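(* Let $\Omega\subset\mathbb{R}^n$ be a bounded Lipschitz domain and let $\alpha,\beta\in L^\infty(\Omega,C\ell_{0,n})$. Then the Hilbert space $L^2(\Omega,C\ell_{0,n})$ admits the orthogonal decomposition $$L^2(\Omega,C\ell_{0,n})=A^2_{\alpha,\beta}(\Omega,C\ell_{0,n})\oplus (D-M^{\alpha}C-\overline{\beta})\,W_0^{1,2}(\Omega,C\ell_{0,n})$$ with respect to the scalar product $\langle u,v\rangle_{0,L^2}=\mathrm{Sc}\int_\Omega \overline{u}\,v\,d\sigma$.
   Context: $C\ell_{0,n}$ is the real Clifford algebra generated by $e_1,\dots,e_n$ (with $e_0=1$) subject to $e_ie_j+e_je_i=-2\delta_{ij}$; its basis consists of $1$ and the products $e_A=e_{i_1}\cdots e_{i_k}$, $A=\{i_1<\dots<i_k\}\subseteq\{1,\dots,n\}$. Conjugation $a\mapsto\overline a$ is the real-linear anti-automorphism with $\overline{ab}=\overline b\,\overline a$, $\overline{1}=1$, $\overline{e_i}=-e_i$; $\mathrm{Sc}\,a$ is the coefficient of $1$ in $a$. $L^p(\Omega,C\ell_{0,n})$ and $W_0^{1,2}(\Omega,C\ell_{0,n})$ (the elements of $W^{1,2}$ with vanishing trace) are the spaces of $C\ell_{0,n}$-valued functions whose real components lie in the corresponding real function spaces; $d\sigma$ is Lebesgue measure on $\Omega$. $D=\sum_{i=1}^n e_i\partial_i$ (Moisil-Teodorescu operator, acting from the left). $C$ denotes the conjugation operator $C[w]=\overline w$ and $M^\alpha$ the right multiplication operator $M^\alpha[w]=w\,\alpha$,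 so that $(D-M^\alpha C-\overline\beta)h=Dh-\overline h\,\alpha-\overline\beta\,h$. The generalized Vekua space $A^2_{\alpha,\beta}(\Omega,C\ell_{0,n})$ is the (real) subspace of all $w\in L^2(\Omega,C\ell_{0,n})$ satisfying the Vekua equation $Dw=\alpha\,\overline w+\beta w$ in $\Omega$ in the sense of distributions. *)

(* Defs.v *)
From HB Require Import structures.
From mathcomp Require Import all_boot all_order all_algebra.
From mathcomp Require Import ring.
Set Implicit Arguments.
Unset Strict Implicit.
Unset Printing Implicit Defensive.
Import Order.TTheory GRing.Theory Num.Theory.
Local Open Scope ring_scope.

Definition symd (T : finType) (A B : {set T}) : {set T} :=
  [set i | (i \in A) (+) (i \in B)].

Definition clifford (R : comNzRingType) (n : nat) : Type :=
  {ffun {set 'I_n} -> R^o}.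

Section clifford.
Context {R : comNzRingType} {n : nat}.
Implicit Types (A B C : {set 'I_n}) (a b c : clifford R n).

HB.instance Definition _ := GRing.Lmodule.on (clifford R n).

(* The basis element e_A = e_{i_1} ... e_{i_k}; see [bladeE]. *)
Definition blade A : clifford R n := [ffun B => (B == A)%:R].

(* e_A e_B = (-1)^(blade_exp A B) e_{A symd B}: every pair a > b costs one
   transposition, and every common index one factor e_i e_i = -1. *)
Definition blade_exp A B : nat :=
  (\sum_(i in A) \sum_(j in B) (j <= i))%N.

Definition clmul a b : clifford R n :=
  \sum_A \sum_B ((-1) ^+ blade_exp A B * a A * b B) *: blade (symd A B).

Definition clgen (i : 'I_n) : clifford R n := blade [set i].

(* conj e_A = (-1)^(k (k + 1) / 2) e_A for k = #|A|; [clconj1], [clconj_gen]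
   and [clconjM] show that this is the anti-automorphism e_i |-> - e_i. *)
Definition clconj a : clifford R n :=
  [ffun A : {set 'I_n} => (-1) ^+ 'C(#|A|.+1, 2) * a A].

Definition clSc a : R := a set0.

Lemma symdA : associative (@symd 'I_n).
Proof. by move=> A B C; apply/setP => i; rewrite !inE addbA. Qed.
Lemma symdC : commutative (@symd 'I_n).
Proof. by move=> A B; apply/setP => i; rewrite !inE addbC. Qed.
Lemma symd0 A : symd A set0 = A.
Proof. by apply/setP => i; rewrite !inE addbF. Qed.
Lemma symd0l A : symd set0 A = A.
Proof. by rewrite symdC symd0. Qed.
Lemma symdd A : symd A A = set0.
Proof. by apply/setP => i; rewrite !inE addbb. Qed.

Let odd_bexp A B : odd (blade_exp A B) =
  \big[addb/false]_i \big[addb/false]_j [&& i \in A, j \in B & (j <= i)%N].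
Proof.
rewrite /blade_exp (big_morph odd oddD (erefl _)) big_mkcond.
apply: eq_bigr => i _; case: (i \in A) => /=; last by rewrite big1.
rewrite (big_morph odd oddD (erefl _)) big_mkcond.
by apply: eq_bigr => j _; case: (j \in B) => //=; rewrite oddb.
Qed.

Let bexpDl A B C :
  odd (blade_exp (symd A B) C) = odd (blade_exp A C) (+) odd (blade_exp B C).
Proof.
rewrite !odd_bexp -big_split; apply: eq_bigr => i _ /=.
rewrite -big_split; apply: eq_bigr => j _ /=; rewrite inE.
by case: (i \in A); case: (i \in B); case: (j \in C); case: (_ <= _)%N.
Qed.

Let bexpDr A B C :
  odd (blade_exp C (symd A B)) = odd (blade_exp C A) (+) odd (blade_exp C B).
Proof.
rewrite !odd_bexp -big_split; apply: eq_bigr => i _ /=.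
rewrite -big_split; apply: eq_bigr => j _ /=; rewrite inE.
by case: (i \in C); case: (j \in A); case: (j \in B); case: (_ <= _)%N.
Qed.

Lemma clifford_blade a : a = \sum_A a A *: blade A.
Proof.
apply/ffunP => B; rewrite sum_ffunE (bigD1 B)//= big1 => [|A /negPf AB].
  by rewrite !ffunE eqxx addr0 [RHS]mulr1.
by rewrite !ffunE eq_sym AB [LHS]mulr0.
Qed.

Lemma clmul_bladeE A B :
  clmul (blade A) (blade B) = (-1) ^+ blade_exp A B *: blade (symd A B).
Proof.
rewrite /clmul (bigD1 A)//= (bigD1 B)//= !ffunE !eqxx !mulr1.
rewrite big1 ?addr0 => [|C /negPf CB]; last by rewrite ffunE CB mulr0 scale0r.
rewrite big1 ?addr0// => C /negPf CA; rewrite big1// => D _.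
by rewrite ffunE CA mulr0 mul0r scale0r.
Qed.

Let clmulDl : left_distributive clmul +%R.
Proof.
move=> a b c; rewrite /clmul -big_split; apply: eq_bigr => A _ /=.
rewrite -big_split; apply: eq_bigr => B _ /=.
by rewrite ffunE mulrDr mulrDl scalerDl.
Qed.

Let clmulDr : right_distributive clmul +%R.
Proof.
move=> a b c; rewrite /clmul -big_split; apply: eq_bigr => A _ /=.
rewrite -big_split; apply: eq_bigr => B _ /=.
by rewrite ffunE mulrDr scalerDl.
Qed.

Let clmulZl k a b : clmul (k *: a) b = k *: clmul a b.
Proof.
rewrite /clmul scaler_sumr; apply: eq_bigr => A _ /=.
rewrite scaler_sumr; apply: eq_bigr => B _ /=.
by rewrite ffunE scalerA; congr (_ *: _); rewrite !mulrA [_ * k]mulrC.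
Qed.

Let clmulZr k a b : clmul a (k *: b) = k *: clmul a b.
Proof.
rewrite /clmul scaler_sumr; apply: eq_bigr => A _ /=.
rewrite scaler_sumr; apply: eq_bigr => B _ /=.
by rewrite ffunE scalerA; congr (_ *: _); rewrite mulrCA.
Qed.

Let clmul0l a : clmul 0 a = 0.
Proof. by have := clmulZl 0 0 a; rewrite !scale0r. Qed.

Let clmul0r a : clmul a 0 = 0.
Proof. by have := clmulZr 0 a 0; rewrite !scale0r. Qed.

Let clmul_suml (F : {set 'I_n} -> clifford R n) b :
  clmul (\sum_A F A) b = \sum_A clmul (F A) b.
Proof. exact: (big_morph (clmul ^~ b) (fun x y => clmulDl x y b) (clmul0l b)). Qed.

Let clmul_sumr (F : {set 'I_n} -> clifford R n) b :
  clmul b (\sum_A F A) = \sum_A clmul b (F A).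
Proof. exact: (big_morph (clmul b) (clmulDr b) (clmul0r b)). Qed.

Let clmul1l : left_id (blade set0) clmul.
Proof.
move=> a; rewrite [in LHS](clifford_blade a) [RHS](clifford_blade a).
rewrite clmul_sumr; apply: eq_bigr => A _.
by rewrite clmulZr clmul_bladeE symd0l /blade_exp big_set0 scale1r.
Qed.

Let clmul1r : right_id (blade set0) clmul.
Proof.
move=> a; rewrite [in LHS](clifford_blade a) [RHS](clifford_blade a).
rewrite clmul_suml; apply: eq_bigr => A _.
rewrite clmulZl clmul_bladeE symd0 /blade_exp big1 ?scale1r// => i _.
by rewrite big_set0.
Qed.

Let clmulA_blade A B C : clmul (blade A) (clmul (blade B) (blade C)) =
  clmul (clmul (blade A) (blade B)) (blade C).
Proof.
rewrite !(clmul_bladeE, clmulZl, clmulZr, scalerA) symdA; congr (_ *: _).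
have sg X Y : (-1) ^+ blade_exp X Y = (-1) ^+ odd (blade_exp X Y) :> R.
  by rewrite signr_odd.
rewrite !sg bexpDr bexpDl !signr_addb.
by rewrite mulrC mulrA.
Qed.

Let clmulA : associative clmul.
Proof.
move=> a b c; rewrite (clifford_blade a).
set F := fun A => a A *: blade A.
rewrite (clmul_suml F (clmul b c)) (clmul_suml F b) clmul_suml.
apply: eq_bigr => A _; rewrite /F !clmulZl; congr (_ *: _).
rewrite {F} (clifford_blade b); set F := fun B => b B *: blade B.
rewrite (clmul_suml F c) (clmul_sumr F (blade A)) clmul_suml clmul_sumr.
apply: eq_bigr => B _; rewrite /F !(clmulZl, clmulZr); congr (_ *: _).
rewrite {F} (clifford_blade c); set F := fun C => c C *: blade C.
rewrite (clmul_sumr F (blade B)) (clmul_sumr _ (blade A)).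
rewrite (clmul_sumr F (clmul _ _)).
apply: eq_bigr => C _; rewrite /F !clmulZr; congr (_ *: _).
exact: clmulA_blade.
Qed.

Let clmul1_neq0 : blade set0 != 0.
Proof. by apply/eqP => /ffunP/(_ set0)/eqP; rewrite !ffunE eqxx oner_eq0. Qed.

HB.instance Definition _ := GRing.Zmodule_isNzRing.Build (clifford R n)
  clmulA clmul1l clmul1r clmulDl clmulDr clmul1_neq0.

Lemma clmulE a b : a * b = clmul a b. Proof. by []. Qed.

HB.instance Definition _ := GRing.Lmodule_isLalgebra.Build R (clifford R n)
  (fun k a b => esym (clmulZl k a b)).
HB.instance Definition _ := GRing.Lalgebra_isAlgebra.Build R (clifford R n)
  (fun k a b => esym (clmulZr k a b)).

Lemma blade0 : blade set0 = 1. Proof. by []. Qed.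

Lemma clgen_anticomm i j :
  clgen i * clgen j + clgen j * clgen i = - ((i == j)%:R *+ 2).
Proof.
rewrite !clmulE !clmul_bladeE /blade_exp !big_set1.
have [->|ij] := eqVneq i j; first by rewrite symdd leqnn expr1 scaleN1r mulr2n opprD.
rewrite (symdC [set j]) -scalerDl mul0rn oppr0.
have : (i != j :> nat)%N by [].
by case: ltngtP => // _ _; rewrite expr0 expr1 (subrr, addNr) scale0r.
Qed.

Lemma bladeE A : blade A = \prod_(i <- enum A) clgen i.
Proof.
have H (s : seq 'I_n) : sorted ltn (map val s) ->
    blade [set i in s] = \prod_(i <- s) clgen i.
  elim: s => [_|i s IH hs]; first by rewrite big_nil -blade0; congr blade; apply/setP => x; rewrite !inE.
  rewrite big_cons -IH; last exact: path_sorted hs.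
  have hs' j : j \in s -> (i < j)%N.
    move=> js; have /allP := order_path_min ltn_trans hs; apply.
    by apply/mapP; exists j.
  rewrite clmulE clmul_bladeE /blade_exp big_set1 big1 ?scale1r; last first.
    by move=> j; rewrite inE => /hs' ij; rewrite leqNgt ij.
  congr blade; apply/setP => j; rewrite !inE.
  have [->|//] := eqVneq j i; apply/esym/negP => /hs'; by rewrite ltnn.
rewrite -H; first by congr blade; apply/setP => i; rewrite inE mem_enum.
rewrite sorted_map {1}/enum_mem; apply: sorted_filter.
  by move=> x y z; exact: ltn_trans.
by rewrite -sorted_map -enumT val_enum_ord iota_ltn_sorted.
Qed.

Lemma clconj_is_linear : linear clconj.
Proof.
move=> k a b; apply/ffunP => A; rewrite !ffunE mulrDr; congr (_ + _).
by rewrite [LHS]mulrCA.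
Qed.
HB.instance Definition _ := GRing.isLinear.Build R (clifford R n) (clifford R n)
  *:%R clconj clconj_is_linear.

Lemma clconj1 : clconj 1 = 1.
Proof.
apply/ffunP => A; rewrite !ffunE; have [->|] := eqVneq A set0; last by rewrite mulr0.
by rewrite cards0 bin_small// mul1r.
Qed.

Lemma clconj_gen i : clconj (clgen i) = - clgen i.
Proof.
apply/ffunP => A; rewrite !ffunE; have [->|] := eqVneq A [set i]; last by rewrite mulr0 oppr0.
by rewrite cards1 binn mulr1.
Qed.

Let bexp_diag A : blade_exp A A = 'C(#|A|.+1, 2).
Proof.
apply: double_inj; rewrite -[LHS]addnn.
have -> : (blade_exp A A + blade_exp A A)%N = (\sum_(i in A) \sum_(j in A) (1 + (i == j)))%N.
  rewrite {2}/blade_exp exchange_big -big_split; apply: eq_bigr => i _ /=.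
  rewrite -big_split; apply: eq_bigr => j _ /=.
  by rewrite -val_eqE/=; case: ltngtP.
have -> : (\sum_(i in A) \sum_(j in A) (1 + (i == j)) = #|A| * #|A|.+1)%N.
  rewrite -sum_nat_const; apply: eq_bigr => i iA; rewrite big_split/= sum1_card.
  by rewrite (bigD1 i)//= eqxx big1 ?addn0 ?addn1// => j /andP[_]; rewrite eq_sym => /negPf->.
move: #|A| => m; rewrite bin2 succnK [in RHS]mulnC even_halfK//.
by rewrite oddM oddS andbN.
Qed.

Let clconj_blade A : clconj (blade A) = (-1) ^+ blade_exp A A *: blade A.
Proof.
apply/ffunP => B; rewrite !ffunE bexp_diag.
by have [->//|] := eqVneq B A; rewrite mulr0 [RHS]mulr0.
Qed.

Let clconjM_blade A B :
  clconj (blade A * blade B) = clconj (blade B) * clconj (blade A).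
Proof.
rewrite !clconj_blade -scalerAl -scalerAr !clmulE !clmul_bladeE linearZ/=.
rewrite clconj_blade (symdC B) !scalerA; congr (_ *: _).
have sg X Y : (-1) ^+ blade_exp X Y = (-1) ^+ odd (blade_exp X Y) :> R.
  by rewrite signr_odd.
rewrite !sg bexpDl !bexpDr -!signr_addb; congr (_ ^+ nat_of_bool _).
by do 4 case: (odd _).
Qed.

Lemma clconjM a b : clconj (a * b) = clconj b * clconj a.
Proof.
rewrite (clifford_blade a) mulr_suml !linear_sum mulr_sumr.
apply: eq_bigr => A _; rewrite -scalerAl !linearZ/= -scalerAr.
congr (_ *: _); rewrite (clifford_blade b) mulr_sumr !linear_sum mulr_suml.
apply: eq_bigr => B _; rewrite -scalerAr !linearZ/= -scalerAl.
by congr (_ *: _); exact: clconjM_blade.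
Qed.
End clifford.

From mathcomp Require Import all_classical all_reals all_analysis.
Import numFieldNormedType.Exports.
Local Open Scope classical_set_scope.
Local Open Scope ring_scope.

(* The coordinate sigma-algebra on R^n, that is, its Borel sigma-algebra. *)
Section measurable_rV.
Context {R : realType} {n : nat}.
Let coord (i : 'I_n) (x : 'rV[R]_n) : R := x ord0 i.
Let rV0 : g_sigma_preimage coord set0. Proof. exact: sigma_algebra0. Qed.
Let rVC A : g_sigma_preimage coord A -> g_sigma_preimage coord (~` A).
Proof. exact: sigma_algebraC. Qed.
Let rVU (F : (set 'rV[R]_n)^nat) : (forall i, g_sigma_preimage coord (F i)) ->
  g_sigma_preimage coord (\bigcup_i (F i)).
Proof. exact: sigma_algebra_bigcup. Qed.
HB.instance Definition _ := @isMeasurable.Build default_measure_display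
  'rV[R]_n (g_sigma_preimage coord) rV0 rVC rVU.
End measurable_rV.

Section rV.
Context {R : realType}.
Lemma measurable_coord n (i : 'I_n) :
  measurable_fun [set: 'rV[R]_n] (fun x => x ord0 i).
Proof.
move=> _ Y mY; rewrite setTI; apply: sub_sigma_algebra => /=.
rewrite -bigcup_seq/=; exists i => /=; first by rewrite mem_index_enum.
by exists Y => //; rewrite setTI.
Qed.

Lemma measurable_fun_coordP d (T : measurableType d) n (f : T -> 'rV[R]_n) :
  (forall i, measurable_fun [set: T] (fun x => f x ord0 i)) ->
  measurable_fun [set: T] f.
Proof.
move=> mf.
suff : g_sigma_preimage (fun i x => f x ord0 i) `<=` @measurable _ T.
  pose c (i : 'I_n) (x : 'rV[R]_n) := x ord0 i.
  rewrite (_ : (fun i x => _) = (fun i => c i \o f))//.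
  by rewrite g_sigma_preimage_comp => h _ A mA; apply: h; exists A.
apply: smallest_sub; first exact: sigma_algebra_measurable.
rewrite -bigcup_seq => A [i _ [B mB <-]].
exact: mf.
Qed.

Definition vcons n (t : R) (x : 'rV[R]_n) : 'rV[R]_n.+1 := row_mx t%:M x.

Lemma vcons0 n t (x : 'rV[R]_n) : vcons t x ord0 ord0 = t.
Proof.
transitivity (row_mx t%:M x ord0 (lshift n ord0)); last by rewrite row_mxEl mxE.
by congr (row_mx _ _ _ _); exact: val_inj.
Qed.

Lemma vconsS n t (x : 'rV[R]_n) i : vcons t x ord0 (lift ord0 i) = x ord0 i.
Proof.
transitivity (row_mx t%:M x ord0 (rshift 1 i)); last by rewrite row_mxEr.
by congr (row_mx _ _ _ _); exact: val_inj.
Qed.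

Definition vbehead n (x : 'rV[R]_n.+1) : 'rV[R]_n := \row_i x ord0 (lift ord0 i).

Lemma vconsK n t (x : 'rV[R]_n) : vbehead (vcons t x) = x.
Proof. by apply/rowP => i; rewrite mxE vconsS. Qed.

Lemma measurable_vcons n :
  measurable_fun [set: measurableTypeR R * 'rV[R]_n] (fun p => vcons p.1 p.2).
Proof.
apply: measurable_fun_coordP => i; case: (unliftP ord0 i) => [j|] ->.
  rewrite (_ : (fun _ => _) = (fun x : 'rV[R]_n => x ord0 j) \o snd).
    exact: (measurableT_comp (measurable_coord j)).
  by apply/funext => -[t x]; rewrite vconsS.
rewrite (_ : (fun _ => _) = fst)//.
by apply/funext => -[t x]; rewrite vcons0.
Qed.

Lemma measurable_vbehead n : measurable_fun [set: 'rV[R]_n.+1] (@vbehead n).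
Proof.
apply: measurable_fun_coordP => i.
rewrite (_ : (fun _ => _) = fun x : 'rV[R]_n.+1 => x ord0 (lift ord0 i)).
  exact: measurable_coord.
by apply/funext => x; rewrite mxE.
Qed.

Definition leb_cons n (mu : {sigma_finite_measure set 'rV[R]_n -> \bar R}) :
    set 'rV[R]_n.+1 -> \bar R :=
  pushforward (lebesgue_measure \x mu)%E (fun p => vcons p.1 p.2).

Section leb_cons.
Variables (n : nat) (mu : {sigma_finite_measure set 'rV[R]_n -> \bar R}).

Let m0 : leb_cons mu set0 = 0%E.
Proof. by rewrite /leb_cons/pushforward preimage_set0 measure0. Qed.
Let m_ge0 A : (0 <= leb_cons mu A)%E.
Proof. by rewrite /leb_cons/pushforward; exact: measure_ge0. Qed.
Let m_sigma : semi_sigma_additive (leb_cons mu).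
Proof.
exact: (@measure_semi_sigma_additive _ _ _
  (measure_function_pushforward__canonical__measure_function_Measure
     (lebesgue_measure \x mu)%E (@measurable_vcons n))).
Qed.
HB.instance Definition _ := isMeasure.Build _ _ _ (leb_cons mu) m0 m_ge0 m_sigma.

Let m_sigma_finite : sigma_finite setT (leb_cons mu).
Proof.
have /sigma_finiteP[F [FT ndF mF]] := sigma_finiteT (@lebesgue_measure R).
have /sigma_finiteP[G [GT ndG mG]] := sigma_finiteT mu.
pose u (x : 'rV[R]_n.+1) : measurableTypeR R * 'rV[R]_n := (x ord0 ord0, vbehead x).
have mu' : measurable_fun setT u.
  apply: measurable_fun_pair; [exact: measurable_coord|exact: measurable_vbehead].
exists (fun k => u @^-1` (F k `*` G k)).
  apply/esym; rewrite -subTset => x _.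
  have : (\bigcup_i F i) (u x).1 by rewrite -FT.
  have : (\bigcup_i G i) (u x).2 by rewrite -GT.
  move=> [l _ Glx] [k _ Fkx]; exists (maxn k l) => //; split.
    by move: Fkx; exact/subsetPset/ndF/leq_maxl.
  by move: Glx; exact/subsetPset/ndG/leq_maxr.
move=> k; have [mFk Fk] := mF k; have [mGk Gk] := mG k; split.
  by rewrite -[X in measurable X]setTI; apply: mu' => //; exact: measurableX.
rewrite /leb_cons /pushforward (_ : _ @^-1` _ = F k `*` G k).
  by rewrite product_measure1E// lte_mul_pinfty// ge0_fin_numE.
by apply/seteqP; split => -[t x] /=; rewrite vcons0 vconsK.
Qed.

HB.instance Definition _ := Measure_isSigmaFinite.Build _ _ _ (leb_cons mu) m_sigma_finite.
End leb_cons.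

(* Lebesgue measure on R^n, as an iterated product; cf. [leb_box]. *)
Fixpoint leb n : {sigma_finite_measure set 'rV[R]_n -> \bar R} :=
  if n is n'.+1 then leb_cons (leb n') else \d_(0 : 'rV[R]_0).

Lemma leb_box n (a b : 'rV[R]_n) : (forall i, a ord0 i <= b ord0 i) ->
  leb n [set x : 'rV[R]_n | forall i, x ord0 i \in `[a ord0 i, b ord0 i]] =
  (\prod_i (b ord0 i - a ord0 i))%:E.
Proof.
elim: n a b => [a b _|n IH a b ab] /=.
  by rewrite diracE big_ord0 mem_set// => -[].
rewrite /leb_cons /pushforward.
transitivity ((lebesgue_measure \x leb n)%E (`[a ord0 ord0, b ord0 ord0]%classic `*`
   [set x : 'rV[R]_n | forall i, x ord0 i \in `[vbehead a ord0 i, vbehead b ord0 i]])).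
  congr (_ _); apply/seteqP; split => -[t x]/=.
    move=> h; split; first by have := h ord0; rewrite vcons0.
    by move=> i; rewrite !mxE; have := h (lift ord0 i); rewrite vconsS.
  move=> [ht hx] i; case: (unliftP ord0 i) => [j|] ->; last by rewrite vcons0.
  by rewrite vconsS; have := hx j; rewrite !mxE.
rewrite product_measure1E//; last first.
  rewrite (_ : mkset _ = \bigcap_(i in [set: 'I_n])
     ((fun x : 'rV[R]_n => x ord0 i) @^-1` `[vbehead a ord0 i, vbehead b ord0 i]%classic)).
    apply: fin_bigcap_measurable => [|i _]; first exact: finite_finset.
    by rewrite -[X in measurable X]setTI; apply: measurable_coord.
  by apply/seteqP; split => x /= h i => [_|]; exact: h.
rewrite IH => [|i]; last by rewrite !mxE.
have /= -> := lebesgue_measure_itv `[a ord0 ord0, b ord0 ord0].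
rewrite lte_fin big_ord_recl EFinM.
under eq_bigr do rewrite !mxE.
have := ab ord0; rewrite le_eqVlt => /predU1P[->|->//].
by rewrite ltxx subrr.
Qed.
End rV.

Section function_spaces.
Context {R : realType}.
Local Notation Rn n := 'rV[R]_n.

Definition partial n (i : 'I_n) (f : Rn n -> R) : Rn n -> R :=
  fun x => 'D_(delta_mx ord0 i) f x.

Definition smooth n (f : Rn n -> R) : Prop :=
  forall (s : seq 'I_n) (x : Rn n), differentiable (foldr (@partial n) f s) x.

Definition test_function n (Om : set (Rn n)) (phi : Rn n -> R) : Prop :=
  smooth phi /\
  (let S := closure [set x | phi x != 0] in compact S /\ S `<=` Om).

(* A function on Om is represented by a total function whose values outside
   Om are irrelevant, as [f \_ Om] replaces them by 0. *)
Definition LpF n (Om : set (Rn n)) (p : \bar R) (f : Rn n -> R) : Prop :=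
  f \_ Om \in Lfun (leb n) p.

Definition L2norm n (Om : set (Rn n)) (f : Rn n -> R) : \bar R :=
  'N[leb n]_2%:E [EFin \o (f \_ Om)].

Definition is_weak_partial n (Om : set (Rn n)) (i : 'I_n) (f g : Rn n -> R) :=
  forall phi, test_function Om phi ->
    \int[leb n]_(x in Om) (f x * partial i phi x) =
    - \int[leb n]_(x in Om) (g x * phi x).

Definition W12 n (Om : set (Rn n)) (f : Rn n -> R) : Prop :=
  LpF Om 2%:E f /\
  forall i, exists2 g, LpF Om 2%:E g & is_weak_partial Om i f g.

(* The weak partial derivative of f, determined almost everywhere in Om
   (an arbitrary function if it does not exist in L^2). *)
Definition wpartial n (Om : set (Rn n)) (i : 'I_n) (f : Rn n -> R) : Rn n -> R :=
  xget (cst 0) [set g | LpF Om 2%:E g /\ is_weak_partial Om i f g].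

Definition W12norm n (Om : set (Rn n)) (f : Rn n -> R) : \bar R :=
  (L2norm Om f + \sum_(i < n) L2norm Om (wpartial Om i f))%E.

(* A local description of a domain of R^(n+1) as a strict epigraph: in the
   orthonormal coordinates (t, y) in R * R^n with origin [chart_org] and frame
   given by the rows of [chart_rot], on the cylinder |t| < [chart_ht],
   |y| < [chart_rad]. *)
Record chart n := Chart {
  chart_org : Rn n.+1;
  chart_rot : 'M[R]_n.+1;
  chart_ht : R;
  chart_rad : R;
  chart_gr : Rn n -> R }.

Definition chart_pt n (k : chart n) (t : R) (y : Rn n) : Rn n.+1 :=
  chart_org k + vcons t y *m chart_rot k.

Definition chart_base n (k : chart n) : set (Rn n) :=
  [set y | `|y| < chart_rad k].

Record lipschitz_chart n (Om : set (Rn n.+1)) (k : chart n) : Prop := {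
  chart_orthogonal : chart_rot k *m (chart_rot k)^T = 1%:M;
  chart_ht_gt0 : 0 < chart_ht k;
  chart_rad_gt0 : 0 < chart_rad k;
  chart_gr_lipschitz : exists L : R, L.-lipschitz (chart_gr k);
  chart_gr_lt : forall y, chart_base k y -> `|chart_gr k y| < chart_ht k;
  chart_epigraph : forall t y, `|t| < chart_ht k -> chart_base k y ->
    Om (chart_pt k t y) <-> chart_gr k y < t }.

Record bounded_lipschitz_domain n (Om : set (Rn n.+1)) : Prop := {
  domain_open : open Om;
  domain_nonempty : Om !=set0;
  domain_connected : connected Om;
  domain_bounded : bounded_set Om;
  domain_lipschitz : forall p, (closure Om `\` Om) p ->
    exists k t y, [/\ lipschitz_chart Om k, `|t| < chart_ht k,
                      chart_base k y & p = chart_pt k t y] }.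

Definition on_graph n (k : chart n) (g : Rn n.+1 -> R) : Rn n -> R :=
  fun y => g (chart_pt k (chart_gr k y) y).

(* g is the trace of f on the boundary of Om: the limit in L^2 of the boundary
   of the restrictions of functions smooth up to the boundary that converge to
   f in W^{1,2}(Om). The topology of L^2 of the boundary is that of the L^2
   norms in the local Lipschitz graph parametrizations. *)
Definition is_trace n (Om : set (Rn n.+1)) (f g : Rn n.+1 -> R) : Prop :=
  (forall k, lipschitz_chart Om k ->
    LpF (chart_base k) 2%:E (on_graph k g)) /\
  exists v : nat -> Rn n.+1 -> R,
  [/\ forall j, smooth (v j),
      W12norm Om (v j \- f) @[j --> \oo] --> 0%E &
      forall k, lipschitz_chart Om k ->
       L2norm (chart_base k) (on_graph k (v j \- g)) @[j --> \oo] --> 0%E].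

Definition W012 n (Om : set (Rn n.+1)) (f : Rn n.+1 -> R) : Prop :=
  W12 Om f /\ is_trace Om f (cst 0).

End function_spaces.

Section clifford_valued.
Context {R : realType} {n : nat}.
Local Notation Cl := (clifford R n.+1).
Variable Om : set 'rV[R]_n.+1.
Implicit Types u v w h f alpha beta : 'rV[R]_n.+1 -> Cl.

Definition coef (A : {set 'I_n.+1}) w : 'rV[R]_n.+1 -> R := fun x => w x A.

Definition clLp (p : \bar R) w : Prop := forall A, LpF Om p (coef A w).

Definition clW012 w : Prop := forall A, W012 Om (coef A w).

Definition clint f : Cl :=
  [ffun A => \int[leb n.+1]_(x in Om) coef A f x].

Definition ip u v : R := clSc (clint (fun x => clconj (u x) * v x)).

Definition Dirac h : 'rV[R]_n.+1 -> Cl := fun x =>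
  \sum_(i < n.+1) clgen i * [ffun A => wpartial Om i (coef A h) x].

Definition distributional_Dirac w f : Prop :=
  forall phi, test_function Om phi ->
    - \sum_(i < n.+1) clgen i * clint (fun x => partial i phi x *: w x) =
    clint (fun x => phi x *: f x).

Definition vekua_space alpha beta : set ('rV[R]_n.+1 -> Cl) :=
  [set w | clLp 2%:E w /\
    distributional_Dirac w (fun x => alpha x * clconj (w x) + beta x * w x)].

Definition vekua_adj alpha beta h : 'rV[R]_n.+1 -> Cl := fun x =>
  Dirac h x - clconj (h x) * alpha x - clconj (beta x) * h x.

(* The image of W_0^{1,2}, closed under almost everywhere equality. *)
Definition vekua_adj_range alpha beta : set ('rV[R]_n.+1 -> Cl) :=
  [set f | clLp 2%:E f /\
    exists2 h, clW012 h & f = vekua_adj alpha beta h %[ae leb n.+1 in Om]].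

Record L2_subspace (U : set ('rV[R]_n.+1 -> Cl)) : Prop := {
  L2_subspace_sub : forall u, U u -> clLp 2%:E u;
  L2_subspace0 : U (fun=> 0);
  L2_subspace_lin : forall (a : R) u v, U u -> U v ->
    U (fun x => a *: u x + v x) }.

(* L^2(Om, Cl) is the orthogonal direct sum of U and W for [ip]. *)
Record L2_orthogonal_decomposition (U W : set ('rV[R]_n.+1 -> Cl)) : Prop := {
  L2_decomp_subl : L2_subspace U;
  L2_decomp_subr : L2_subspace W;
  L2_decomp_orth : forall u w, U u -> W w -> ip u w = 0;
  L2_decomp_sum : forall f, clLp 2%:E f -> exists u w, [/\ U u, W w &
    f = (fun x => u x + w x) %[ae leb n.+1 in Om]];
  L2_decomp_direct : forall f, U f -> W f ->
    f = (fun=> 0) %[ae leb n.+1 in Om] }.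

End clifford_valued.

(* Main.v *)
(* The Vekua space is the orthogonal complement of the image of the test
   functions under T = D - M^alpha C - conj(beta), because T is the formal
   adjoint of w |-> Dw - alpha conj(w) - beta w for the real scalar product.
   It remains to identify the closure of that image with the image of W_0^{1,2}.

   The closure is contained in the image: by |D phi| = |grad phi| in L^2 and by
   a Poincare inequality |phi| <= e |grad phi|, valid modulo finitely many mean
   values over small cells, T controls the W^{1,2} norm on a subspace of finite
   codimension; so a sequence of test functions whose images converge can be
   corrected by elements of the kernel so as to converge in W^{1,2}.

   The image is contained in the closure: by the divergence theorem in Lipschitz
   charts, a function with vanishing trace is still weakly differentiable after
   extension by zero; a partition of unity, small shifts into the domain and
   mollification then approximate it by test functions in W^{1,2}. *)

Require Import Defs.
From HB Require Import structures.
From mathcomp Require Import all_boot all_order all_algebra.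
From mathcomp Require Import all_classical all_reals all_analysis.
From mathcomp Require Import measurable_realfun ess_sup_inf ring lra.
Set Implicit Arguments.
Unset Strict Implicit.
Unset Printing Implicit Defensive.
Import Order.TTheory GRing.Theory Num.Def Num.Theory.
Import numFieldNormedType.Exports.
Local Open Scope classical_set_scope.
Local Open Scope ring_scope.

(** * Seminorms and inner products *)

Section seminorms.
Context {R : realType} {V : lmodType R}.
Implicit Types (X : V -> Prop) (p q : V -> R) (d : nat -> V).

(** [alpha] and [beta] are bounded but of any size, so the zero-order part of T is not small against
    D and a Poincare inequality on Om itself does not absorb it. It is absorbed by one whose
    constant is proportional to the mesh of a grid; the mesh is chosen from the bounds of the
    coefficients, at the price of one mean value per cell and Clifford component. This plays the
    part of Rellich compactness, and [cauchy_lift] plays that of Fredholm theory: it turns an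
    estimate on the common kernel of finitely many functionals into a statement on sequences.

    Conjugation makes T only real-linear, so everything refers to the real scalar product, for which
    Sc (conj a b) is the Euclidean product of the components.

    At the boundary there is neither a surface measure nor a normal: traces are given in graph
    coordinates. The divergence theorem is therefore used as an upper bound for a boundary integral,
    obtained by shifting the indicator of Om by h and estimating the strip where it changes.
    Integration by parts for test functions is likewise derived from the translation invariance of
    Lebesgue measure. *)

Record is_subspace X : Prop := {
  subspace0 : X 0;
  subspace_lin : forall a u v, X u -> X v -> X (a *: u + v) }.

Lemma subspaceD X u v : is_subspace X -> X u -> X v -> X (u + v).
Proof. by move=> sX Xu Xv; rewrite -[u]scale1r; exact: subspace_lin. Qed.

Lemma subspaceZ X a u : is_subspace X -> X u -> X (a *: u).
Proof. by move=> sX Xu; rewrite -[_ *: _]addr0; apply: subspace_lin => //; exact: subspace0. Qed.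

Lemma subspaceB X u v : is_subspace X -> X u -> X v -> X (u - v).
Proof. by move=> sX Xu Xv; rewrite addrC -scaleN1r; exact: subspace_lin. Qed.

Record seminorm_on X p : Prop := {
  seminorm_ge0 : forall u, X u -> 0 <= p u;
  seminormD : forall u v, X u -> X v -> p (u + v) <= p u + p v;
  seminormZ : forall a u, X u -> p (a *: u) = `|a| * p u }.

(** Stated for a bare function p, so that several seminorms can be compared on one space without
    giving it a topology. *)
Definition cauchy_for p d := forall e : R, 0 < e ->
  exists N, forall k l, (N <= k)%N -> (N <= l)%N -> p (d k - d l) < e.

Definition cvg_for p d x := forall e : R, 0 < e ->
  exists N, forall k, (N <= k)%N -> p (d k - x) < e.

Section on.
Variables (X : V -> Prop) (p : V -> R).
Hypotheses (sX : is_subspace X) (sp : seminorm_on X p).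

Lemma seminorm0 : p 0 = 0.
Proof. by rewrite -(scale0r 0) (seminormZ sp)// ?normr0 ?mul0r//; exact: subspace0. Qed.

Lemma seminormN u : X u -> p (- u) = p u.
Proof. by move=> Xu; rewrite -scaleN1r (seminormZ sp)// normrN1 mul1r. Qed.

Lemma seminormB u v : X u -> X v -> p (u - v) <= p u + p v.
Proof.
move=> Xu Xv; rewrite -(seminormN Xv); apply: (seminormD sp) => //.
by rewrite -scaleN1r; exact: subspaceZ.
Qed.

Lemma seminormBC u v : X u -> X v -> p (u - v) = p (v - u).
Proof. by move=> Xu Xv; rewrite -seminormN ?opprB//; exact: subspaceB. Qed.

Lemma seminorm_trans v u w : X u -> X v -> X w -> p (u - w) <= p (u - v) + p (v - w).
Proof.
move=> Xu Xv Xw; have -> : u - w = (u - v) + (v - w) by rewrite addrA subrK.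
by apply: (seminormD sp); exact: subspaceB.
Qed.

Lemma cauchy_near (d d' : nat -> V) : (forall k, X (d k)) -> (forall k, X (d' k)) ->
  cauchy_for p d -> (forall e : R, 0 < e -> exists N, forall k, (N <= k)%N -> p (d' k - d k) < e) ->
  cauchy_for p d'.
Proof.
move=> Xd Xd' cd dd' e e0.
have e3 : 0 < e / 3 by rewrite divr_gt0.
have [N1 h1] := cd _ e3; have [N2 h2] := dd' _ e3.
exists (maxn N1 N2) => k l; rewrite !geq_max => /andP[k1 k2] /andP[l1 l2].
have h3 := h1 _ _ k1 l1; have h4 := h2 _ k2; have h5 := h2 _ l2.
have t1 := seminorm_trans (Xd' k) (Xd k) (Xd' l).
have t2 := seminorm_trans (Xd k) (Xd l) (Xd' l).
have t3 := seminormBC (Xd l) (Xd' l).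
by lra.
Qed.
End on.

Lemma invS_lt (e : R) : 0 < e -> exists N, forall k, (N <= k)%N -> k.+1%:R^-1 < e.
Proof.
move=> e0; exists (Num.truncn e^-1) => k Nk.
rewrite invf_plt ?posrE//; apply: (lt_le_trans (truncnS_gt _)).
by rewrite ler_nat ltnS.
Qed.

(* Induction on the number of functionals.  When some x in X has l x = 1, write
   phi_k = phi'_k + a_k x with phi'_k in the kernel of l; if q (x - .) has
   infimum 0 on the kernel, x is replaced by elements of the kernel, and
   otherwise the coefficients a_k are Cauchy. *)
Lemma cauchy_lift (s : seq (V -> R)) (p q : V -> R) (c : R) X :
    is_subspace X -> seminorm_on X p -> seminorm_on X q ->
    (forall l, List.In l s -> forall a u v, X u -> X v -> l (a *: u + v) = a * l u + l v) ->
    (forall x, X x -> (forall l, List.In l s -> l x = 0) -> p x <= c * q x) ->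
  forall phi, (forall k, X (phi k)) -> cauchy_for q phi ->
  exists psi, [/\ forall k, X (psi k), cauchy_for p psi &
    forall e : R, 0 < e -> exists N, forall k, (N <= k)%N -> q (psi k - phi k) < e].
Proof.
elim: s X => [|l s IH] X sX pX qX lin pq phi Xphi cphi.
  exists phi; split => //; last first.
    by move=> e e0; exists 0%N => k _; rewrite subrr (seminorm0 sX qX).
  (* The constant c carries no sign; c' makes the division by it legitimate. *)
  move=> e e0; pose c' := maxr c 1.
  have c'0 : 0 < c' by rewrite lt_max ltr01 orbT.
  have [N hN] := cphi _ (divr_gt0 e0 c'0); exists N => k m Nk Nm.
  have Xkm : X (phi k - phi m) by exact: subspaceB.
  have := hN k m Nk Nm; rewrite ltr_pdivlMr// mulrC; apply: le_lt_trans.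
  apply: (le_trans (pq _ Xkm _)); first by [].
  by apply: ler_wpM2r; [exact: (seminorm_ge0 qX)|rewrite le_max lexx].
have linl a u v : X u -> X v -> l (a *: u + v) = a * l u + l v.
  by apply: (lin l); left.
have linZ a u : X u -> l (a *: u) = a * l u.
  have l0 : l 0 = 0.
    have /eqP := linl 1 _ _ (subspace0 sX) (subspace0 sX).
    by rewrite scale1r addr0 mul1r -subr_eq0 opprD addrA subrr sub0r oppr_eq0 => /eqP.
  move=> Xu; have := linl a _ _ Xu (subspace0 sX).
  by rewrite addr0 l0 addr0.
have linB u v : X u -> X v -> l (u - v) = l u - l v.
  by move=> Xu Xv; rewrite addrC -scaleN1r linl// mulN1r addrC.
pose Y v := X v /\ l v = 0.
have sY : is_subspace Y.
  split=> [|a u v [Xu lu] [Xv lv]].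
    split; first exact: subspace0.
    by rewrite -(scale0r 0) linZ ?mul0r//; exact: subspace0.
  split; first exact: subspace_lin.
  by rewrite linl// lu lv mulr0 addr0.
have pY : seminorm_on Y p.
  split=> [u [Xu _]|u v [Xu _] [Xv _]|a u [Xu _]];
  [exact: seminorm_ge0 pX _ Xu|exact: seminormD pX _ _ Xu Xv|exact: seminormZ pX _ _ Xu].
have qY : seminorm_on Y q.
  split=> [u [Xu _]|u v [Xu _] [Xv _]|a u [Xu _]];
  [exact: seminorm_ge0 qX _ Xu|exact: seminormD qX _ _ Xu Xv|exact: seminormZ qX _ _ Xu].
have {}IH := IH Y sY pY qY.
have {}IH : forall phi, (forall k, Y (phi k)) -> cauchy_for q phi ->
  exists psi, [/\ forall k, Y (psi k), cauchy_for p psi &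
    forall e : R, 0 < e -> exists N, forall k, (N <= k)%N -> q (psi k - phi k) < e].
  apply: IH => [l' l's a u v [Xu _] [Xv _]|x [Xx lx] h].
    by apply: lin => //; right.
  by apply: pq => // l' [<-//|]; exact: h.
have [[x Xx lx]|nx] := pselect (exists2 x, X x & l x != 0); last first.
  have [|psi [Ypsi cpsi hpsi]] := IH phi _ cphi.
    by move=> k; split => //; apply/eqP/negP => /negP h; apply: nx; exists (phi k).
  by exists psi; split => // k; have [] := Ypsi k.
wlog lx1 : x Xx lx / l x = 1.
  move=> h; apply: (h ((l x)^-1 *: x)); first exact: subspaceZ.
    by rewrite linZ// mulVf// oner_neq0.
  by rewrite linZ// mulVf.
move: lx1 => {}lx.
pose a k := l (phi k).
pose phi' k := phi k - a k *: x.
have Yphi' k : Y (phi' k).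
  split; first by apply: subspaceB => //; exact: subspaceZ.
  by rewrite linB ?linZ ?lx ?mulr1 ?subrr//; exact: subspaceZ.
have [h|] := pselect (forall e : R, 0 < e -> exists2 y, Y y & q (x - y) < e).
  have /choice[y hy] : forall k, exists y, Y y /\ `|a k| * q (x - y) < k.+1%:R^-1.
    move=> k; have a1 : 0 < `|a k| + 1 by rewrite ltr_wpDl.
    have [|y Yy qy] := h (k.+1%:R^-1 / (`|a k| + 1)); first by rewrite divr_gt0// invr_gt0.
    exists y; split => //; move: qy; rewrite ltr_pdivlMr//; apply: le_lt_trans.
    rewrite mulrC ler_wpM2l ?lerDl//.
    by apply: (seminorm_ge0 qX); apply: subspaceB => //; case: Yy.
  pose phi2 k := phi' k + a k *: y k.
  have Yphi2 k : Y (phi2 k).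
    by apply: subspaceD => //; apply: subspaceZ => //; case: (hy k).
  have phi2_near e : 0 < e -> exists N, forall k, (N <= k)%N -> q (phi2 k - phi k) < e.
    move=> e0; have [N hN] := invS_lt e0; exists N => k Nk.
    apply: lt_trans (hN k Nk); have [[Xy _] +] := hy k; apply: le_lt_trans.
    rewrite -(seminormZ qX)//; last exact: subspaceB.
    rewrite (seminormBC sX qX)//; last by case: (Yphi2 k).
    by rewrite /phi2 /phi' opprD opprB addrA addrCA subrr addr0 scalerBr.
  have cphi2 : cauchy_for q phi2.
    by apply: (cauchy_near sX qX Xphi _ cphi phi2_near) => k; case: (Yphi2 k).
  have [psi [Ypsi cpsi hpsi]] := IH phi2 Yphi2 cphi2.
  exists psi; split => // [k|e e0]; first by have [] := Ypsi k.
  have e2 : 0 < e / 2 by rewrite divr_gt0.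
  have [N1 h1] := hpsi _ e2; have [N2 h2] := phi2_near _ e2.
  exists (maxn N1 N2) => k; rewrite geq_max => /andP[/h1 k1 /h2 k2].
  have [X1 _] := Ypsi k; have [X2 _] := Yphi2 k.
  have := seminorm_trans sX qX X1 X2 (Xphi k); lra.
move=> /existsNP[d /not_implyP[d0 hd]].
have {}hd y : Y y -> d <= q (x - y).
  by move=> Yy; rewrite leNgt; apply/negP => qy; apply: hd; exists y.
(* phi k - phi m is (a k - a m) times some x - y with y in the kernel, and q (x - y) is at least the
   distance d. *)
have ad k m : `|a k - a m| * d <= q (phi k - phi m).
  have [->|akm] := eqVneq (a k) (a m).
    by rewrite subrr normr0 mul0r; apply: (seminorm_ge0 qX); exact: subspaceB.
  have akm0 : a k - a m != 0 by rewrite subr_eq0.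
  pose y := - (a k - a m)^-1 *: (phi' k - phi' m).
  have Yy : Y y by apply: subspaceZ => //; exact: subspaceB.
  have -> : phi k - phi m = (a k - a m) *: (x - y).
    rewrite /y scaleNr opprK scalerDr scalerA mulfV// scale1r /phi' scalerBl.
    by rewrite [- (phi m - _)]opprB addrCA !subrKA.
  rewrite (seminormZ qX); last by apply: subspaceB => //; case: Yy.
  by rewrite ler_wpM2l//; exact: hd.
have ca e : 0 < e -> exists N, forall k m, (N <= k)%N -> (N <= m)%N -> `|a k - a m| < e.
  move=> e0; have [N hN] := cphi _ (mulr_gt0 e0 d0).
  exists N => k m Nk Nm; rewrite -(ltr_pM2r d0).
  exact: le_lt_trans (ad k m) (hN k m Nk Nm).
have small (r b e : R) : 0 <= r -> 0 < e -> b < e / (r + 1) -> b * r < e.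
  move=> r0 e0; rewrite ltr_pdivlMr ?ltr_wpDl//; nra.
have cphi' : cauchy_for q phi'.
  move=> e e0; have e2 : 0 < e / 2 by rewrite divr_gt0.
  have [N1 h1] := cphi _ e2.
  have qx := seminorm_ge0 qX Xx.
  have [|N2 h2] := ca (e / 2 / (q x + 1)); first by rewrite divr_gt0// ltr_wpDl.
  exists (maxn N1 N2) => k m; rewrite !geq_max => /andP[k1 k2] /andP[m1 m2].
  have -> : phi' k - phi' m = (phi k - phi m) - (a k - a m) *: x.
    by rewrite /phi' scalerBl !opprB addrACA [RHS]addrACA; congr (_ + _); exact: addrC.
  have Xkm : X (phi k - phi m) by exact: subspaceB.
  have Xax : X ((a k - a m) *: x) by exact: subspaceZ.
  have := seminormB sX qX Xkm Xax; rewrite (seminormZ qX)//.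
  have := h1 k m k1 m1; have := small _ _ _ qx e2 (h2 k m k2 m2); lra.
have [psi [Ypsi cpsi hpsi]] := IH phi' Yphi' cphi'.
exists (fun k => psi k + a k *: x); split.
- by move=> k; apply: subspaceD => //; [case: (Ypsi k)|exact: subspaceZ].
- move=> e e0; have e2 : 0 < e / 2 by rewrite divr_gt0.
  have [N1 h1] := cpsi _ e2.
  have px := seminorm_ge0 pX Xx.
  have [|N2 h2] := ca (e / 2 / (p x + 1)); first by rewrite divr_gt0// ltr_wpDl.
  exists (maxn N1 N2) => k m; rewrite !geq_max => /andP[k1 k2] /andP[m1 m2].
  rewrite opprD addrACA -scalerBl.
  have Xkm : X (psi k - psi m).
    by apply: subspaceB => //; [case: (Ypsi k)|case: (Ypsi m)].
  have Xax : X ((a k - a m) *: x) by exact: subspaceZ.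
  have := seminormD pX Xkm Xax; rewrite (seminormZ pX)//.
  have := h1 k m k1 m1; have := small _ _ _ px e2 (h2 k m k2 m2); lra.
- move=> e e0; have [N hN] := hpsi _ e0; exists N => k /hN.
  by rewrite /phi' opprB addrA.
Qed.
End seminorms.

Section semi_inner.
Context {R : realType} {V : lmodType R}.
Implicit Types (S D : V -> Prop) (b : V -> V -> R) (d : nat -> V).

Record semi_inner S b : Prop := {
  inner_sym : forall u v, S u -> S v -> b u v = b v u;
  inner_lin : forall a u v w, S u -> S v -> S w ->
    b (a *: u + v) w = a * b u w + b v w;
  inner_ge0 : forall u, S u -> 0 <= b u u }.

Definition nrm b (u : V) : R := Num.sqrt (b u u).

Variables (S : V -> Prop) (b : V -> V -> R).
Hypotheses (sS : is_subspace S) (bS : semi_inner S b).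

Lemma nrm_ge0 u : 0 <= nrm b u. Proof. exact: sqrtr_ge0. Qed.

Lemma nrm_sqr u : S u -> nrm b u ^+ 2 = b u u.
Proof. by move=> Su; rewrite sqr_sqrtr//; exact: (inner_ge0 bS). Qed.

Lemma inner_linr a u v w : S u -> S v -> S w ->
  b w (a *: u + v) = a * b w u + b w v.
Proof.
move=> Su Sv Sw; have Sl := subspace_lin sS a Su Sv.
by rewrite !(inner_sym bS Sw)// (inner_lin bS).
Qed.

Lemma inner0l w : S w -> b 0 w = 0.
Proof.
move=> Sw; have S0 := subspace0 sS; have := inner_lin bS (-1) S0 S0 Sw.
by rewrite scaler0 addr0 mulN1r addNr.
Qed.

Lemma inner0r w : S w -> b w 0 = 0.
Proof. by move=> Sw; rewrite (inner_sym bS)// ?inner0l//; exact: subspace0. Qed.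

Lemma innerZl a u w : S u -> S w -> b (a *: u) w = a * b u w.
Proof.
move=> Su Sw; have S0 := subspace0 sS; have := inner_lin bS a Su S0 Sw.
by rewrite inner0l// !addr0.
Qed.

Lemma innerZr a u w : S u -> S w -> b w (a *: u) = a * b w u.
Proof.
move=> Su Sw; have Sa := subspaceZ a sS Su.
by rewrite !(inner_sym bS Sw)// innerZl.
Qed.

Lemma innerDl u v w : S u -> S v -> S w -> b (u + v) w = b u w + b v w.
Proof. by move=> Su Sv Sw; rewrite -[u in LHS]scale1r (inner_lin bS)// mul1r. Qed.

Lemma innerBl u v w : S u -> S v -> S w -> b (u - v) w = b u w - b v w.
Proof.
by move=> Su Sv Sw; rewrite addrC -scaleN1r (inner_lin bS)// mulN1r addrC.
Qed.

Lemma innerBr u v w : S u -> S v -> S w -> b w (u - v) = b w u - b w v.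
Proof.
move=> Su Sv Sw; have Sl := subspaceB sS Su Sv.
by rewrite !(inner_sym bS Sw)// innerBl.
Qed.

Lemma inner_sqr_add a u v : S u -> S v ->
  b (a *: u + v) (a *: u + v) = a ^+ 2 * b u u + 2 * a * b u v + b v v.
Proof.
move=> Su Sv; have Sl := subspace_lin sS a Su Sv.
rewrite (inner_lin bS)// !inner_linr// (inner_sym bS Sv Su); ring.
Qed.

Lemma quad_disc (x y z : R) : 0 <= x ->
  (forall a, 0 <= a ^+ 2 * x + 2 * a * y + z) -> y ^+ 2 <= x * z.
Proof.
move=> x0 h; have [x0'|x0'] := eqVneq x 0.
  have z0 : 0 <= z by have := h 0; rewrite expr0n/= mul0r add0r mulr0 mul0r add0r.
  rewrite x0' mul0r; have [->|y0] := eqVneq y 0; first by rewrite expr0n.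
  (* With x = 0 the form is affine in a, and at this argument it takes the value -1. *)
  have := h (- (z + 1) / (2 * y)); rewrite x0' mulr0 add0r.
  have -> : 2 * (- (z + 1) / (2 * y)) * y = - (z + 1) by field.
  lra.
have xp : 0 < x by rewrite lt_neqAle eq_sym x0'.
have := h (- y / x); rewrite -(pmulr_rge0 _ xp).
have -> : x * ((- y / x) ^+ 2 * x + 2 * (- y / x) * y + z) = x * z - y ^+ 2.
  by field.
lra.
Qed.

Lemma inner_CS2 u v : S u -> S v -> b u v ^+ 2 <= b u u * b v v.
Proof.
move=> Su Sv; apply: quad_disc; first exact: (inner_ge0 bS).
by move=> a; rewrite -inner_sqr_add//; apply: (inner_ge0 bS); exact: subspace_lin.
Qed.

Lemma inner_CS u v : S u -> S v -> `|b u v| <= nrm b u * nrm b v.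
Proof.
move=> Su Sv; rewrite -(ler_pXn2r (ltn0Sn 1)) ?nnegrE ?mulr_ge0 ?nrm_ge0//.
by rewrite exprMn !nrm_sqr// real_normK ?num_real// inner_CS2.
Qed.

Lemma nrm_seminorm : seminorm_on S (nrm b).
Proof.
split=> [u _|u v Su Sv|a u Su]; first exact: nrm_ge0.
  rewrite -(ler_pXn2r (ltn0Sn 1)) ?nnegrE ?addr_ge0 ?nrm_ge0//.
  rewrite sqrrD !nrm_sqr//; last exact: subspaceD.
  have := inner_sqr_add 1 Su Sv; rewrite scale1r => ->.
  have := le_trans (ler_norm _) (inner_CS Su Sv); lra.
rewrite /nrm; have Sa := subspaceZ a sS Su.
rewrite innerZl// innerZr// mulrA -expr2 sqrtrM ?sqr_ge0//.
by rewrite sqrtr_sqr.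
Qed.

(** D need not be closed, so the projection of f exists only as a minimizing sequence. It is Cauchy
    by the parallelogram law at midpoints, and moving it in the direction x shows that the error
    becomes orthogonal to x in the limit. *)
Lemma inner_proj D f : is_subspace D -> (forall x, D x -> S x) -> S f ->
  exists d, [/\ forall k, D (d k), cauchy_for (nrm b) d &
    forall x, D x -> forall e : R, 0 < e ->
      exists N, forall k, (N <= k)%N -> `|b (f - d k) x| < e].
Proof.
move=> sD DS Sf.
pose E := [set b (f - x) (f - x) | x in D].
have E_ge0 : lbound E 0.
  by move=> _ [x Dx <-]; apply: (inner_ge0 bS); apply: subspaceB => //; exact: DS.
have infE : has_inf E.
  by split; [exists (b (f - 0) (f - 0)); exists 0 => //; exact: subspace0|exists 0].
have /choice[d hd] : forall k, exists x, D x /\ b (f - x) (f - x) < inf E + k.+1%:R^-1.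
  move=> k; have k0 : (0 : R) < k.+1%:R^-1 by rewrite invr_gt0.
  by have [_ [x Dx <-] hx] := inf_adherent k0 infE; exists x.
have Dd k : D (d k) by case: (hd k).
have Sd k : S (d k) by exact: DS.
have Sfd k : S (f - d k) by exact: subspaceB.
have infle x : D x -> inf E <= b (f - x) (f - x).
  by move=> Dx; apply: ge_inf; [case: infE|exists x].
have cd k l : b (d k - d l) (d k - d l) <= 2 * (k.+1%:R^-1 + l.+1%:R^-1).
  have Dm : D (2^-1 *: (d k + d l)) by apply: subspaceZ => //; exact: subspaceD.
  have mid : f - 2^-1 *: (d k + d l) = 2^-1 *: (f - d k) + 2^-1 *: (f - d l).
    rewrite -scalerDr addrACA -opprD scalerBr; congr (_ - _).
    by rewrite -mulr2n -[f *+ 2]scaler_nat scalerA mulVf ?scale1r// pnatr_eq0.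
  have := infle _ Dm; rewrite mid.
  have Sl : S (2^-1 *: (f - d l)) by exact: subspaceZ.
  rewrite inner_sqr_add// !innerZr// innerZl//.
  have -> : d k - d l = (-1) *: (f - d k) + (f - d l).
    by rewrite scaleN1r opprB subrKA.
  rewrite inner_sqr_add// (inner_sym bS (Sfd k) (Sfd l)).
  case: (hd k) => _; case: (hd l) => _. move: (b _ _) (b _ _) (b _ _) (_^-1) (_^-1) (inf E) => X Y Z s t i. lra.
exists d; split => // [e e0|x Dx e e0].
  have e4 : 0 < e ^+ 2 / 4 by rewrite divr_gt0// exprn_gt0.
  have [N hN] := invS_lt e4; exists N => k l /hN hk /hN hl.
  rewrite -(ltr_pXn2r (ltn0Sn 1)) ?nnegrE ?nrm_ge0 ?(ltW e0)//.
  rewrite nrm_sqr; last exact: subspaceB.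
  move: hk hl (cd k l); move: (b _ _) (k.+1%:R^-1) (l.+1%:R^-1) => X s t; lra.
have Sx := DS _ Dx; have bxx := inner_ge0 bS Sx.
have key k : b (f - d k) x ^+ 2 <= b x x * k.+1%:R^-1.
  rewrite (inner_sym bS)//; apply: quad_disc => // a.
  have Ddx : D (d k - a *: x) by apply: subspaceB => //; exact: subspaceZ.
  have := infle _ Ddx; rewrite opprB addrCA inner_sqr_add//.
  by case: (hd k) => _; move: (b _ _) (b _ _) (b _ _) (_^-1) (inf E) => X Y Z s i; lra.
have e1 : 0 < e ^+ 2 / (b x x + 1) by rewrite divr_gt0// ?exprn_gt0// ltr_wpDl.
have [N hN] := invS_lt e1; exists N => k /hN hk.
rewrite -(ltr_pXn2r (ltn0Sn 1)) ?nnegrE ?normr_ge0 ?(ltW e0)//.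
rewrite real_normK ?num_real//; apply: le_lt_trans (key k) _.
move: hk; rewrite ltr_pdivlMr ?ltr_wpDl//.
have : 0 < k.+1%:R^-1 :> R by rewrite invr_gt0.
by move: (b _ _) bxx (_^-1) => X X0 s; nra.
Qed.
End semi_inner.

(** * Square-integrable functions *)

Section L2.
Context d (T : measurableType d) (R : realType) (mu : {measure set T -> \bar R}).
Implicit Types f g h : T -> R^o.

Definition itg (f : T -> R) := mu.-integrable setT (EFin \o f).

Lemma itg_mfun (f : T -> R) : itg f -> measurable_fun setT f.
Proof. by move/measurable_int/measurable_EFinP. Qed.

Lemma itg_le (f g : T -> R) : measurable_fun setT f -> itg g ->
  (forall x, `|f x| <= g x) -> itg f.
Proof.
move=> mf ig fg; apply: le_integrable ig => //; first exact/measurable_EFinP.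
move=> x _ /=; rewrite lee_fin; apply: le_trans (fg x) _; exact: ler_norm.
Qed.

Lemma itgD (f g : T -> R) : itg f -> itg g -> itg (fun x => f x + g x).
Proof.
move=> fi gi; rewrite /itg (_ : EFin \o _ = (EFin \o f) \+ (EFin \o g))%E//.
exact: integrableD.
Qed.

Lemma itgZ a (f : T -> R) : itg f -> itg (fun x => a * f x).
Proof.
move=> fi; rewrite /itg (_ : EFin \o _ = (fun x => a%:E * (EFin \o f) x))%E//.
exact: integrableZl.
Qed.

Lemma itgN (f : T -> R) : itg f -> itg (fun x => - f x).
Proof.
move=> /(itgZ (-1)); congr itg; apply/funext => x; exact: mulN1r.
Qed.

Lemma itgB (f g : T -> R) : itg f -> itg g -> itg (fun x => f x - g x).
Proof. by move=> fi /itgN; exact: itgD. Qed.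

Lemma itg0 : itg (fun=> 0). Proof. exact: integrable0. Qed.

Lemma itg_norm (f : T -> R) : itg f -> itg (fun x => `|f x|).
Proof. by move=> /integrable_abse. Qed.

Lemma itg_sum (I : Type) (s : seq I) (P : pred I) (F : I -> T -> R) :
  (forall i, P i -> itg (F i)) -> itg (fun x => \sum_(i <- s | P i) F i x).
Proof.
move=> iF; elim: s => [|i s IH].
  have -> : (fun x => \sum_(i <- [::] | P i) F i x) = fun=> 0.
    by apply/funext => x; rewrite big_nil.
  exact: itg0.
rewrite (_ : (fun x => \sum_(i <- i :: s | P i) F i x) =
    fun x => (if P i then F i x else 0) + \sum_(i <- s | P i) F i x); last first.
  by apply/funext => x; rewrite big_cons; case: ifP => // _; rewrite add0r.
by apply: itgD => //; case Pi: (P i); [exact: iF|exact: itg0].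
Qed.

Lemma Rintegral0 : \int[mu]_x (0 : R) = 0.
Proof. by rewrite Rintegral_cst// mul0r. Qed.

Lemma Rintegral_sum (I : Type) (s : seq I) (P : pred I) (F : I -> T -> R) :
  (forall i, P i -> itg (F i)) ->
  \int[mu]_x (\sum_(i <- s | P i) F i x) = \sum_(i <- s | P i) \int[mu]_x F i x.
Proof.
move=> iF; elim: s => [|i s IH].
  rewrite big_nil -[RHS]Rintegral0; apply: eq_Rintegral => x _; exact: big_nil.
rewrite big_cons -IH; case: ifPn => Pi.
  rewrite -RintegralD//; [|exact: iF|exact: itg_sum].
  by apply: eq_Rintegral => x _; rewrite big_cons Pi.
by apply: eq_Rintegral => x _; rewrite big_cons (negPf Pi).
Qed.

Lemma RintegralN (f : T -> R) : itg f -> \int[mu]_x (- f x) = - \int[mu]_x f x.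
Proof.
by move=> fi; rewrite -mulN1r -RintegralZl//; apply: eq_Rintegral => x _; rewrite mulN1r.
Qed.

Lemma EFin_Rintegral (f : T -> R) : itg f ->
  (\int[mu]_x f x)%:E = (\int[mu]_x (f x)%:E)%E.
Proof. by move=> fi; rewrite fineK//; exact: integrable_fin_num. Qed.

Lemma ae_eq_Rintegral (f g : T -> R) :
  measurable_fun setT f -> measurable_fun setT g ->
  f = g %[ae mu] -> \int[mu]_x f x = \int[mu]_x g x.
Proof.
move=> mf mg fg; congr fine; apply: ae_eq_integral => //; try exact/measurable_EFinP.
by apply: filterS fg => x /= /(_ I) -> _.
Qed.

Lemma itg_le_ae (f g : T -> R) : measurable_fun setT f -> itg g ->
  {ae mu, forall x, `|f x| <= g x} -> itg f.
Proof.
move=> mf ig fg; have mg := itg_mfun ig; apply/integrableP; split; first exact/measurable_EFinP.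
have /integrableP[_] := ig; apply: le_lt_trans.
apply: ae_ge0_le_integral => //.
- by apply: measurableT_comp => //; exact/measurable_EFinP.
- by apply: measurableT_comp => //; exact/measurable_EFinP.
- by apply: filterS fg => x fgx _; rewrite lee_fin (le_trans fgx)// ler_norm.
Qed.

Lemma ae_eq_itg (f g : T -> R) :
  measurable_fun setT g -> f = g %[ae mu] -> itg f -> itg g.
Proof.
move=> mg fg /itg_norm fi; apply: itg_le_ae fi _ => //.
by apply: filterS fg => x /(_ I) ->.
Qed.

Lemma Rintegral_eq0_ae (f : T -> R) : itg f -> (forall x, 0 <= f x) ->
  \int[mu]_x f x = 0 -> f = (fun=> 0) %[ae mu].
Proof.
move=> fi f0 fi0; have int0 : (\int[mu]_x (f x)%:E = 0)%E.
  by rewrite -EFin_Rintegral// fi0.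
have mf : measurable_fun setT (EFin \o f) by apply/measurable_EFinP/itg_mfun.
have [+ _] := ae_eq_integral_abs mu measurableT mf.
have -> : (\int[mu]_x `|(EFin \o f) x| = 0)%E.
  by rewrite -[RHS]int0; apply: eq_integral => x _ /=; rewrite ger0_norm.
by move=> /(_ erefl); apply: filterS => x /(_ I) [].
Qed.

Definition L2 (f : T -> R) :=
  measurable_fun setT f /\ itg (fun x => f x ^+ 2).

Lemma L2_mfun (f : T -> R) : L2 f -> measurable_fun setT f. Proof. by case. Qed.

Lemma L2_mulr (f g : T -> R) : L2 f -> L2 g -> itg (fun x => f x * g x).
Proof.
move=> [mf f2] [mg g2]; apply: itg_le (itgD f2 g2) _; first exact: measurable_funM.
by move=> x; rewrite ler_norml; nra.
Qed.

Lemma L2_le_ae c (f g : T -> R) : measurable_fun setT f -> L2 g ->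
  {ae mu, forall x, `|f x| <= c * `|g x|} -> L2 f.
Proof.
move=> mf [mg g2] fg; split=> //.
apply: (itg_le_ae _ (itgZ (c ^+ 2) g2)); first exact: measurable_funX.
apply: filterS fg => x fgx.
rewrite normrX -(real_normK (num_real (g x))) -exprMn.
by rewrite lerXn2r ?nnegrE// (le_trans _ fgx).
Qed.

Lemma L2_le c (f g : T -> R) : measurable_fun setT f -> L2 g ->
  (forall x, `|f x| <= c * `|g x|) -> L2 f.
Proof. by move=> mf Lg fg; apply: (L2_le_ae mf Lg); exact: aeW. Qed.

Lemma L2_ae (f g : T -> R) : measurable_fun setT g -> L2 f -> f = g %[ae mu] -> L2 g.
Proof.
move=> mg [mf f2] fg; split => //; apply: ae_eq_itg f2; first exact: measurable_funX.
by apply: filterS fg => x /= /(_ I) -> _.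
Qed.

Lemma L2_is_subspace : is_subspace (L2 : (T -> R^o) -> Prop).
Proof.
split.
  split; first exact: measurable_cst.
  have -> : (fun x : T => (0 : T -> R) x ^+ 2) = fun=> 0.
    by apply/funext => x; rewrite expr0n.
  exact: itg0.
move=> a f g Lf Lg; have [mf f2] := Lf; have [mg g2] := Lg.
have mfg : measurable_fun setT (fun x => a * f x + g x).
  by apply: measurable_funD => //; exact: measurable_funM.
split=> //.
rewrite (_ : (fun x => _) = (fun x => a ^+ 2 * f x ^+ 2 + 2 * a * (f x * g x) + g x ^+ 2)).
  by apply: itgD => //; apply: itgD; apply: itgZ => //; exact: L2_mulr.
by apply/funext => x; rewrite !fctE /GRing.scale/=; ring.
Qed.

Lemma L2D (f g : T -> R) : L2 f -> L2 g -> L2 (fun x => f x + g x).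
Proof. exact: (subspaceD L2_is_subspace). Qed.

Lemma L2B (f g : T -> R) : L2 f -> L2 g -> L2 (fun x => f x - g x).
Proof. exact: (subspaceB L2_is_subspace). Qed.

Lemma L2Z a (f : T -> R) : L2 f -> L2 (fun x => a * f x).
Proof. exact: (subspaceZ a L2_is_subspace). Qed.

Lemma L20 : L2 (fun=> 0). Proof. exact: (subspace0 L2_is_subspace). Qed.

Lemma L2_sum (I : Type) (s : seq I) (P : pred I) (F : I -> T -> R) :
  (forall i, P i -> L2 (F i)) -> L2 (fun x => \sum_(i <- s | P i) F i x).
Proof.
move=> iF; elim: s => [|i s IH].
  have -> : (fun x => \sum_(i <- [::] | P i) F i x) = fun=> 0.
    by apply/funext => x; rewrite big_nil.
  exact: L20.
rewrite (_ : (fun x => \sum_(i <- i :: s | P i) F i x) =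
    fun x => (if P i then F i x else 0) + \sum_(i <- s | P i) F i x); last first.
  by apply/funext => x; rewrite big_cons; case: ifP => // _; rewrite add0r.
by apply: L2D => //; case Pi: (P i); [exact: iF|exact: L20].
Qed.

Definition ip2 f g : R := \int[mu]_x (f x * g x).

(** Functions that agree almost everywhere are not identified, hence only a semi-inner product. *)
Lemma ip2_inner : semi_inner (L2 : (T -> R^o) -> Prop) ip2.
Proof.
split.
- by move=> f g _ _; apply: eq_Rintegral => x _; rewrite mulrC.
- move=> a f g h Lf Lg Lh; rewrite /ip2 -RintegralZl//; last exact: L2_mulr.
  rewrite -RintegralD//; [|by apply: itgZ; exact: L2_mulr|exact: L2_mulr].
  by apply: eq_Rintegral => x _; rewrite !fctE mulrDl -mulrA.
- by move=> f _; apply: Rintegral_ge0 => x _; rewrite -expr2 sqr_ge0.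
Qed.

Definition nrm2 f : R := nrm ip2 f.

Lemma nrm2_seminorm : seminorm_on (L2 : (T -> R^o) -> Prop) nrm2.
Proof. exact: nrm_seminorm L2_is_subspace ip2_inner. Qed.

Lemma nrm2_ge0 f : 0 <= nrm2 f. Proof. exact: nrm_ge0. Qed.

Lemma nrm2_sqr f : nrm2 f ^+ 2 = \int[mu]_x (f x ^+ 2).
Proof.
rewrite /nrm2 /nrm sqr_sqrtr; last by apply: Rintegral_ge0 => x _; rewrite -expr2 sqr_ge0.
by apply: eq_Rintegral => x _; rewrite expr2.
Qed.

Lemma nrm2_le (f g : T -> R) : L2 f -> L2 g -> (forall x, `|f x| <= `|g x|) ->
  nrm2 f <= nrm2 g.
Proof.
move=> [_ f2] [_ g2] fg; rewrite -(ler_pXn2r (ltn0Sn 1)) ?nnegrE ?nrm2_ge0// !nrm2_sqr.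
apply: le_Rintegral => // x _.
rewrite -(real_normK (num_real (f x))) -(real_normK (num_real (g x))).
by rewrite lerXn2r ?nnegrE.
Qed.

Lemma nrm2_ae (f g : T -> R) : measurable_fun setT f -> measurable_fun setT g ->
  f = g %[ae mu] -> nrm2 f = nrm2 g.
Proof.
move=> mf mg fg; congr Num.sqrt; apply: ae_eq_Rintegral; try exact: measurable_funM.
by apply: filterS fg => x /= /(_ I) -> _.
Qed.

Lemma ip2_CS f g : L2 f -> L2 g -> `|ip2 f g| <= nrm2 f * nrm2 g.
Proof. exact: inner_CS L2_is_subspace ip2_inner _ _. Qed.

Lemma ip2_eq0 f : L2 f -> ip2 f f = 0 -> f = (fun=> 0) %[ae mu].
Proof.
move=> Lf f0; have : (fun x => f x ^+ 2) = (fun=> 0) %[ae mu].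
  apply: Rintegral_eq0_ae; [by case: Lf|by move=> x; exact: sqr_ge0|].
  by rewrite -[RHS]f0; apply: eq_Rintegral => x _; rewrite expr2.
by apply: filterS => x /(_ I)/eqP; rewrite sqrf_eq0 => /eqP.
Qed.

Lemma nrm2_eq0 f : L2 f -> nrm2 f = 0 -> f = (fun=> 0) %[ae mu].
Proof.
move=> Lf n0; apply: ip2_eq0 => //; rewrite -(nrm_sqr ip2_inner)// -/(nrm2 f) n0.
by rewrite expr0n.
Qed.

Lemma Lnorm2E (f : T -> R) : L2 f -> ('N[mu]_2%:E [EFin \o f] = (nrm2 f)%:E)%E.
Proof.
move=> [mf f2]; rewrite unlock.
have -> : (\int[mu]_x `|(EFin \o f) x| `^ 2 = (nrm2 f ^+ 2)%:E)%E.
  rewrite nrm2_sqr EFin_Rintegral//; apply: eq_integral => x _ /=.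
  by rewrite powR_mulrn// real_normK ?num_real.
by rewrite poweR_EFin -powR_mulrn ?nrm2_ge0// -powRrM mulfV// powRr1 ?nrm2_ge0.
Qed.

Lemma L2_Lfun (f : T -> R) : f \in Lfun mu 2%:E <-> L2 f.
Proof.
split=> [Lf|Lf].
  split; last exact: Lfun2_integrable_sqr.
  by move: Lf; rewrite inE => /andP[]; rewrite inE.
rewrite inE; apply/andP; rewrite !inE; split; first by case: Lf.
by rewrite /= /finite_norm Lnorm2E// ltry.
Qed.

End L2.
Arguments itg {d T R} mu f.
Arguments L2 {d T R} mu f.
Arguments ip2 {d T R} mu f g.
Arguments nrm2 {d T R} mu f.

(** * Completeness of L^2 *)

Section L2_complete.
Context d (T : measurableType d) (R : realType) (mu : {measure set T -> \bar R}).

Lemma fatou_le (f : nat -> T -> R) (g : T -> R) (c : R) :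
  (forall k, itg mu (f k)) -> (forall k x, 0 <= f k x) ->
  (forall x, f k x @[k --> \oo] --> g x) ->
  (forall k, \int[mu]_x f k x <= c) -> itg mu g /\ \int[mu]_x g x <= c.
Proof.
move=> fi f0 fg fc.
have mf k : measurable_fun setT (f k) := itg_mfun (fi k).
have mg : measurable_fun setT g by apply: measurable_fun_cvg mf _ => x _; exact: fg.
have g0 x : 0 <= g x.
  by apply: (cvgr_to_ge (fg x)); exact: nearW.
have key : (\int[mu]_x (g x)%:E <= c%:E)%E.
  have /= := @fatou _ _ _ mu setT measurableT (fun k x => (f k x)%:E).
  rewrite (eq_integral (fun x => (g x)%:E)); last first.
    move=> x _; have /cvg_limn_einf_sup[] // : (f k x)%:E @[k --> \oo] --> (g x)%:E.
    by apply: cvg_EFin; [exact: nearW|exact: fg].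
  move=> h; apply: le_trans (h _ _) _; [by move=> k; exact/measurable_EFinP|by move=> *; rewrite lee_fin|].
  rewrite limn_einf_lim; apply: lime_le; first exact: is_cvg_einfs.
  apply: nearW => k; apply: (@le_trans _ _ (\int[mu]_x (f k x)%:E)%E).
    by apply: ereal_inf_lbound; exists k => /=.
  by rewrite -EFin_Rintegral// lee_fin.
have ig : itg mu g.
  apply/integrableP; split; first exact/measurable_EFinP.
  apply: le_lt_trans (ltry c); apply: le_trans key.
  by rewrite le_eqVlt; apply/orP; left; apply/eqP/eq_integral => x _ /=; rewrite ger0_norm.
by split => //; rewrite -lee_fin EFin_Rintegral.
Qed.

Lemma L2_fatou (u : nat -> T -> R) (f : T -> R) (c : R) :
  (forall k, L2 mu (u k)) -> (forall x, u k x @[k --> \oo] --> f x) ->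
  (forall k, nrm2 mu (u k) <= c) -> L2 mu f /\ nrm2 mu f <= c.
Proof.
move=> Lu uf uc.
have c0 : 0 <= c := le_trans (nrm2_ge0 mu _) (uc 0%N).
have [|||//|fi fc] := @fatou_le (fun k x => u k x ^+ 2) (fun x => f x ^+ 2) (c ^+ 2).
- by move=> k; case: (Lu k).
- by move=> k x; exact: sqr_ge0.
- by move=> x; rewrite expr2; under eq_fun do rewrite expr2; apply: cvgM; exact: uf.
- by move=> k; rewrite -nrm2_sqr lerXn2r ?nnegrE ?nrm2_ge0.
split; last by rewrite -(ler_pXn2r (ltn0Sn 1)) ?nnegrE ?nrm2_ge0// nrm2_sqr.
split => //; apply: measurable_fun_cvg => [m|x _]; last exact: uf.
exact: L2_mfun (Lu m).
Qed.

(** Riesz-Fischer. Along a subsequence with increments below 2^-k the sums [S m] of absolute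
    increments stay bounded in L^2, so the subsequence converges almost everywhere; Fatou then
    bounds the distance of the whole sequence to the limit. *)
Theorem L2_complete (u : nat -> T -> R^o) : (forall k, L2 mu (u k)) ->
  cauchy_for (nrm2 mu) u -> exists2 f : T -> R^o, L2 mu f & cvg_for (nrm2 mu) u f.
Proof.
move=> Lu cu.
have sn := nrm2_seminorm mu; have sL := L2_is_subspace mu.
have /choice[N hN] : forall k, exists N, forall m l, (N <= m)%N -> (N <= l)%N ->
    nrm2 mu (u m - u l) < 2^-1 ^+ k.
  by move=> k; apply: cu; rewrite exprn_gt0// invr_gt0.
pose fix n k := if k is k'.+1 then maxn (n k') (N k) else N 0%N.
have nN k : (N k <= n k)%N by case: k => //= k; rewrite leq_maxr.
have nS k : (n k <= n k.+1)%N by rewrite /= leq_maxl.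
pose v k := u (n k).
have Lv k : L2 mu (v k) by exact: Lu.
have dv k : nrm2 mu (v k.+1 - v k) < 2^-1 ^+ k.
  by apply: hN => //; apply: leq_trans (nN k) _.
pose S m x : R := \sum_(k < m) `|v k.+1 x - v k x|.
have Labs k : L2 mu (fun x => `|v k.+1 x - v k x|).
  have Ld : L2 mu (v k.+1 - v k) by exact: L2B.
  apply: (L2_le (c := 1) _ Ld); last by move=> x; rewrite normr_id mul1r.
  exact: measurableT_comp (L2_mfun Ld).
have LS m : L2 mu (S m) by apply: L2_sum.
have nS2 m : nrm2 mu (S m) <= 2 - 2 * 2^-1 ^+ m.
  elim: m => [|m IH].
    rewrite expr0 mulr1 subrr (_ : S 0%N = 0) ?(seminorm0 sL sn)//.
    by apply/funext => x; rewrite /S big_ord0.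
  have -> : S m.+1 = (S m : T -> R^o) + (fun x => `|v m.+1 x - v m x|).
    by apply/funext => x; rewrite /S big_ord_recr.
  apply: le_trans (seminormD sn (LS m) (Labs m)) _.
  have : nrm2 mu (fun x => `|v m.+1 x - v m x|) <= 2^-1 ^+ m.
    apply: le_trans (ltW (dv m)); apply: nrm2_le => //; first exact: L2B.
    by move=> x; rewrite normr_id.
  by move: IH; rewrite exprS; lra.
have Snd x : nondecreasing_seq (S ^~ x).
  apply/nondecreasing_seqP => m; rewrite /S big_ord_recr/= lerDl//.
pose g x : \bar R := limn (fun m => ((S m x) ^+ 2)%:E).
have S0 m x : 0 <= S m x by apply: sumr_ge0.
have gnd x : nondecreasing_seq (fun m => ((S m x) ^+ 2)%:E).
  by move=> m m' mm'; rewrite lee_fin lerXn2r ?nnegrE//; exact: Snd.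
have mS m : measurable_fun setT (fun x => ((S m x) ^+ 2)%:E).
  by apply/measurable_EFinP/measurable_funX; exact: L2_mfun.
have S20 m x : (0 <= ((S m x) ^+ 2)%:E)%E by rewrite lee_fin sqr_ge0.
have g0 x : (0 <= g x)%E.
  by apply: lime_ge; [exact: ereal_nondecreasing_is_cvgn|exact: nearW].
have mg : measurable_fun setT g.
  apply: (emeasurable_fun_cvg (fun m x => ((S m x) ^+ 2)%:E)) => // x _.
  exact: ereal_nondecreasing_is_cvgn.
have intg : (\int[mu]_x g x <= 4%:E)%E.
  rewrite /g (@monotone_convergence _ _ _ mu setT measurableT (fun m x => ((S m x) ^+ 2)%:E))//.
  have mono : {homo (fun m => \int[mu]_x ((S m x) ^+ 2)%:E)%E : m m' / (m <= m')%N >-> (m <= m')%E}.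
    move=> m m' mm'; apply: ge0_le_integral => //.
    by move=> x _; exact: gnd.
  apply: lime_le; first exact: ereal_nondecreasing_is_cvgn.
  apply: nearW => m; rewrite -EFin_Rintegral; last by case: (LS m).
  rewrite -nrm2_sqr lee_fin.
  have := nS2 m; have := nrm2_ge0 mu (S m); have : 0 <= 2^-1 ^+ m :> R by rewrite exprn_ge0.
  move: (nrm2 _ _) (2^-1 ^+ m) => a b; nra.
have aeg : {ae mu, forall x, g x \is a fin_num}.
  have : mu.-integrable setT g.
    apply/integrableP; split => //; apply: le_lt_trans (ltry 4); apply: le_trans intg.
    by rewrite le_eqVlt; apply/orP; left; apply/eqP/eq_integral => x _; rewrite gee0_abs.
  by move=> /integrable_ae; move=> /(_ measurableT); apply: filterS => x; exact.
pose E := [set x | g x \is a fin_num].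
have mE : measurable E.
  by rewrite -[E]setTI; exact: emeasurable_fin_num.
(* Setting [v k] to 0 where the monotone limit g is infinite makes the sequence converge at every
   point, as [L2_fatou] asks. *)
pose w k x : R := v k x * \1_E x.
have mw k : measurable_fun setT (w k).
  by apply: measurable_funM; [exact: L2_mfun|exact: measurable_indic].
have wv k : v k = w k %[ae mu].
  by apply: filterS aeg => x gx _; rewrite /w indicE mem_set ?mulr1.
have Lw k : L2 mu (w k) by exact: L2_ae (mw k) (Lv k) (wv k).
have cw x : cvgn (w ^~ x).
  have [Ex|Ex] := pselect (E x); last first.
    rewrite (_ : w ^~ x = cst 0); first exact: is_cvg_cst.
    by apply/funext => k; rewrite /w indicE memNset// mulr0.
  have -> : w ^~ x = v ^~ x.
    by apply/funext => k; rewrite /w indicE mem_set ?mulr1.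
  have cS : cvgn (S ^~ x).
    apply: nondecreasing_is_cvgn; first exact: Snd.
    (* A real number is at most its square plus 1, and the squares are bounded by g x. *)
    exists (fine (g x) + 1) => _ [m _ <-].
    have gm : (S m x) ^+ 2 <= fine (g x).
      rewrite -lee_fin fineK//; apply: lime_ge; first exact: ereal_nondecreasing_is_cvgn.
      by exists m => // k /= mk; exact: gnd.
    have := S0 m x; nra.
  have cs : cvgn (series (fun k => v k.+1 x - v k x)).
    apply: (@normed_cvg R R^o); rewrite (_ : [normed _] = S ^~ x)//.
    by apply/funext => m; rewrite /S /normed_series_of /series/= big_mkord.
  have -> : v ^~ x = series (fun k => v k.+1 x - v k x) \+ cst (v 0%N x).
    by apply/funext => k; rewrite /series/= telescope_sumr// subrK.
  by apply: is_cvgD => //; exact: is_cvg_cst.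
pose f x := limn (w ^~ x).
have wf x : w k x @[k --> \oo] --> f x by exact: cw.
have uvw m k : nrm2 mu (u m - w k) = nrm2 mu (u m - v k).
  apply: nrm2_ae; [exact: L2_mfun (L2B (Lu _) (Lw _))|exact: L2_mfun (L2B (Lu _) (Lv _))|].
  by apply: filterS (wv k) => x /(_ I) vw _; rewrite !fctE vw.
have key k m : (N k <= m)%N -> L2 mu (u m - f) /\ nrm2 mu (u m - f) <= 2^-1 ^+ k.
  move=> Nm; apply: (@L2_fatou (fun l => u m - w (l + k)%N)).
  - by move=> l; exact: L2B.
  - move=> x; rewrite !fctE; apply: cvgB; first exact: cvg_cst.
    by move: (wf x); rewrite -(cvg_shiftn k).
  - move=> l; rewrite uvw ltW//; apply: hN => //.
    apply: leq_trans (nN k) _.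
    elim: l => [|l IH]; first by [].
    by rewrite addSn; apply: leq_trans IH _; exact: nS.
exists f.
  have [Lf _] := key 0%N (N 0%N) (leqnn _).
  have -> : f = (u (N 0%N) : T -> R^o) - (u (N 0%N) - f) by rewrite opprB addrCA subrr addr0.
  exact: L2B.
move=> e e0; have [k hk] : exists k, (2^-1 : R) ^+ k < e.
  have : (2^-1 : R) ^+ k @[k --> \oo] --> (0 : R).
    by apply: cvg_expr; rewrite ger0_norm ?invr_ge0// invf_lt1// ltr1n.
  move=> /cvgrPdist_lt/(_ _ e0)[k _ /(_ k (leqnn _))] /=.
  by rewrite sub0r normrN ger0_norm ?exprn_ge0//; exists k.
by exists (N k) => m /key[_]; move/le_lt_trans; exact.
Qed.
End L2_complete.

(** * Lebesgue measure *)

Section rV_borel.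
Context {R : realType}.

Lemma countable_union_measurable d (T : measurableType d) (I : countType)
  (P : I -> Prop) (F : I -> set T) : (forall i, measurable (F i)) ->
  measurable (\bigcup_(i in [set i | P i]) F i).
Proof.
move=> mF.
pose G k := if unpickle k is Some i then if `[< P i >] then F i else set0 else set0.
rewrite (_ : \bigcup_(i in _) _ = \bigcup_k G k).
  apply: bigcupT_measurable => k; rewrite /G; case: unpickle => // i.
  by case: ifP.
apply/seteqP; split=> [x [i /= Pi Fi]|x [k _]].
  by exists (pickle i) => //; rewrite /G pickleK; case: asboolP.
by rewrite /G; case: unpickle => // i; case: asboolP => // Pi Fi; exists i.
Qed.

Lemma measurable_coord_preimage n (i : 'I_n) (B : set R) : measurable B ->
  measurable [set x : 'rV[R]_n | B (x ord0 i)].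
Proof. by move=> mB; rewrite -[X in measurable X]setTI; exact: measurable_coord. Qed.

Lemma measurable_forall_coord n (B : 'I_n -> set R) : (forall i, measurable (B i)) ->
  measurable [set x : 'rV[R]_n | forall i, B i (x ord0 i)].
Proof.
move=> mB; rewrite (_ : mkset _ = \bigcap_(i in [set: 'I_n]) [set x : 'rV[R]_n | B i (x ord0 i)]).
  by apply: fin_bigcap_measurable => [|i _]; [exact: finite_finset|exact: measurable_coord_preimage].
by apply/seteqP; split => x /= h i => [_|]; exact: h.
Qed.

(** The sigma-algebra is generated by the coordinates; an open set belongs to it as a union of boxes
    with rational centres and radii, of which there are countably many. *)
Lemma rV_open_measurable n (U : set 'rV[R]_n) : open U -> measurable U.
Proof.
move=> oU.
pose B (p : 'rV[rat]_n * rat) : set 'rV[R]_n :=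
  [set x | forall i, `]ratr (p.1 ord0 i) - ratr p.2, ratr (p.1 ord0 i) + ratr p.2[%classic (x ord0 i)].
rewrite (_ : U = \bigcup_(p in [set p | B p `<=` U]) B p).
  by apply: countable_union_measurable => p;
    apply: (measurable_forall_coord (B := fun i => `]ratr (p.1 ord0 i) - ratr p.2, ratr (p.1 ord0 i) + ratr p.2[%classic)).
apply/seteqP; split => [x Ux|x [p /= pU] /pU//].
have /nbhs_ballP[e /= e0 eU] : nbhs x U by exact: open_nbhs_nbhs.
have e4 : 0 < e / 4 by rewrite divr_gt0.
have e42 : e / 4 < e / 2 by lra.
have [r] := rat_in_itvoo e42.
rewrite in_itv/= => /andP[r1 r2].
have /choice[q hq] : forall i, exists q : rat, `|x ord0 i - ratr q| < e / 4.
  move=> i; have xe : x ord0 i < x ord0 i + e / 4 by rewrite ltrDl.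
  have [q] := rat_in_itvoo xe.
  by rewrite in_itv/= => /andP[q1 q2]; exists q; rewrite ltr_norml; lra.
exists (\row_i q i, r) => /=.
  move=> y By; apply: eU; split => // j i; rewrite (ord1 j).
  have := By i; rewrite /= mxE in_itv/= => /andP[y1 y2].
  have := hq i; rewrite /ball/= !ltr_norml; lra.
by move=> i; have := hq i; rewrite /= mxE in_itv/= ltr_norml; lra.
Qed.

Lemma rV_continuous_measurable n (f : 'rV[R]_n -> R) : continuous f ->
  measurable_fun setT f.
Proof.
move=> /continuousP cf; apply: (measurability _ (RGenOpens.measurableE R)) => _ [_ [a [b ->] <-]].
rewrite setTI; apply: rV_open_measurable; apply: cf; exact: interval_open.
Qed.

Lemma measurable_rVD n : measurable_fun [set: 'rV[R]_n * 'rV[R]_n] (fun p => p.1 + p.2).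
Proof.
apply: measurable_fun_coordP => i.
rewrite (_ : (fun _ => _) = (fun p : 'rV[R]_n * 'rV[R]_n => p.1 ord0 i + p.2 ord0 i)).
  apply: measurable_funD.
  - exact: (measurableT_comp (measurable_coord i) measurable_fst).
  - exact: (measurableT_comp (measurable_coord i) measurable_snd).
by apply/funext => p; rewrite mxE.
Qed.

Lemma measurable_rVB n : measurable_fun [set: 'rV[R]_n * 'rV[R]_n] (fun p => p.1 - p.2).
Proof.
apply: measurable_fun_coordP => i.
rewrite (_ : (fun _ => _) = (fun p : 'rV[R]_n * 'rV[R]_n => p.1 ord0 i - p.2 ord0 i)).
  apply: measurable_funB.
  - exact: (measurableT_comp (measurable_coord i) measurable_fst).
  - exact: (measurableT_comp (measurable_coord i) measurable_snd).
by apply/funext => p; rewrite !mxE.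
Qed.

Lemma measurable_translate n (v : 'rV[R]_n) : measurable_fun setT (fun x : 'rV[R]_n => x + v).
Proof.
apply: measurable_fun_coordP => i.
rewrite (_ : (fun _ => _) = (fun x : 'rV[R]_n => x ord0 i + v ord0 i)).
  by apply: measurable_funD => //; exact: measurable_coord.
by apply/funext => p; rewrite mxE.
Qed.

Lemma measurable_mulmx m n (M : 'M[R]_(m, n)) :
  measurable_fun setT (fun x : 'rV[R]_m => x *m M).
Proof.
apply: measurable_fun_coordP => i.
rewrite (_ : (fun _ => _) = (fun x : 'rV[R]_m => \sum_j x ord0 j * M j i)).
  apply: measurable_sum => j; apply: measurable_funM => //; exact: measurable_coord.
by apply/funext => p; rewrite mxE.
Qed.

End rV_borel.

(** * Invariance of Lebesgue measure under translations and linear maps *)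

Section measure_preserving.
Context d (T : measurableType d) {R : realType} (mu : {measure set T -> \bar R}).
Variables (phi : T -> T) (mphi : measurable_fun setT phi).
Hypothesis phimu : forall A, measurable A -> mu (phi @^-1` A) = mu A.

Lemma mp_ge0_integral (f : T -> \bar R) : measurable_fun setT f ->
  (forall x, 0 <= f x)%E -> (\int[mu]_x f (phi x) = \int[mu]_x f x)%E.
Proof.
move=> mf f0.
have := @ge0_integral_pushforward _ _ _ _ R phi mphi mu setT f measurableT mf (fun x _ => f0 x).
rewrite preimage_setT => <-.
by apply: eq_measure_integral => A mA _; exact: phimu.
Qed.

Lemma mp_itg (f : T -> R) : itg mu f -> itg mu (fun x => f (phi x)).
Proof.
move=> fi; have /integrableP[mf foo] := fi.
apply/integrableP; split; first exact: (measurableT_comp mf mphi).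
rewrite (mp_ge0_integral (f := fun x => `|(f x)%:E|%E))//.
exact: measurableT_comp.
Qed.

Lemma mp_Rintegral (f : T -> R) : itg mu f -> \int[mu]_x f (phi x) = \int[mu]_x f x.
Proof.
move=> fi; congr fine; have /integrableP[mf foo] := fi.
have := @integral_pushforward _ _ _ _ R phi mphi mu setT (EFin \o f) mf.
rewrite preimage_setT => <-//; last exact: mp_itg.
by apply: eq_measure_integral => A mA _; rewrite -phimu.
Qed.

Lemma mp_L2 (f : T -> R) : L2 mu f -> L2 mu (fun x => f (phi x)).
Proof.
move=> [mf f2]; split; first exact: (measurableT_comp mf mphi).
exact: (mp_itg f2).
Qed.

Lemma mp_nrm2 (f : T -> R) : L2 mu f -> nrm2 mu (fun x => f (phi x)) = nrm2 mu f.
Proof.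
move=> [_]; under [in X in X -> _]eq_fun do rewrite expr2.
by move=> f2; congr Num.sqrt; exact: (mp_Rintegral f2).
Qed.
End measure_preserving.

Section leb_translate.
Context {R : realType}.

Lemma lebesgue_measure_translate (a : R) (A : set (measurableTypeR R)) : measurable A ->
  lebesgue_measure ((fun x => x + a) @^-1` A) = lebesgue_measure A.
Proof.
have mphi : measurable_fun setT (fun x : measurableTypeR R => (x + a : measurableTypeR R)).
  exact: measurable_funD.
move=> mA; apply/esym.
have := @lebesgue_measure_unique R
  (measure_function_pushforward__canonical__measure_function_Measure lebesgue_measure mphi).
move=> -> // _ [[b c]] _ <-; rewrite /= /pushforward.
rewrite (_ : _ @^-1` _ = `]b - a, c - a]%classic); last first.
  by apply/seteqP; split => x /=; rewrite !in_itv/= ltrBlDr lerBrDr.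
rewrite !lebesgue_measure_itv/= !lte_fin ltrD2r; case: ifP => // _.
by rewrite -!EFinD; congr (_%:E); ring.
Qed.

(** By induction on the dimension: the image of the product measure under a product of two
    translations agrees with it on rectangles, hence everywhere. *)
Lemma leb_translate n (v : 'rV[R]_n) (A : set 'rV[R]_n) : measurable A ->
  leb n ((fun x => x + v) @^-1` A) = leb n A.
Proof.
elim: n v A => [v A _|n IH v A mA] /=.
  by congr (\d_(0 : 'rV[R]_0) _); apply/seteqP; split => x /=; rewrite (thinmx0 v) addr0.
rewrite /leb_cons /pushforward.
pose a := v ord0 ord0; pose w := vbehead v.
pose phi (p : measurableTypeR R * 'rV[R]_n) : measurableTypeR R * 'rV[R]_n := (p.1 + a, p.2 + w).
have mphi : measurable_fun setT phi.
  apply: measurable_fun_pair.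
    by apply: measurable_funD => //; exact: measurable_fst.
  exact: (measurableT_comp (measurable_translate w) measurable_snd).
have mB : measurable ((fun p : measurableTypeR R * 'rV[R]_n => vcons p.1 p.2) @^-1` A).
  by rewrite -[X in measurable X]setTI; exact: measurable_vcons.
have -> : (fun p : measurableTypeR R * 'rV[R]_n => vcons p.1 p.2) @^-1` ((fun x => x + v) @^-1` A) =
    phi @^-1` ((fun p => vcons p.1 p.2) @^-1` A).
  apply/seteqP; split => -[t x] /=; rewrite (_ : vcons t x + v = vcons (t + a) (x + w))//;
  apply/rowP => i; rewrite mxE; case: (unliftP ord0 i) => [j|] ->;
  by rewrite ?vconsS ?vcons0// mxE mxE.
have h := @product_measure_unique _ _ _ _ R lebesgue_measure (leb n)
  (measure_function_pushforward__canonical__measure_function_Measure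
     (lebesgue_measure \x leb n)%E mphi).
apply/esym; apply: (h _ _ mB) => X Y mX mY.
transitivity ((lebesgue_measure \x leb n)%E
   (((fun x => x + a) @^-1` X) `*` ((fun x => x + w) @^-1` Y))) => //.
have mX' : measurable ((fun x : measurableTypeR R => (x + a : measurableTypeR R)) @^-1` X).
  rewrite -[_ @^-1` _]setTI.
  have mf : measurable_fun setT (fun x : measurableTypeR R => (x + a : measurableTypeR R)).
    exact: measurable_funD.
  exact: mf.
have mY' : measurable ((fun x => x + w) @^-1` Y).
  by rewrite -[_ @^-1` _]setTI; exact: measurable_translate.
rewrite product_measure1E//; congr (_ * _)%E; last exact: IH.
exact: lebesgue_measure_translate.
Qed.

End leb_translate.

Section leb_invariant_unique.
Context {R : realType} {n : nat}.
Implicit Types (nu : {sigma_finite_measure set 'rV[R]_n -> \bar R}) (A B : set 'rV[R]_n).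

Lemma measurable_rVN : measurable_fun setT (fun x : 'rV[R]_n => - x).
Proof.
apply: measurable_fun_coordP => i.
rewrite (_ : (fun _ => _) = (fun x : 'rV[R]_n => - (x ord0 i))).
  exact: (measurableT_comp _ (measurable_coord i)).
by apply/funext => p; rewrite mxE.
Qed.

(* Both sides are the integral of 1_A(x) 1_B(x + y) for dleb(x) dnu(y). *)
Lemma invariant_measure_unique nu :
  (forall v A, measurable A -> nu ((fun x => x + v) @^-1` A) = nu A) ->
  forall A B, measurable A -> measurable B ->
  (leb n A * nu B = leb n B * nu [set x | A (- x)%R])%E.
Proof.
move=> nu_inv A B mA mB.
pose f (p : 'rV[R]_n * 'rV[R]_n) : \bar R := (\1_A p.1 * \1_B (p.1 + p.2))%:E.
have mBD : measurable_fun setT (fun p : 'rV[R]_n * 'rV[R]_n => (\1_B (p.1 + p.2) : R)).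
  by apply: (measurableT_comp (f := \1_B : _ -> R)); [exact: measurable_indic|exact: measurable_rVD].
have mf : measurable_fun setT f.
  apply/measurable_EFinP; apply: measurable_funM => //.
  by apply: (measurableT_comp (f := \1_A : _ -> R)); [exact: measurable_indic|exact: measurable_fst].
have f0 p : (0 <= f p)%E by rewrite lee_fin mulr_ge0.
have indT (mu' : {measure set 'rV[R]_n -> \bar R}) (C : set 'rV[R]_n) : measurable C ->
    (\int[mu']_x (\1_C x)%:E = mu' C)%E.
  by move=> mC; rewrite integral_indic// setIT.
have mBx x : measurable ((fun y => y + x) @^-1` B).
  by rewrite -[_ @^-1` _]setTI; exact: measurable_translate.
have mAx x : measurable ((fun y => y - x) @^-1` A).
  by rewrite -[_ @^-1` _]setTI; exact: measurable_translate.
have mNA : measurable [set x | A (- x)].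
  by rewrite -[X in measurable X]setTI; exact: measurable_rVN.
have int1 x : (\int[nu]_y f (x, y) = (\1_A x)%:E * nu B)%E.
  rewrite /f /=; under eq_integral do rewrite EFinM.
  rewrite ge0_integralZl//; last first.
    apply/measurable_EFinP/(measurableT_comp (f := \1_B : _ -> R)) => //.
    exact: (measurableT_comp (measurable_rVD (n := n)) (measurable_pair1 x)).
  congr (_ * _)%E; rewrite -(nu_inv x B mB) -indT//.
  by apply: eq_integral => y _; rewrite !indicE addrC.
have int2 y : (\int[leb n]_x f (x, y) = \int[leb n]_x (\1_B x * \1_A (x - y))%:E)%E.
  rewrite -(@mp_ge0_integral _ _ _ (leb n) (fun x => x + y) (measurable_translate y) _
     (fun x => (\1_B x * \1_A (x - y))%:E)).
  - by apply: eq_integral => x _; rewrite /f/= addrK mulrC.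
  - by move=> C mC; exact: leb_translate.
  - apply/measurable_EFinP/measurable_funM => //.
    by apply: (measurableT_comp (f := \1_A : _ -> R)) => //; exact: measurable_translate.
  - by move=> x; rewrite lee_fin mulr_ge0.
pose g (p : 'rV[R]_n * 'rV[R]_n) : \bar R := (\1_B p.1 * \1_A (p.1 - p.2))%:E.
have mg : measurable_fun setT g.
  apply/measurable_EFinP; apply: measurable_funM.
    by apply: (measurableT_comp (f := \1_B : _ -> R)); [exact: measurable_indic|exact: measurable_fst].
  by apply: (measurableT_comp (f := \1_A : _ -> R)); [exact: measurable_indic|exact: measurable_rVB].
have g0 p : (0 <= g p)%E by rewrite lee_fin mulr_ge0.
have int3 x : (\int[nu]_y g (x, y) = (\1_B x)%:E * nu [set x | A (- x)%R])%E.
  rewrite /g /=; under eq_integral do rewrite EFinM.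
  rewrite ge0_integralZl//; last first.
    apply/measurable_EFinP/(measurableT_comp (f := \1_A : _ -> R)) => //.
    exact: (measurableT_comp (measurable_rVB (n := n)) (measurable_pair1 x)).
  congr (_ * _)%E; rewrite -(nu_inv (- x) _ mNA) -indT//; last first.
    by rewrite -[_ @^-1` _]setTI; exact: measurable_translate.
  apply: eq_integral => y _; rewrite !indicE; congr ((nat_of_bool _)%:R%:E).
  by apply/idP/idP; rewrite !inE /= opprB.
transitivity (\int[leb n]_x \int[nu]_y f (x, y))%E.
  under [RHS]eq_integral do rewrite int1.
  rewrite -(indT (leb n) _ mA) ge0_integralZr//.
  exact/measurable_EFinP/measurable_indic.
rewrite (fubini_tonelli f mf f0).
transitivity (\int[nu]_y \int[leb n]_x g (x, y))%E.
  by apply: eq_integral => y _; exact: int2.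
rewrite -(fubini_tonelli g mg g0).
under eq_integral do rewrite int3.
rewrite -(indT (leb n) _ mB) ge0_integralZr//.
exact/measurable_EFinP/measurable_indic.
Qed.
End leb_invariant_unique.

Section leb_bounded.
Context {R : realType} {n : nat}.

Definition cube (r : R) : set 'rV[R]_n := [set x | forall i, x ord0 i \in `[- r, r]].

Lemma mem_cube r x : cube r x <-> forall i, `|x ord0 i| <= r.
Proof. by split => h i; have := h i; rewrite in_itv/= ler_norml. Qed.

Lemma cube_measurable r : measurable (cube r).
Proof. exact: (measurable_forall_coord (B := fun=> `[- r, r]%classic)). Qed.

Lemma leb_cube r : 0 <= r -> leb n (cube r) = ((r *+ 2) ^+ n)%:E.
Proof.
move=> r0; have := @leb_box R n (const_mx (- r)) (const_mx r).
rewrite /cube; under eq_set do under eq_forall do rewrite !mxE.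
move=> ->; last by move=> i; rewrite !mxE; lra.
under eq_bigr do rewrite !mxE opprK -mulr2n.
by rewrite big_const_ord iter_mulr_1.
Qed.

Lemma leb_bounded_lty (A : set 'rV[R]_n) r : measurable A ->
  (forall x, A x -> forall i, `|x ord0 i| <= r) -> (leb n A < +oo)%E.
Proof.
move=> mA Ar; apply: (@le_lt_trans _ _ (leb n (cube (maxr r 0)))).
  apply: le_measure; rewrite ?inE//; first exact: cube_measurable.
  by move=> x /Ar h; apply/mem_cube => i; rewrite le_max h.
by rewrite leb_cube ?ltry// le_max lexx orbT.
Qed.

End leb_bounded.

Section leb_linear_change.
Context {R : realType} {n : nat} (M : 'M[R]_n).

(* The measure below needs an invertible matrix to be sigma-finite. *)
Let N := if M \in unitmx then M else 1%:M.
Let Nu : N \in unitmx. Proof. by rewrite /N; case: ifP => // _; exact: unitmx1. Qed.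
Let phi (x : 'rV[R]_n) := x *m N.
Let mphi : measurable_fun setT phi. Proof. exact: measurable_mulmx. Qed.

Definition leb_image : set 'rV[R]_n -> \bar R := pushforward (leb n) phi.

Let m0 : leb_image set0 = 0%E.
Proof. by rewrite /leb_image/pushforward preimage_set0 measure0. Qed.
Let m_ge0 A : (0 <= leb_image A)%E.
Proof. by rewrite /leb_image/pushforward; exact: measure_ge0. Qed.
Let m_sigma : semi_sigma_additive leb_image.
Proof.
exact: (@measure_semi_sigma_additive _ _ _
  (measure_function_pushforward__canonical__measure_function_Measure (leb n) mphi)).
Qed.
HB.instance Definition _ := isMeasure.Build _ _ _ leb_image m0 m_ge0 m_sigma.

Let m_sigma_finite : sigma_finite setT leb_image.
Proof.
have /sigma_finiteP[F [FT _ mF]] := sigma_finiteT (@leb R n).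
exists (fun k => (fun x => x *m invmx N) @^-1` F k).
  apply/esym; rewrite -subTset => x _.
  by have : setT (x *m invmx N) by []; rewrite FT => -[k]; exists k.
move=> k; have [mFk Fk] := mF k; split.
  by rewrite -[X in measurable X]setTI; exact: measurable_mulmx.
rewrite /leb_image /pushforward (_ : _ @^-1` _ = F k)//.
by apply/seteqP; split => x /=; rewrite /phi mulmxK.
Qed.
HB.instance Definition _ := Measure_isSigmaFinite.Build _ _ _ leb_image m_sigma_finite.

Hypothesis Mu : M \in unitmx.

(** The image of Lebesgue measure under an invertible matrix is again translation invariant, hence a
    multiple of it. The factor is left unidentified, as it only enters estimates. *)
Lemma leb_mulmx : exists2 c : R, 0 <= c &
  forall A, measurable A -> leb n ((fun x => x *m M) @^-1` A) = (c%:E * leb n A)%E.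
Proof.
have NM : N = M by rewrite /N Mu.
pose nu : {sigma_finite_measure set 'rV[R]_n -> \bar R} := leb_image.
have nuE A : nu A = leb n ((fun x => x *m M) @^-1` A).
  by have -> : (fun x : 'rV[R]_n => x *m M) = phi by rewrite /phi NM.
have mphiM : measurable_fun setT (fun x : 'rV[R]_n => x *m M) by exact: measurable_mulmx.
have nu_inv (v : 'rV[R]_n) (A : set 'rV[R]_n) : measurable A -> nu ((fun x => x + v) @^-1` A) = nu A.
  move=> mA; rewrite !nuE.
  rewrite -(leb_translate (v *m invmx M) (A := (fun x => x *m M) @^-1` A)); last first.
    by rewrite -[_ @^-1` _]setTI; exact: mphiM.
  congr (leb n _); apply/seteqP; split => x /=; by rewrite mulmxDl mulmxKV.
have key := invariant_measure_unique nu_inv.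
pose Q : set 'rV[R]_n := cube 1.
have mQ : measurable Q by exact: cube_measurable.
have Qoo : (nu [set x | Q (- x)%R] < +oo)%E.
  rewrite nuE.
  apply: (@leb_bounded_lty _ _ _ (\sum_i \sum_j `|invmx M i j|)).
    rewrite -[X in measurable X]setTI; apply: mphiM => //.
    by rewrite -[X in measurable X]setTI; exact: measurable_rVN.
  move=> x /= /mem_cube Qx i; rewrite -(mulmxK Mu x) mxE.
  apply: le_trans (ler_norm_sum _ _ _) _; apply: ler_sum => j _.
  rewrite normrM; have := Qx j; rewrite mxE normrN => xj.
  apply: (@le_trans _ _ `|invmx M j i|); first by rewrite ler_piMl.
  by rewrite (bigD1 i)//= lerDl sumr_ge0.
(* [2 ^+ n] is the measure of the cube Q, the reference set for [invariant_measure_unique]. *)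
exists (fine (nu [set x | Q (- x)%R]) / (2 ^+ n)) => [|A mA].
  by rewrite divr_ge0 ?fine_ge0 ?exprn_ge0.
rewrite -nuE; have := key Q A mQ mA; rewrite leb_cube ?ler01//.
rewrite -[X in _ = (_ * X)%E -> _](@fineK _ (nu _)) ?ge0_fin_numE//.
move=> h.
have := congr1 (fun z => ((2 ^- n)%:E * z)%E) h.
rewrite muleA -EFinM mulVf ?expf_neq0 ?pnatr_eq0// mul1e => ->.
by rewrite [in LHS]muleC -muleA -EFinM muleC mulrC.
Qed.

End leb_linear_change.

(** * Functions determined by their integrals over boxes *)

Section box_determined.
Context {R : realType} {n : nat}.

Lemma rV_norm_le (x : 'rV[R]_n) r : 0 <= r ->
  `|x| <= r <-> forall i, `|x ord0 i| <= r.
Proof.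
move=> r0; rewrite /Num.norm/= mx_normrE; split=> [h i|h].
  by apply: le_trans h; apply: (le_bigmax _ (fun ij : 'I_1 * 'I_n => `|x ij.1 ij.2|) (ord0, i)).
by apply: bigmax_le => // -[j i] _ /=; rewrite (ord1 j); exact: h.
Qed.

Lemma rV_coord_le (x : 'rV[R]_n) i : `|x ord0 i| <= `|x|.
Proof. exact: ((rV_norm_le x (normr_ge0 x)).1 (lexx _) i). Qed.

Lemma rV_norm_lt (x : 'rV[R]_n) r : 0 < r ->
  (forall i, `|x ord0 i| < r) -> `|x| < r.
Proof.
by move=> r0 h; rewrite /Num.norm/= mx_normrE; apply: bigmax_lt => // -[j i] _ /=; rewrite (ord1 j); exact: h.
Qed.

Definition obox (a b : 'rV[R]_n) : set 'rV[R]_n :=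
  [set x | forall i, x ord0 i \in `]a ord0 i, b ord0 i[].

Lemma obox_measurable a b : measurable (obox a b).
Proof. exact: (measurable_forall_coord (B := fun i => `]a ord0 i, b ord0 i[%classic)). Qed.

Lemma oboxI a b c d : obox a b `&` obox c d =
  obox (\row_i maxr (a ord0 i) (c ord0 i)) (\row_i minr (b ord0 i) (d ord0 i)).
Proof.
apply/seteqP; split => x /=.
  move=> [h1 h2] i; rewrite !mxE in_itv/= gt_max lt_min.
  by move: (h1 i) (h2 i); rewrite !in_itv/= => /andP[-> ->] /andP[-> ->].
move=> h; split=> i; have := h i; rewrite !mxE !in_itv/= gt_max lt_min => /andP[/andP[? ?] /andP[? ?]];
by apply/andP.
Qed.

Lemma obox_generate : @measurable _ 'rV[R]_n = <<s [set obox p.1 p.2 | p in setT] >>.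
Proof.
apply/seteqP; split => A; last first.
  apply: smallest_sub; first exact: sigma_algebra_measurable.
  by move=> _ [p _ <-]; exact: obox_measurable.
set G := (X in <<s X >>).
suff : @measurable _ 'rV[R]_n `<=` <<s G >> by exact.
apply: smallest_sub; first exact: smallest_sigma_algebra.
rewrite -bigcup_seq => B [i _ [C mC <-]]; rewrite setTI.
have E : @measurable _ R = <<s @RGenOpens.G R >> := RGenOpens.measurableE R.
have {}mC : <<s @RGenOpens.G R >> C by rewrite -E.
move: C mC.
apply: (@smallest_sub _ _ _ [set C | <<s G >> ((fun x : 'rV[R]_n => x ord0 i) @^-1` C)]).
  split => [|C|F mF] /=.
  - rewrite preimage_set0; exact: sigma_algebra0.
  - move=> h; rewrite setTD preimage_setC -setTD; exact: sigma_algebraCD.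
  - rewrite preimage_bigcup; apply: sigma_algebra_bigcup => k; exact: mF.
move=> _ [x [y ->]] /=.
rewrite (_ : _ @^-1` _ = \bigcup_k obox (\row_j if j == i then x else - k%:R)
    (\row_j if j == i then y else k%:R)).
  apply: sigma_algebra_bigcup => k; apply: sub_sigma_algebra.
  by exists (\row_j if j == i then x else - k%:R, \row_j if j == i then y else k%:R).
apply/seteqP; split => z /=.
  rewrite in_itv/= => zi; exists (Num.truncn `|z|).+1 => //= j.
  rewrite !mxE; case: eqP => [->|_]; rewrite in_itv//=.
  by rewrite -ltr_norml; apply: le_lt_trans (rV_coord_le z j) (truncnS_gt _).
by move=> [k _ /(_ i)]; rewrite !mxE eqxx.
Qed.

(** Dynkin's lemma: open boxes are stable under intersection and generate the sigma-algebra, and the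
    measurable sets over which g has integral 0 form a Dynkin system. *)
Lemma box_integral_eq0 (g : 'rV[R]_n -> R) : itg (leb n) g ->
  (forall a b, \int[leb n]_(x in obox a b) g x = 0) ->
  g = (fun=> 0) %[ae leb n].
Proof.
move=> ig g0.
have mg := itg_mfun ig.
have ifin A : measurable A -> (\int[leb n]_(x in A) (g x)%:E \is a fin_num)%E.
  by move=> mA; apply: integrable_fin_num => //; apply: integrableS ig.
have igS A : measurable A -> (leb n).-integrable A (EFin \o g).
  by move=> mA; apply: integrableS ig.
have box0 a b : (\int[leb n]_(x in obox a b) (g x)%:E = 0)%E.
  by rewrite -(fineK (ifin _ (obox_measurable a b))); congr (_%:E); exact: g0.
have cup0 (F : (set 'rV[R]_n)^nat) : (forall k, measurable (F k)) -> trivIset setT F ->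
    (forall k, (\int[leb n]_(x in F k) (g x)%:E = 0)%E) ->
    (\int[leb n]_(x in \bigcup_k F k) (g x)%:E = 0)%E.
  move=> mF tF F0; rewrite integral_bigcup//; last by apply: igS; exact: bigcupT_measurable.
  by rewrite eseries0// => k _ _; rewrite F0.
(* Complements in the Dynkin system require the integral over the whole space, which is exhausted by
   the cubes [B k]. *)
have T0 : (\int[leb n]_x (g x)%:E = 0)%E.
  pose B k : set 'rV[R]_n := obox (const_mx (- k%:R)) (const_mx k%:R).
  have mB k : measurable (B k) by exact: obox_measurable.
  have BT : \bigcup_k B k = setT.
    apply/seteqP; split => // x _; exists (Num.truncn `|x|).+1 => //= i.
    rewrite !mxE in_itv/= -ltr_norml; apply: le_lt_trans (rV_coord_le x i) (truncnS_gt _).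
  have ndB : nondecreasing_seq B.
    move=> k l kl; apply/subsetPset => x /= h i; have := h i; rewrite !mxE !in_itv/=.
    by move=> /andP[h1 h2]; apply/andP; split;
       [apply: le_lt_trans h1; rewrite lerN2 ler_nat|apply: lt_le_trans h2 _; rewrite ler_nat].
  have cB k : (\int[leb n]_(x in seqDU B k) (g x)%:E = 0)%E.
    case: k => [|k]; first by rewrite /seqDU big_ord0 setD0; exact: box0.
    have -> : seqDU B k.+1 = B k.+1 `\` B k.
      by rewrite seqDU_seqD.
    have mD : measurable (B k.+1 `\` B k) by exact: measurableD.
    have := box0 (const_mx (- k.+1%:R)) (const_mx k.+1%:R); rewrite -/(B k.+1).
    have /setDUK BU : B k `<=` B k.+1 by apply/subsetPset/ndB.
    rewrite -[X in (\int[_]_(x in X) _)%E]BU integral_setU_EFin//.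
    - by rewrite box0 add0e.
    - by apply: measurable_funTS; exact: mg.
    - by apply/disj_setPS => x [? []].
  rewrite -BT seqDU_bigcup_eq; apply: cup0; [exact: seqDU_measurable|exact: trivIset_seqDU|exact: cB].
have key A : measurable A -> (\int[leb n]_(x in A) (g x)%:E = 0)%E.
  move: A; rewrite obox_generate.
  apply: dynkin_induction => //.
  - exact: obox_generate.
  - move=> _ _ [p _ <-] [q _ <-]; rewrite oboxI.
    by exists ((\row_i maxr (p.1 ord0 i) (q.1 ord0 i)), (\row_i minr (p.2 ord0 i) (q.2 ord0 i))).
  - by move=> _ [p _ <-].
  - move=> S mS S0; have mC : measurable (~` S) by exact: measurableC.
    have := T0; rewrite -(setUv S) integral_setU_EFin//.
    + by rewrite S0 add0e.
    + by rewrite setUv.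
    + by apply/disj_setPS; rewrite setICr.
have := @integral_ae_eq _ _ _ (leb n) setT measurableT (cst 0%E) (EFin \o g) ig.
move=> /(_ (measurable_cst _)) h.
have : ae_eq (leb n) setT (EFin \o g) (cst 0%E).
  by apply: h => E _ mE; rewrite key// integral0.
by apply: filterS => x /(_ I) [].
Qed.

End box_determined.

(** * Smooth functions *)

Section smooth_theory.
Context {R : realType} {n : nat}.
Implicit Types (f g : 'rV[R]_n -> R) (i : 'I_n) (x v : 'rV[R]_n).

Lemma smooth_differentiable f x : smooth f -> differentiable f x.
Proof. by move=> /(_ [::] x). Qed.

Lemma smooth_partial f i : smooth f -> smooth (partial i f).
Proof. by move=> sf s x; have := sf (rcons s i) x; rewrite foldr_rcons. Qed.

(** Derivatives rarely keep the form of the function at hand, so smoothness is proved by exhibiting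
    a class that is stable under [partial] rather than by induction on the order. *)
Lemma smooth_coind (C : ('rV[R]_n -> R) -> Prop) :
  (forall f, C f -> (forall x, differentiable f x) /\ forall i, C (partial i f)) ->
  forall f, C f -> smooth f.
Proof.
move=> hC f Cf s x.
suff Cs : C (foldr (@partial R n) f s) by have [] := hC _ Cs.
by elim: s => //= i s IH; have [] := hC _ IH.
Qed.

Lemma smooth_derivable f x v : smooth f -> derivable f x v.
Proof. by move=> sf; apply: diff_derivable; exact: smooth_differentiable. Qed.

Lemma smooth_continuous f : smooth f -> continuous f.
Proof. by move=> sf x; apply: differentiable_continuous; exact: smooth_differentiable. Qed.

Lemma partial_diff f i x : differentiable f x -> partial i f x = 'd f x (delta_mx ord0 i).
Proof. by move=> df; rewrite /partial deriveE. Qed.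

Lemma diff_partial f x v : differentiable f x ->
  'd f x v = \sum_i v ord0 i * partial i f x.
Proof.
move=> df; rewrite {1}(row_sum_delta v) linear_sum; apply: eq_bigr => i _.
by rewrite linearZ/= -partial_diff.
Qed.

Lemma partialD f g i : (forall x, differentiable f x) -> (forall x, differentiable g x) ->
  partial i (fun x => f x + g x) = (fun x => partial i f x + partial i g x).
Proof. by move=> df dg; apply/funext => x; rewrite /partial deriveD//; exact: diff_derivable. Qed.

Lemma partialM f g i : (forall x, differentiable f x) -> (forall x, differentiable g x) ->
  partial i (fun x => f x * g x) = (fun x => f x * partial i g x + g x * partial i f x).
Proof. by move=> df dg; apply/funext => x; rewrite /partial deriveM//; exact: diff_derivable. Qed.

Lemma partialV f i : (forall x, differentiable f x) -> (forall x, f x != 0) ->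
  partial i (fun x => (f x)^-1) = (fun x => -1 * (((f x)^-1 * (f x)^-1) * partial i f x)).
Proof.
move=> df f0; apply/funext => x; rewrite /partial deriveV//; last exact: diff_derivable.
by rewrite /GRing.scale/= mulN1r mulNr expr2 invfM.
Qed.

(** By the product and quotient rules this class is stable under [partial], which yields all closure
    properties of [smooth] at once. *)
Inductive smooth_alg : ('rV[R]_n -> R) -> Prop :=
| sa_smooth f of smooth f : smooth_alg f
| sa_cst (c : R) : smooth_alg (fun=> c)
| sa_add f g of smooth_alg f & smooth_alg g : smooth_alg (fun x => f x + g x)
| sa_mul f g of smooth_alg f & smooth_alg g : smooth_alg (fun x => f x * g x)
| sa_inv f of smooth_alg f & (forall x, f x != 0) : smooth_alg (fun x => (f x)^-1).

Lemma smooth_alg_smooth f : smooth_alg f -> smooth f.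
Proof.
apply: smooth_coind => {}f; elim=> {f}.
- move=> f sf; split=> [x|i]; first exact: smooth_differentiable.
  by apply: sa_smooth; exact: smooth_partial.
- move=> c; split=> [x|i]; first exact: differentiable_cst.
  have -> : partial i (fun=> c) = (fun=> 0).
    by apply/funext => x; rewrite /partial derive_cst.
  exact: sa_cst.
- move=> f g sf [df pf] sg [dg pg]; split=> [x|i]; first exact: differentiableD.
  by rewrite partialD//; exact: sa_add.
- move=> f g sf [df pf] sg [dg pg]; split=> [x|i]; first exact: differentiableM.
  by rewrite partialM//; apply: sa_add; exact: sa_mul.
- move=> f sf [df pf] f0; split=> [x|i]; first exact: differentiableV.
  rewrite partialV//; apply: sa_mul; first exact: sa_cst.
  by apply: sa_mul => //; apply: sa_mul; exact: sa_inv.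
Qed.

Lemma smooth_cst (c : R) : smooth (fun _ : 'rV[R]_n => c).
Proof. exact/smooth_alg_smooth/sa_cst. Qed.

Lemma smoothD f g : smooth f -> smooth g -> smooth (fun x => f x + g x).
Proof. by move=> sf sg; apply/smooth_alg_smooth/sa_add; exact: sa_smooth. Qed.

Lemma smoothM f g : smooth f -> smooth g -> smooth (fun x => f x * g x).
Proof. by move=> sf sg; apply/smooth_alg_smooth/sa_mul; exact: sa_smooth. Qed.

Lemma smoothV f : smooth f -> (forall x, f x != 0) -> smooth (fun x => (f x)^-1).
Proof. by move=> sf f0; apply/smooth_alg_smooth/sa_inv => //; exact: sa_smooth. Qed.

Lemma smoothZ a f : smooth f -> smooth (fun x => a * f x).
Proof. by move=> sf; apply: smoothM => //; exact: smooth_cst. Qed.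

Lemma smoothB f g : smooth f -> smooth g -> smooth (fun x => f x - g x).
Proof.
move=> sf sg; rewrite (_ : (fun _ => _) = (fun x => f x + -1 * g x)).
  by apply: smoothD => //; exact: smoothZ.
by apply/funext => x; rewrite mulN1r.
Qed.

Lemma smooth_prod (I : Type) (s : seq I) (F : I -> 'rV[R]_n -> R) :
  (forall j, smooth (F j)) -> smooth (fun x => \prod_(j <- s) F j x).
Proof.
move=> sF; elim: s => [|j s IH].
  by rewrite (_ : (fun _ => _) = fun=> 1);
    [exact: smooth_cst|apply/funext => x; rewrite big_nil].
rewrite (_ : (fun _ => _) = fun x => F j x * \prod_(j <- s) F j x).
  exact: smoothM.
by apply/funext => x; rewrite big_cons.
Qed.

Lemma partialZ a f i : smooth f ->
  partial i (fun x => a * f x) = (fun x => a * partial i f x).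
Proof.
move=> sf; apply/funext => x; rewrite /partial.
by rewrite (_ : (fun _ => _) = a *: f)// deriveZ//; exact: smooth_derivable.
Qed.

Lemma partialB f g i : smooth f -> smooth g ->
  partial i (fun x => f x - g x) = (fun x => partial i f x - partial i g x).
Proof.
by move=> sf sg; apply/funext => x; rewrite /partial deriveB//; exact: smooth_derivable.
Qed.

Lemma partial_translate f i v : partial i (fun x => f (x + v)) = (fun x => partial i f (x + v)).
Proof.
apply/funext => x; rewrite /partial /derive /=.
by under eq_fun do rewrite -addrA.
Qed.

Lemma smooth_translate f v : smooth f -> smooth (fun x => f (x + v)).
Proof.
move=> sf; apply: (@smooth_coind (fun g => exists2 f, smooth f & g = (fun x => f (x + v)))); last by exists f.
move=> _ [{sf}g sg ->]; split=> [x|i].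
  apply: differentiable_comp; last exact: smooth_differentiable.
  by apply: differentiableD; [by have [] := is_diff_id x|exact: differentiable_cst].
by exists (partial i g); [exact: smooth_partial|rewrite partial_translate].
Qed.

Definition smooth1 (F : R -> R) := forall k t, derivable (derive1n k F) t 1.

Lemma smooth_coord (F : R -> R) (a c : R) (i : 'I_n) : smooth1 F ->
  smooth (fun x => F (a * x ord0 i + c)).
Proof.
move=> sF; apply: (@smooth_coind (fun g => exists k b,
    g = (fun x => b * (derive1n k F) (a * x ord0 i + c)))); last first.
  by exists 0%N, 1; apply/funext => x; rewrite mul1r.
move=> _ [k [b ->]].
pose L x : R := a * x ord0 i + c.
have dL x : differentiable L x.
  apply: differentiableD; last exact: differentiable_cst.
  apply: differentiableM; first exact: differentiable_cst.
  exact: differentiable_coord.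
have DL x v : 'd L x v = a * v ord0 i.
  rewrite -deriveE// /derive; apply: cvg_lim => //.
  apply: cvg_near_cst; near=> h.
  have h0 : h != 0 by near: h; exact: nbhs_dnbhs_neq.
  rewrite /= /L !mxE /GRing.scale/=; field.
  exact: h0.
have dF x : differentiable (derive1n k F) (L x) by apply/derivable1_diffP.
have dC x : differentiable ((derive1n k F) \o L) x by exact: differentiable_comp.
split=> [x|j].
  by apply: differentiableM; [exact: differentiable_cst|exact: dC].
exists k.+1, (b * (a * (i == j)%:R)); apply/funext => x.
rewrite /partial (_ : (fun _ => _) = b *: ((derive1n k F) \o L))//.
rewrite deriveZ; last exact: diff_derivable.
rewrite deriveE// diff_comp//= DL deriv1E//.
by rewrite mxE eqxx/= eq_sym /GRing.scale/= mulrA.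
Unshelve. all: by end_near. Qed.

End smooth_theory.

(** * The flat function exp (-1/t) *)

Section flat_exponential.
Context {R : realType}.
Implicit Types (p : {poly R}) (s t : R).

(** Each power s^i is at most i^i exp s, by 1 + x <= exp x at x = s / i. *)
Lemma poly_le_expR p : exists2 C : R, 0 <= C & forall s, 0 <= s -> `|p.[s]| <= C * expR s.
Proof.
have powle i s : 0 <= s -> s ^+ i <= i%:R ^+ i * expR s.
  move=> s0; case: i => [|i]; first by rewrite !expr0 mul1r; apply: le_trans (expR_ge1Dx s); rewrite lerDl.
  have i0 : i.+1%:R != 0 :> R by rewrite pnatr_eq0.
  have h : s <= i.+1%:R * expR (s / i.+1%:R).
    rewrite -ler_pdivrMl ?ltr0n// mulrC; apply: le_trans (expR_ge1Dx _); by rewrite lerDr.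
  rewrite (_ : expR s = expR (s / i.+1%:R) ^+ i.+1); last first.
    by rewrite -expRM_natl mulrC divfK.
  by rewrite -exprMn lerXn2r// nnegrE// mulr_ge0// expR_ge0.
exists (\sum_(i < size p) `|p`_i| * i%:R ^+ i).
  by apply: sumr_ge0 => i _; rewrite mulr_ge0// exprn_ge0.
move=> s s0; rewrite horner_coef mulr_suml; apply: le_trans (ler_norm_sum _ _ _) _.
apply: ler_sum => i _; rewrite normrM -mulrA ler_wpM2l// normrX ger0_norm//.
exact: powle.
Qed.

(** The polynomial factor in 1/t makes the class stable under differentiation, which sends p to X^2
    (p - p'). *)
Definition flatp p t : R := if 0 < t then p.[t^-1] * expR (- t^-1) else 0.

Lemma is_derive_flatp p t : is_derive t 1 (flatp p) (flatp ('X^2 * (p - p^`())) t).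
Proof.
have [t0|t0|<-] := ltgtP 0 t.
- have near_t : \forall x \near t, p.[x^-1] * expR (- x^-1) = flatp p x.
    by near=> x; rewrite /flatp; case: ifPn => // /negP[]; near: x; exact: lt_nbhsr.
  apply: (near_eq_is_derive near_t).
  have tn0 : t != 0 by rewrite gt_eqF.
  have dV : is_derive t 1 (fun x : R => x^-1) (- t^-2).
    by apply: is_derive_eq; [exact: (is_deriveV (f := id) tn0)|rewrite /GRing.scale/= mulr1].
  have dp : is_derive t 1 (fun x : R => p.[x^-1]) ((- t^-2) * (p^`()).[t^-1]).
    have dh : is_derive t^-1 1 (horner p) (p^`()).[t^-1].
      by rewrite derivE derive1E; apply: DeriveDef => //; exact: derivable_horner.
    rewrite mulrC; exact: (@is_derive1_comp _ (horner p) (fun x => x^-1) _ _ _ dh dV).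
  have dN : is_derive t 1 (fun x : R => - x^-1) (t^-2).
    by have := is_deriveN dV; rewrite opprK.
  have de : is_derive t 1 (fun x : R => expR (- x^-1)) (t^-2 * expR (- t^-1)).
    rewrite mulrC; exact: (@is_derive1_comp _ expR (fun x => - x^-1) _ _ _ (is_derive_expR _) dN).
  apply: (is_derive_eq (is_deriveM dp de)).
  rewrite /flatp t0 hornerM hornerXn hornerD hornerN /GRing.scale/= exprVn.
  by ring.
- have near_t : \forall x \near t, cst 0 x = flatp p x.
    by near=> x; rewrite /flatp/= ltNge ltW//; near: x; exact: lt_nbhsl.
  apply: (near_eq_is_derive near_t).
  by rewrite /flatp ltNge (ltW t0)/=; exact: is_derive_cst.
- have f00 q : flatp q 0 = 0 by rewrite /flatp ltxx.
  rewrite f00.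
  (* The bound is taken for X^2 p rather than p, so that a factor |h| survives the division by h in
     the difference quotient at 0. *)
  have [C C0 hC] := poly_le_expR ('X^2 * p).
  have key h : `|h^-1 * flatp p h| <= C * `|h|.
    rewrite /flatp; case: ifPn => h0; last by rewrite mulr0 normr0 mulr_ge0.
    have := hC h^-1; rewrite invr_ge0 (ltW h0) => /(_ isT).
    rewrite hornerM hornerXn normrM [X in X * _]ger0_norm ?exprn_ge0 ?invr_ge0 ?(ltW h0)//.
    move=> le1; rewrite !normrM (gtr0_norm h0) [X in X * _]ger0_norm ?invr_ge0 ?(ltW h0)//.
    rewrite (ger0_norm (expR_ge0 _)) expRN mulrA ler_pdivrMr ?expR_gt0//.
    rewrite -(ler_pM2l (x := h^-1)) ?invr_gt0// mulrA -expr2.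
    by rewrite !mulrA [h^-1 * C]mulrC -(mulrA C) mulVf ?mulr1 ?gt_eqF.
  have lim0 : h^-1 *: (flatp p (h *: 1 + 0) - flatp p 0) @[h --> (0:R)^'] --> (0 : R).
    apply/cvgr0Pnorm_lt => e e0.
    near=> h; rewrite f00 subr0 addr0 /GRing.scale/= mulr1.
    apply: le_lt_trans (key h) _.
    have hd : `|h| < e / (C + 1).
      near: h; apply: dnbhs0_lt; rewrite divr_gt0// ltr_wpDl//.
    have C1 : 0 < C + 1 by rewrite ltr_wpDl.
    move: hd; rewrite ltr_pdivlMr//; have := normr_ge0 h; nra.
  apply: DeriveDef; first by apply/cvg_ex; exists 0.
  by rewrite /derive; apply/cvg_lim.
Unshelve. all: by end_near. Qed.

Lemma derive1_flatp p : derive1 (flatp p) = flatp ('X^2 * (p - p^`())).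
Proof. by apply/funext => t; rewrite derive1E; have [] := is_derive_flatp p t. Qed.

Lemma flatp_smooth1 p : smooth1 (flatp p).
Proof.
move=> k t; suff [q ->] : exists q, derive1n k (flatp p) = flatp q.
  by have [] := is_derive_flatp q t.
elim: k => [|k [q IH]]; first by exists p.
by exists ('X^2 * (q - q^`())); rewrite derive1nS IH derive1_flatp.
Qed.

Definition flat t : R := flatp 1 t.

Lemma flat_smooth1 : smooth1 flat. Proof. exact: flatp_smooth1. Qed.

Lemma flat_gt0 t : 0 < t -> 0 < flat t.
Proof. by move=> t0; rewrite /flat/flatp t0 hornerC mul1r expR_gt0. Qed.

Lemma flat_eq0 t : t <= 0 -> flat t = 0.
Proof. by move=> t0; rewrite /flat/flatp ltNge t0. Qed.

Lemma flat_ge0 t : 0 <= flat t.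
Proof. by have [/flat_eq0->|/flat_gt0/ltW] := leP t 0. Qed.

End flat_exponential.

(** * Smooth cutoff functions of boxes *)

Section plateau.
Context {R : realType} {n : nat}.
Implicit Types (p x : 'rV[R]_n) (r : R).

(* A smooth step in the coordinate i along a x_i + c, from 0 for a x_i + c <= 0
   to 1 for a x_i + c >= 1. *)
Definition step (a c : R) (i : 'I_n) x : R :=
  flat (a * x ord0 i + c) / (flat (a * x ord0 i + c) + flat ((- a) * x ord0 i + (1 - c))).

Lemma step_denom (a c : R) (i : 'I_n) x :
  0 < flat (a * x ord0 i + c) + flat ((- a) * x ord0 i + (1 - c)).
Proof.
have [h|h] := leP (a * x ord0 i + c) 0; last by rewrite ltr_pwDl ?flat_gt0 ?flat_ge0.
by rewrite ltr_wpDl ?flat_ge0// flat_gt0//; lra.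
Qed.

Lemma step_smooth a c i : smooth (step a c i).
Proof.
apply: smoothM; first by apply: smooth_coord; exact: flat_smooth1.
apply: smoothV => [|x]; last by rewrite gt_eqF// step_denom.
by apply: smoothD; apply: smooth_coord; exact: flat_smooth1.
Qed.

Lemma step_ge0 a c i x : 0 <= step a c i x.
Proof. by rewrite divr_ge0 ?flat_ge0// ltW// step_denom. Qed.

Lemma step_le1 a c i x : step a c i x <= 1.
Proof. by rewrite ler_pdivrMr ?step_denom// mul1r lerDl flat_ge0. Qed.

Lemma step_eq1 a c i x : 1 <= a * x ord0 i + c -> step a c i x = 1.
Proof.
move=> h; have := step_denom a c i x; rewrite /step.
by rewrite [flat (- a * _ + _)]flat_eq0 ?addr0 => [h0|]; [rewrite divff ?gt_eqF|lra].
Qed.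

Lemma step_eq0 a c i x : a * x ord0 i + c <= 0 -> step a c i x = 0.
Proof. by move=> h; rewrite /step flat_eq0// mul0r. Qed.

(** A cutoff of the closed box from a to b with transition layers of width d outside it: each
    coordinate contributes a rising and a falling step. *)
Definition plateau (a b : 'rV[R]_n) (d : R) x : R :=
  \prod_(i < n) (step d^-1 (1 - a ord0 i / d) i x * step (- d^-1) (1 + b ord0 i / d) i x).

Variables (a b : 'rV[R]_n) (d : R).
Hypothesis d0 : 0 < d.

Lemma plateau_smooth : smooth (plateau a b d).
Proof.
by apply: smooth_prod => i; apply: smoothM; exact: step_smooth.
Qed.

Lemma plateau_ge0 x : 0 <= plateau a b d x.
Proof. by apply: prodr_ge0 => i _; rewrite mulr_ge0 ?step_ge0. Qed.

Lemma plateau_le1 x : plateau a b d x <= 1.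
Proof.
apply: prodr_ile1 => i _; rewrite mulr_ge0 ?step_ge0//=.
by rewrite mulr_ile1 ?step_ge0 ?step_le1.
Qed.

Lemma plateau_eq1 x : (forall i, a ord0 i <= x ord0 i <= b ord0 i) -> plateau a b d x = 1.
Proof.
move=> h; apply: big1 => i _; have /andP[h1 h2] := h i.
have e1 : d^-1 * x ord0 i + (1 - a ord0 i / d) = 1 + (x ord0 i - a ord0 i) / d by ring.
have e2 : - d^-1 * x ord0 i + (1 + b ord0 i / d) = 1 + (b ord0 i - x ord0 i) / d by ring.
by rewrite !step_eq1 ?mulr1// ?e1 ?e2 lerDl divr_ge0 ?subr_ge0 ?(ltW d0).
Qed.

Lemma plateau_neq0 x : plateau a b d x != 0 ->
  forall i, a ord0 i - d < x ord0 i < b ord0 i + d.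
Proof.
move=> h i; apply/andP; split; rewrite ltNge; apply/negP => hi; move/negP: h; apply;
  rewrite /plateau (bigD1 i)//=.
- rewrite step_eq0 ?mul0r//.
  have -> : d^-1 * x ord0 i + (1 - a ord0 i / d) = (x ord0 i - (a ord0 i - d)) / d.
    by field; rewrite gt_eqF.
  by rewrite ler_pdivrMr// mul0r subr_le0.
- rewrite [step (- _) _ _ _]step_eq0 ?mulr0 ?mul0r//.
  have -> : - d^-1 * x ord0 i + (1 + b ord0 i / d) = (b ord0 i + d - x ord0 i) / d.
    by field; rewrite gt_eqF.
  by rewrite ler_pdivrMr// mul0r subr_le0.
Qed.

End plateau.

(** * Mean values along lines and test functions on the whole space *)

Section smooth_mean_value.
Context {R : realType} {n : nat}.
Implicit Types (f g phi : 'rV[R]_n -> R) (i : 'I_n) (x v : 'rV[R]_n).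

Lemma is_derive_line f x v (s : R) : differentiable f (x + s *: v) ->
  is_derive s 1 (fun s => f (x + s *: v)) (\sum_i v ord0 i * partial i f (x + s *: v)).
Proof.
move=> df; have dv : derivable f (x + s *: v) v by exact: diff_derivable.
have E : (fun h : R => h^-1 *: (((fun s => f (x + s *: v)) \o shift s) (h *: 1) - f (x + s *: v))) =
    (fun h : R => h^-1 *: ((f \o shift (x + s *: v)) (h *: v) - f (x + s *: v))).
  apply/funext => h /=; congr (_ *: (f _ - _)).
  by rewrite [h *: 1]mulr1 scalerDl addrCA.
have -> : \sum_i v ord0 i * partial i f (x + s *: v) = 'D_v f (x + s *: v).
  by rewrite deriveE// diff_partial.
apply: DeriveDef.
  by rewrite /derivable E.
by rewrite /derive E.
Qed.

Lemma smooth_mvt f x v : smooth f -> exists2 c : R, 0 <= c <= 1 &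
  f (x + v) - f x = \sum_i v ord0 i * partial i f (x + c *: v).
Proof.
move=> sf.
have dl (s : R) : is_derive s 1 (fun s => f (x + s *: v)) (\sum_i v ord0 i * partial i f (x + s *: v)).
  by apply: is_derive_line; exact: smooth_differentiable.
have [|c] := @MVT R (fun s => f (x + s *: v)) _ 0 1 ltr01 (fun s _ => dl s).
  apply: continuous_subspaceT => s; apply: differentiable_continuous.
  by apply/derivable1_diffP; have [] := dl s.
rewrite in_itv/= => /andP[c0 c1].
rewrite scale1r scale0r addr0 subr0 mulr1 => E; exists c => //.
by rewrite !ltW.
Qed.

Definition supp_in r phi := forall x, phi x != 0 -> `|x| <= r.

(** Test functions on the whole space. A bounding ball is easier to carry through sums and
    translations than the closure of the support. *)
Definition is_tf phi := smooth phi /\ exists2 r : R, 0 <= r & supp_in r phi.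

Lemma supp_in_partial r phi i : supp_in r phi -> supp_in r (partial i phi).
Proof.
move=> sphi x; apply: contraNT; rewrite -ltNge => rx.
apply/eqP; rewrite /partial -(derive_cst (0:R) x (delta_mx ord0 i)).
apply: near_eq_derive.
have : \forall y \near x, r < `|y|.
  have /cvgrPdist_lt/(_ (`|x| - r)) := @norm_continuous _ _ x.
  rewrite subr_gt0 => /(_ rx); apply: filterS => y; have := ler_norm (`|x| - `|y|); lra.
apply: filterS => y ry; apply/eqP/negP => /negP/sphi; lra.
Qed.

Lemma tf_partial phi i : is_tf phi -> is_tf (partial i phi).
Proof.
move=> [sp [r r0 hr]]; split; first exact: smooth_partial.
by exists r => //; exact: supp_in_partial.
Qed.

Lemma tf_smooth phi : is_tf phi -> smooth phi. Proof. by case. Qed.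

Lemma tfM f phi : smooth f -> is_tf phi -> is_tf (fun x => f x * phi x).
Proof.
move=> sf [sp [r r0 hr]]; split; first exact: smoothM.
by exists r => // x; rewrite mulf_eq0 negb_or => /andP[_]; exact: hr.
Qed.

Lemma tfD phi psi : is_tf phi -> is_tf psi -> is_tf (fun x => phi x + psi x).
Proof.
move=> [sp [r r0 hr]] [sq [s s0 hs]]; split; first exact: smoothD.
exists (maxr r s) => [|x h]; first by rewrite le_max r0.
rewrite le_max; have [p0|p0] := eqVneq (phi x) 0; last by rewrite hr.
by rewrite (hs x) ?orbT//; move: h; rewrite p0 add0r.
Qed.

Lemma tfZ a phi : is_tf phi -> is_tf (fun x => a * phi x).
Proof. by apply: tfM; exact: smooth_cst. Qed.

Lemma tf0 : is_tf (fun=> 0 : R).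
Proof. by split; [exact: smooth_cst|exists 0 => // x; rewrite eqxx]. Qed.

Lemma tf_translate phi v : is_tf phi -> is_tf (fun x => phi (x + v)).
Proof.
move=> [sp [r r0 hr]]; split; first exact: smooth_translate.
exists (r + `|v|) => [|x /hr h]; first by rewrite addr_ge0.
by have := ler_normD (x + v) (- v); rewrite addrK normrN; lra.
Qed.

End smooth_mean_value.

Section nrm2_sum.
Context d (T : measurableType d) (R : realType) (mu : {measure set T -> \bar R}).

Lemma nrm2Z a (f : T -> R) : L2 mu f -> nrm2 mu (fun x => a * f x) = `|a| * nrm2 mu f.
Proof. exact: (seminormZ (nrm2_seminorm mu)). Qed.

Lemma nrm2D (f g : T -> R) : L2 mu f -> L2 mu g ->
  nrm2 mu (fun x => f x + g x) <= nrm2 mu f + nrm2 mu g.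
Proof. exact: (seminormD (nrm2_seminorm mu)). Qed.

Lemma nrm2B (f g : T -> R) : L2 mu f -> L2 mu g ->
  nrm2 mu (fun x => f x - g x) <= nrm2 mu f + nrm2 mu g.
Proof. exact: (seminormB (L2_is_subspace mu) (nrm2_seminorm mu)). Qed.

Lemma nrm20 : nrm2 mu (fun=> 0) = 0.
Proof. exact: (seminorm0 (L2_is_subspace mu) (nrm2_seminorm mu)). Qed.

Lemma nrm2_sum (I : Type) (s : seq I) (P : pred I) (F : I -> T -> R) :
  (forall i, P i -> L2 mu (F i)) ->
  nrm2 mu (fun x => \sum_(i <- s | P i) F i x) <= \sum_(i <- s | P i) nrm2 mu (F i).
Proof.
move=> LF; elim: s => [|i s IH].
  rewrite big_nil (_ : (fun _ => _) = fun=> 0) ?nrm20//.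
  by apply/funext => x; rewrite big_nil.
rewrite big_cons; case Pi : (P i); last first.
  by apply: le_trans IH; rewrite (_ : (fun _ => _) = fun x => \sum_(i <- s | P i) F i x)//;
    apply/funext => x; rewrite big_cons Pi.
rewrite (_ : (fun _ => _) = fun x => F i x + \sum_(i <- s | P i) F i x); last first.
  by apply/funext => x; rewrite big_cons Pi.
apply: le_trans (nrm2D _ _) _; [exact: LF|exact: L2_sum|exact: lerD].
Qed.

End nrm2_sum.

Lemma itg_indic d (T : measurableType d) (R : realType) (mu : {measure set T -> \bar R}) (A : set T) :
  measurable A -> (mu A < +oo)%E -> itg mu (\1_A : T -> R).
Proof.
move=> mA Aoo; apply/integrableP; split; first exact/measurable_EFinP/measurable_indic.
rewrite (eq_integral (fun x => (\1_A x)%:E)) ?integral_indic ?setIT// => x _.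
by rewrite gee0_abs// lee_fin.
Qed.

(** * Integration by parts and translation estimates for test functions *)

Section test_calculus.
Context {R : realType} {n : nat}.
Notation mu := (@leb R n.+1).
Implicit Types (f g phi psi : 'rV[R]_n.+1 -> R) (i : 'I_n.+1) (x v : 'rV[R]_n.+1).

Lemma ball_compact (r : R) : compact [set x : 'rV[R]_n.+1 | `|x| <= r].
Proof.
apply: bounded_closed_compact.
  exists r; split; first exact: num_real.
  by move=> M rM x /= xr; apply: le_trans xr (ltW rM).
rewrite (_ : mkset _ = (fun x : 'rV[R]_n.+1 => `|x|) @^-1` [set y | y <= r])//.
by apply: closed_comp; [move=> x _; exact: norm_continuous|exact: closed_le].
Qed.

Lemma continuous_bounded_ball f r : continuous f ->
  exists2 C : R, 0 <= C & forall x, `|x| <= r -> `|f x| <= C.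
Proof.
move=> cf; have [r0|r0] := ltP r 0.
  by exists 0 => // x; have := normr_ge0 x; lra.
have := @EVT_max_rV R n.+1 (fun x => `|f x|) [set x | `|x| <= r].
case.
- by exists 0; rewrite /= normr0.
- exact: ball_compact.
- apply: continuous_subspaceT => x; apply: continuous_comp; first exact: cf.
  exact: norm_continuous.
- by move=> c _ hc; exists `|f c| => // x xr; apply: hc; rewrite inE.
Qed.

Lemma tf_bounded phi : is_tf phi -> exists2 C : R, 0 <= C & forall x, `|phi x| <= C.
Proof.
move=> [sp [r r0 hr]].
have [C C0 hC] := continuous_bounded_ball r (smooth_continuous sp).
exists C => // x; have [->|p0] := eqVneq (phi x) 0; first by rewrite normr0.
by apply: hC; exact: hr.
Qed.

Lemma tf_measurable phi : is_tf phi -> measurable_fun setT phi.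
Proof. by move=> [sp _]; apply: rV_continuous_measurable; exact: smooth_continuous. Qed.

Definition nball (r : R) : set 'rV[R]_n.+1 := [set x | `|x| <= r].

Lemma nball_measurable r : measurable (nball r).
Proof.
have [r0|r0] := ltP r 0.
  by rewrite (_ : nball r = set0)//; apply/seteqP; split => // x; rewrite /nball/= leNgt => /negP[]; exact: lt_le_trans r0 _.
rewrite (_ : nball r = cube r); first exact: cube_measurable.
by apply/seteqP; split => x /= => [/(rV_norm_le _ r0)|] /mem_cube// /(rV_norm_le _ r0).
Qed.

Lemma nball_lty r : (mu (nball r) < +oo)%E.
Proof.
apply: (@leb_bounded_lty _ _ _ r); first exact: nball_measurable.
by move=> x xr i; apply: le_trans (rV_coord_le x i) xr.
Qed.

Lemma nball_itg r c : itg mu (fun x => c * \1_(nball r) x).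
Proof.
by apply: itgZ; apply: itg_indic; [exact: nball_measurable|exact: nball_lty].
Qed.

Lemma bounded_supp_itg f r C : measurable_fun setT f -> (forall x, `|f x| <= C) ->
  (forall x, f x != 0 -> `|x| <= r) -> itg mu f.
Proof.
move=> mf fC fr; apply: itg_le (nball_itg r C) _ => // x.
have [->|f0] := eqVneq (f x) 0.
  by rewrite normr0 mulr_ge0// (le_trans _ (fC x)).
by rewrite indicE mem_set ?mulr1//; exact: fr.
Qed.

Lemma bounded_supp_L2 f r C : measurable_fun setT f -> (forall x, `|f x| <= C) ->
  (forall x, f x != 0 -> `|x| <= r) -> L2 mu f.
Proof.
move=> mf fC fr; split => //; apply: (@bounded_supp_itg _ r (C ^+ 2)).
- exact: measurable_funX.
- by move=> x; rewrite normrX lerXn2r ?nnegrE// (le_trans _ (fC x)).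
- by move=> x; rewrite sqrf_eq0; exact: fr.
Qed.

Lemma bounded_supp_nrm2 f r C : measurable_fun setT f -> (forall x, `|f x| <= C) ->
  (forall x, f x != 0 -> `|x| <= r) -> nrm2 mu f <= C * Num.sqrt (fine (mu (nball r))).
Proof.
move=> mf fC fr.
have C0 : 0 <= C := le_trans (normr_ge0 _) (fC 0).
have Lf := bounded_supp_L2 mf fC fr.
rewrite -(ler_pXn2r (ltn0Sn 1)) ?nnegrE ?nrm2_ge0 ?mulr_ge0 ?sqrtr_ge0//.
rewrite nrm2_sqr exprMn sqr_sqrtr ?fine_ge0//.
have -> : C ^+ 2 * fine (mu (nball r)) = \int[mu]_x (C ^+ 2 * \1_(nball r) x).
  rewrite RintegralZl//; last first.
    by apply: itg_indic; [exact: nball_measurable|exact: nball_lty].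
  congr (_ * _); rewrite /Rintegral integral_indic ?setIT//; exact: nball_measurable.
apply: le_Rintegral => //; [by case: Lf|exact: nball_itg|move=> x _].
have [->|f0] := eqVneq (f x) 0; first by rewrite expr0n/= mulr_ge0// sqr_ge0.
rewrite indicE mem_set; last exact: fr.
by rewrite mulr1 -(real_normK (num_real (f x))) lerXn2r ?nnegrE.
Qed.

Lemma tf_itg phi : is_tf phi -> itg mu phi.
Proof.
move=> tp; have [C C0 hC] := tf_bounded tp; have [_ [r r0 hr]] := tp.
by apply: (@bounded_supp_itg _ r C) => //; exact: tf_measurable.
Qed.

Lemma tf_L2 phi : is_tf phi -> L2 mu phi.
Proof.
move=> tp; have [C C0 hC] := tf_bounded tp; have [_ [r r0 hr]] := tp.
by apply: (@bounded_supp_L2 _ r C) => //; exact: tf_measurable.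
Qed.

Lemma tf_lipschitz phi : is_tf phi ->
  exists2 C : R, 0 <= C & forall x v, `|phi (x + v) - phi x| <= C * `|v|.
Proof.
move=> tp; have /choice[C hC] : forall i, exists C : R, 0 <= C /\ forall x, `|partial i phi x| <= C.
  by move=> i; have [C C0 hC] := tf_bounded (tf_partial i tp); exists C.
exists (\sum_i C i) => [|x v]; first by apply: sumr_ge0 => i _; case: (hC i).
have [c _ ->] := smooth_mvt x v (tf_smooth tp).
apply: le_trans (ler_norm_sum _ _ _) _; rewrite mulr_suml; apply: ler_sum => i _.
rewrite normrM mulrC; apply: ler_pM => //; first by case: (hC i).
exact: rV_coord_le.
Qed.

Lemma tf_taylor phi : is_tf phi -> exists2 C : R, 0 <= C & forall x v,
  `|phi (x + v) - phi x - \sum_i v ord0 i * partial i phi x| <= C * `|v| ^+ 2.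
Proof.
move=> tp.
have /choice[C hC] : forall i, exists C : R, 0 <= C /\
    forall x v, `|partial i phi (x + v) - partial i phi x| <= C * `|v|.
  by move=> i; have [C C0 hC] := tf_lipschitz (tf_partial i tp); exists C.
exists (\sum_i C i) => [|x v]; first by apply: sumr_ge0 => i _; case: (hC i).
have [c /andP[c0 c1] ->] := smooth_mvt x v (tf_smooth tp).
rewrite -sumrB; apply: le_trans (ler_norm_sum _ _ _) _; rewrite mulr_suml; apply: ler_sum => i _.
rewrite -mulrBr normrM expr2 mulrCA; apply: ler_pM => //; first exact: rV_coord_le.
apply: le_trans ((hC i).2 _ _) _; rewrite ler_wpM2l//; first by case: (hC i).
by rewrite normrZ ler_piMl// ger0_norm.
Qed.

(* The Taylor remainder is supported in a fixed ball, hence O(|v|^2) in L^1 and L^2. *)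
Lemma tf_remainder phi : is_tf phi -> exists2 C : R, 0 <= C &
  forall v, `|v| <= 1 ->
    let rem x := phi (x + v) - phi x - \sum_i v ord0 i * partial i phi x in
    [/\ itg mu rem, L2 mu rem, \int[mu]_x `|rem x| <= C * `|v| ^+ 2 &
        nrm2 mu rem <= C * `|v| ^+ 2].
Proof.
move=> tp; have [C C0 hC] := tf_taylor tp; have [sp [r r0 hr]] := tp.
pose V := fine (mu (nball (r + 1))).
have V0 : 0 <= V by rewrite fine_ge0.
exists (C * V + C * Num.sqrt V) => [|v v1 rem].
  by rewrite addr_ge0// mulr_ge0// sqrtr_ge0.
have mrem : measurable_fun setT rem.
  apply: measurable_funB.
    apply: measurable_funB; last exact: tf_measurable.
    by apply: tf_measurable; exact: tf_translate.
  apply: measurable_sum => i; apply: measurable_funM => //.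
  by apply: tf_measurable; exact: tf_partial.
have srem x : rem x != 0 -> `|x| <= r + 1.
  move=> h; rewrite leNgt; apply/negP => xr; move/negP: h; apply.
  have px : phi x = 0 by apply/eqP/negP => /negP/hr; lra.
  have pv : phi (x + v) = 0.
    apply/eqP/negP => /negP/hr; have := ler_normD (x + v) (- v); rewrite addrK normrN; lra.
  rewrite /rem px pv subrr sub0r oppr_eq0 big1// => i _.
  have -> : partial i phi x = 0.
    by apply/eqP/negP => /negP/(supp_in_partial hr); lra.
  by rewrite mulr0.
have brem x : `|rem x| <= C * `|v| ^+ 2 by exact: hC.
have irem : itg mu rem by exact: bounded_supp_itg mrem brem srem.
have v20 : 0 <= `|v| ^+ 2 by rewrite exprn_ge0.
have sV : 0 <= Num.sqrt V by exact: sqrtr_ge0.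
split => //.
- exact: bounded_supp_L2 mrem brem srem.
- apply: (@le_trans _ _ (\int[mu]_x (C * `|v| ^+ 2 * \1_(nball (r + 1)) x))).
    apply: le_Rintegral => //; [exact: itg_norm|exact: nball_itg|move=> x _].
    have [->|h0] := eqVneq (rem x) 0; first by rewrite normr0 mulr_ge0 ?mulr_ge0.
    by rewrite indicE mem_set ?mulr1//; exact: srem.
  rewrite RintegralZl//; last first.
    by apply: itg_indic; [exact: nball_measurable|exact: nball_lty].
  have -> : \int[mu]_x (\1_(nball (r + 1)) x : R) = V.
    by rewrite /Rintegral integral_indic ?setIT//; exact: nball_measurable.
  by rewrite mulrAC ler_wpM2r// lerDl mulr_ge0.
- apply: le_trans (bounded_supp_nrm2 mrem brem srem) _.
  by rewrite -/V mulrAC ler_wpM2r// lerDr mulr_ge0.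
Qed.

Lemma leb_translate_itg f v : itg mu f -> itg mu (fun x => f (x + v)).
Proof. by apply: mp_itg; [exact: measurable_translate|exact: leb_translate]. Qed.

Lemma leb_translate_Rintegral f v : itg mu f ->
  \int[mu]_x f (x + v) = \int[mu]_x f x.
Proof. by move=> fi; apply: (mp_Rintegral (measurable_translate v)) => // A; exact: leb_translate. Qed.

Lemma leb_translate_L2 f v : L2 mu f -> L2 mu (fun x => f (x + v)).
Proof. by apply: mp_L2; [exact: measurable_translate|exact: leb_translate]. Qed.

Lemma leb_translate_nrm2 f v : L2 mu f -> nrm2 mu (fun x => f (x + v)) = nrm2 mu f.
Proof. by move=> fi; apply: (mp_nrm2 (measurable_translate v)) => // A; exact: leb_translate. Qed.

Lemma sum_delta (F : 'I_n.+1 -> R) i (h : R) :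
  \sum_j (h *: delta_mx ord0 i : 'rV[R]_n.+1) ord0 j * F j = h * F i.
Proof.
rewrite (bigD1 i)//= big1 ?addr0; first by rewrite !mxE !eqxx mulr1.
by move=> j /negPf ji; rewrite !mxE ji andbF mulr0 mul0r.
Qed.

Lemma norm_delta_le i (h : R) : `|h *: delta_mx ord0 i : 'rV[R]_n.+1| <= `|h|.
Proof.
rewrite normrZ ler_piMr//; apply/rV_norm_le => // j.
by rewrite mxE; case: (_ && _); rewrite ?normr1 ?normr0.
Qed.

(** By translation invariance the difference quotients have integral 0, and by [tf_remainder] they
    differ from the derivative by O(h) in L^1. *)
Lemma tf_int_partial phi i : is_tf phi -> \int[mu]_x partial i phi x = 0.
Proof.
move=> tp; have [C C0 hC] := tf_remainder tp.
have ip := tf_itg tp; have idp := tf_itg (tf_partial i tp).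
have key (h : R) : 0 < h -> h <= 1 -> `|\int[mu]_x partial i phi x| <= C * h.
  move=> h0 h1; pose v : 'rV[R]_n.+1 := h *: delta_mx ord0 i.
  have vh : `|v| <= h by have := norm_delta_le i h; rewrite (gtr0_norm h0).
  have [irem _ le1 _] := hC v (le_trans vh h1).
  rewrite -(ler_pM2l h0) -{1}(gtr0_norm h0) -normrM.
  have -> : h * \int[mu]_x partial i phi x =
      - \int[mu]_x (phi (x + v) - phi x - \sum_j v ord0 j * partial j phi x).
    have sd x : \sum_j v ord0 j * partial j phi x = h * partial i phi x by exact: sum_delta.
    have -> : \int[mu]_x (phi (x + v) - phi x - \sum_j v ord0 j * partial j phi x) =
        \int[mu]_x (phi (x + v) - phi x - h * partial i phi x).
      by apply: eq_Rintegral => x _; rewrite sd.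
    have ipv := leb_translate_itg v ip.
    rewrite RintegralB//; [|exact: itgB|exact: itgZ].
    rewrite RintegralB// leb_translate_Rintegral// subrr sub0r opprK.
    by rewrite RintegralZl.
  rewrite normrN; apply: le_trans (le_normr_Rintegral _ _) _ => //.
  apply: le_trans le1 _.
  have -> : h * (C * h) = C * h ^+ 2 by ring.
  by apply: ler_wpM2l => //; rewrite lerXn2r// nnegrE// ltW.
apply/eqP; rewrite -normr_le0; apply/ler_addgt0Pr => e e0; rewrite add0r.
have Cp : 0 < C + 1 by rewrite ltr_wpDl.
have m0 : 0 < minr 1 (e / (C + 1)) by rewrite lt_min ltr01 divr_gt0.
apply: le_trans (key (minr 1 (e / (C + 1))) m0 _) _; first by rewrite ge_min lexx.
apply: (@le_trans _ _ ((C + 1) * minr 1 (e / (C + 1)))).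
  by rewrite ler_wpM2r ?ltW// ltrDl.
by rewrite mulrC -ler_pdivlMr// ge_min lexx orbT.
Qed.

Lemma tf_ibp f phi i : smooth f -> is_tf phi ->
  \int[mu]_x (f x * partial i phi x) = - \int[mu]_x (partial i f x * phi x).
Proof.
move=> sf tp; have := tf_int_partial i (tfM sf tp).
rewrite partialM; [|by move=> x; exact: smooth_differentiable|
  by move=> x; apply: smooth_differentiable; exact: tf_smooth].
rewrite RintegralD//.
- under [X in _ + X]eq_Rintegral do rewrite mulrC.
  by move=> /eqP; rewrite addr_eq0 => /eqP.
- exact/tf_itg/(tfM sf)/tf_partial.
- under [X in integrable _ _ X]eq_fun do rewrite mulrC.
  by apply: tf_itg; apply: tfM => //; exact: smooth_partial.
Qed.

(** The translation by v is split into m translations by v / m. Each costs its first-order term and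
    a Taylor remainder O(1/m^2), so the total of the remainders vanishes as m grows. *)
Lemma tf_translate_bound phi v : is_tf phi ->
  nrm2 mu (fun x => phi (x + v) - phi x) <= \sum_i `|v ord0 i| * nrm2 mu (partial i phi).
Proof.
move=> tp; have Lp := tf_L2 tp.
have Ld (w : 'rV[R]_n.+1) : L2 mu (fun x => phi (x + w) - phi x).
  by apply: L2B => //; exact: leb_translate_L2.
have LS (w : 'rV[R]_n.+1) : L2 mu (fun x => \sum_i w ord0 i * partial i phi x).
  by apply: L2_sum => i _; apply: L2Z; apply: tf_L2; exact: tf_partial.
pose N (w : 'rV[R]_n.+1) := nrm2 mu (fun x => phi (x + w) - phi x).
pose S (w : 'rV[R]_n.+1) := \sum_i `|w ord0 i| * nrm2 mu (partial i phi).
have Nadd w m : N (w *+ m) <= m%:R * N w.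
  elim: m => [|m IH].
    rewrite mulr0n mul0r /N (_ : (fun _ => _) = fun=> 0) ?nrm20//.
    by apply/funext => x; rewrite addr0 subrr.
  rewrite -natr1 mulrDl mul1r; apply: le_trans (lerD IH (lexx _)).
  have -> : N w = nrm2 mu (fun x => phi (x + w *+ m + w) - phi (x + w *+ m)).
    exact/esym/(leb_translate_nrm2 (w *+ m) (Ld w)).
  rewrite addrC /N.
  have -> : (fun x => phi (x + w *+ m.+1) - phi x) =
    (fun x => (phi (x + w *+ m + w) - phi (x + w *+ m)) + (phi (x + w *+ m) - phi x)).
    by apply/funext => x; rewrite mulrSr addrA subrKA.
  by apply: nrm2D; [exact: (leb_translate_L2 (w *+ m) (Ld w))|exact: Ld].
have [C C0 hC] := tf_remainder tp.
have NS w : `|w| <= 1 -> N w <= S w + C * `|w| ^+ 2.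
  move=> w1; have [_ Lr _ le1] := hC w w1.
  have -> : N w = nrm2 mu (fun x => (\sum_i w ord0 i * partial i phi x) +
    (phi (x + w) - phi x - \sum_i w ord0 i * partial i phi x)).
    by congr nrm2; apply/funext => x; rewrite addrCA subrr addr0.
  apply: le_trans (nrm2D (LS w) Lr) _; apply: lerD => //.
  have Lpa i : L2 mu (partial i phi) by apply: tf_L2; exact: tf_partial.
  apply: le_trans (nrm2_sum _ _) _ => [i _|]; first exact: L2Z.
  by apply: ler_sum => i _; rewrite nrm2Z.
apply/ler_addgt0Pr => e e0.
(* Large enough for |v / m| <= 1, the range of the Taylor bound, and for the accumulated remainder C
   |v|^2 / m to stay below e. *)
pose m := (Num.truncn (maxr `|v| (C * `|v| ^+ 2 / e))).+1.
have m0 : 0 < m%:R :> R by rewrite ltr0n.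
have : maxr `|v| (C * `|v| ^+ 2 / e) < m%:R by exact: truncnS_gt.
rewrite gt_max => /andP[vm Cm].
pose w := m%:R^-1 *: v.
have -> : v = w *+ m by rewrite -scaler_nat /w scalerA mulfV ?scale1r// gt_eqF.
apply: le_trans (Nadd w m) _.
have nw : `|w| = `|v| / m%:R by rewrite normrZ ger0_norm ?invr_ge0 ?ltW// mulrC.
have w1 : `|w| <= 1 by rewrite nw ler_pdivrMr// mul1r ltW.
have := NS w w1; rewrite -(ler_pM2l m0) => /le_trans; apply.
rewrite mulrDr; apply: lerD.
  rewrite mulr_sumr; apply: ler_sum => i _.
  by rewrite mulmxnE normrMn mulrA mulr_natl.
rewrite nw exprMn expr2 [X in _ * (_ * (_ * X))]expr2.
have -> : m%:R * (C * (`|v| * `|v| * (m%:R^-1 * m%:R^-1))) = C * `|v| ^+ 2 / m%:R.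
  by field; rewrite gt_eqF.
by rewrite ler_pdivrMr// (mulrC e) -ler_pdivrMr// ltW.
Qed.

End test_calculus.

(** * Test functions *)

Section fundamental_lemma.
Context {R : realType} {n : nat}.
Notation mu := (@leb R n.+1).
Implicit Types (f g phi psi : 'rV[R]_n.+1 -> R) (i : 'I_n.+1) (x v : 'rV[R]_n.+1).

Lemma plateau_tf (a b : 'rV[R]_n.+1) (d : R) : 0 < d -> is_tf (plateau a b d).
Proof.
move=> d0; split; first exact: plateau_smooth.
exists (`|a| + `|b| + d) => [|x h]; first by rewrite !addr_ge0// ltW.
apply/rV_norm_le => [|i]; first by rewrite !addr_ge0// ltW.
have /andP[h1 h2] := plateau_neq0 d0 h i.
have := rV_coord_le a i; have := rV_coord_le b i; rewrite !ler_norml.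
have := normr_ge0 a; have := normr_ge0 b; lra.
Qed.

Lemma tf_mul_itg f phi : L2 mu f -> is_tf phi -> itg mu (fun x => f x * phi x).
Proof. by move=> Lf tp; apply: L2_mulr => //; exact: tf_L2. Qed.

Lemma tf_mul_bounded_L2 f phi : L2 mu f -> is_tf phi -> L2 mu (fun x => f x * phi x).
Proof.
move=> Lf tp; have [C C0 hC] := tf_bounded tp.
apply: (L2_le (c := C) _ Lf) => [|x].
  by apply: measurable_funM; [exact: L2_mfun Lf|exact: tf_measurable].
by rewrite normrM mulrC ler_wpM2r.
Qed.

(** Plateaus approximate the indicator of a box boundedly and pointwise; dominated convergence
    reduces the claim to [box_integral_eq0]. *)
Lemma tf_box_eq0 g : itg mu g ->
  (forall phi, is_tf phi -> \int[mu]_x (g x * phi x) = 0) -> g = (fun=> 0) %[ae mu].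
Proof.
move=> ig hg; apply: box_integral_eq0 => // a b.
have mg := itg_mfun ig.
pose d k : R := k.+1%:R^-1.
have d0 k : 0 < d k by rewrite invr_gt0.
(* The box is shrunk by the width of the transition layer, so that the support condition of [phi k]
   falls inside the open box. *)
pose phi k := plateau (\row_i (a ord0 i + d k)) (\row_i (b ord0 i - d k)) (d k).
have tphi k : is_tf (phi k) by exact: plateau_tf.
have phi_in k x : phi k x != 0 -> obox a b x.
  move=> h i; have := plateau_neq0 (d0 k) h i; rewrite !mxE in_itv/=.
  by rewrite addrK subrK.
have phi_lim x : phi k x @[k --> \oo] --> (\1_(obox a b) x : R).
  have [bx|bx] := pselect (obox a b x); last first.
    rewrite indicE memNset//; apply: cvg_near_cst; apply: nearW => k.
    by apply/eqP/negP => /negP/phi_in.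
  rewrite indicE mem_set//; apply: cvg_near_cst.
  pose m := \big[minr/1]_i minr (x ord0 i - a ord0 i) (b ord0 i - x ord0 i).
  have m0 : 0 < m.
    apply: lt_bigmin => // i _; have := bx i; rewrite in_itv/= => /andP[h1 h2].
    by rewrite lt_min !subr_gt0 h1.
  have [N hN] := invS_lt m0; exists N => // k /= /hN dk.
  apply: plateau_eq1 => // i; rewrite !mxE.
  have : m <= minr (x ord0 i - a ord0 i) (b ord0 i - x ord0 i) by exact: bigmin_le.
  rewrite le_min => /andP[]; move: dk; rewrite -/(d k); move: (d k) => dk; lra.
have mbox := obox_measurable a b.
rewrite Rintegral_mkcond.
have -> : g \_ (obox a b) = (fun x => g x * \1_(obox a b) x).
  by apply/funext => x; rewrite patchE indicE; case: ifP => _; rewrite ?mulr1 ?mulr0.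
have := @dominated_cvg _ _ _ mu setT measurableT (fun k x => (g x * phi k x)%:E)
  (fun x => (g x * \1_(obox a b) x)%:E) (fun x => `|g x|%:E).
have idom : mu.-integrable setT (fun x => `|g x|%:E) by exact: (itg_norm ig).
move=> h.
have {}h : ((\int[mu]_x (g x * phi k x)%:E)%E @[k --> \oo] -->
    (\int[mu]_x (g x * \1_(obox a b) x)%:E)%E).
  apply: h.
  - move=> k; apply/measurable_EFinP/measurable_funM => //; exact: tf_measurable.
  - move=> x _; apply: cvg_EFin; first exact: nearW.
    by apply: cvgM; [exact: cvg_cst|exact: phi_lim].
  - by [].
  - exact: idom.
  - move=> k x _; rewrite lee_fin normrM ler_piMr//.
    by rewrite ger0_norm ?plateau_ge0 ?plateau_le1.
rewrite /Rintegral (_ : (\int[mu]_x (g x * \1_(obox a b) x)%:E)%E = 0%E)//.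
rewrite -(cvg_lim _ h)//; apply: lim_near_cst => //; apply: nearW => k.
have igp : itg mu (fun x => g x * phi k x).
  have [C C0 hC] := tf_bounded (tphi k).
  apply: (itg_le _ (itgZ C (itg_norm ig))) => [|x].
    by apply: measurable_funM => //; exact: tf_measurable.
  by rewrite normrM mulrC ler_wpM2r.
by rewrite -EFin_Rintegral// hg.
Qed.

(** The radii r and 2 r leave room for a plateau that is 1 at x and supported in U; rational data
    make the family of these plateaus countable. *)
Lemma open_rat_box (U : set 'rV[R]_n.+1) x : open U -> U x ->
  exists q : 'rV[rat]_n.+1, exists r : rat, [/\ (0 < r)%R,
    forall i, `|x ord0 i - ratr (q ord0 i)| <= ratr r &
    forall y : 'rV[R]_n.+1, (forall i, `|y ord0 i - ratr (q ord0 i)| <= 2 * ratr r) -> U y].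
Proof.
move=> oU Ux.
have /nbhs_ballP[e /= e0 eU] : nbhs x U by exact: open_nbhs_nbhs.
have e42 : 0 < e / 4 by rewrite divr_gt0.
have [r] := rat_in_itvoo e42; rewrite in_itv/= => /andP[r1 r2].
have /choice[q hq] : forall i, exists q : rat, `|x ord0 i - ratr q| < ratr r.
  move=> i; have xe : x ord0 i < x ord0 i + ratr r by rewrite ltrDl.
  have [q] := rat_in_itvoo xe.
  by rewrite in_itv/= => /andP[q1 q2]; exists q; rewrite ltr_norml; lra.
exists (\row_i q i), r; split.
- by rewrite -(ltr0q R).
- by move=> i; rewrite mxE ltW.
- move=> y hy; apply: eU; split => // j i; rewrite (ord1 j).
  have := hy i; rewrite mxE /ball/= ler_norml; have := hq i; rewrite !ltr_norml; lra.
Qed.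

Definition tf_in (U : set 'rV[R]_n.+1) phi :=
  smooth phi /\ exists2 K, compact K /\ K `<=` U & forall x, phi x != 0 -> K x.

Lemma tf_in_tf U phi : tf_in U phi -> is_tf phi.
Proof.
move=> [sp [K [cK _] hK]]; split => //.
have [M [Mr hM]] := compact_bounded cK.
exists (`|M| + 1) => [|x /hK Kx]; first by rewrite addr_ge0.
by apply: hM Kx; rewrite (le_lt_trans (ler_norm M))// ltrDl.
Qed.

Lemma tf_in_test U phi : tf_in U phi <-> test_function U phi.
Proof.
split=> [[sp [K [cK KU] hK]]|[sp [cS SU]]]; last first.
  by split => //; eexists; [split; [exact: cS|exact: SU]|exact: subset_closure].
split => //.
have clK : closed K by apply: compact_closed => //; exact: norm_hausdorff.
have SK : closure [set x | phi x != 0] `<=` K.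
  by rewrite (closure_id K).1//; apply: closureS => x /= /hK.
split; last exact: subset_trans KU.
by apply: subclosed_compact SK => //; exact: closed_closure.
Qed.

Lemma tf_inM U f phi : smooth f -> tf_in U phi -> tf_in U (fun x => f x * phi x).
Proof.
move=> sf [sp [K hK hp]]; split; first exact: smoothM.
by exists K => // x; rewrite mulf_eq0 negb_or => /andP[_]; exact: hp.
Qed.

Lemma box_compact (a b : 'rV[R]_n.+1) :
  compact [set x : 'rV[R]_n.+1 | forall i, a ord0 i <= x ord0 i <= b ord0 i].
Proof.
have := @rV_compact R n.+1 (fun i => `[a ord0 i, b ord0 i]%classic).
rewrite (_ : mkset _ = [set x : 'rV[R]_n.+1 | forall i, `[a ord0 i, b ord0 i]%classic (x ord0 i)]).
  by apply => i; exact: segment_compact.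
by apply/seteqP; split=> x /= h i; have := h i; rewrite in_itv.
Qed.

Lemma rat_plateau_tf_in (U : set 'rV[R]_n.+1) (q : 'rV[rat]_n.+1) (r : rat) : (0 < r)%R ->
  (forall y : 'rV[R]_n.+1, (forall i, `|y ord0 i - ratr (q ord0 i)| <= 2 * ratr r) -> U y) ->
  tf_in U (plateau (\row_i (ratr (q ord0 i) - ratr r)) (\row_i (ratr (q ord0 i) + ratr r)) (ratr r)).
Proof.
move=> r0 hU; have r0' : 0 < ratr r :> R by rewrite ltr0q.
split; first exact: plateau_smooth.
pose a : 'rV[R]_n.+1 := \row_i (ratr (q ord0 i) - 2 * ratr r).
pose b : 'rV[R]_n.+1 := \row_i (ratr (q ord0 i) + 2 * ratr r).
exists [set x : 'rV[R]_n.+1 | forall i, a ord0 i <= x ord0 i <= b ord0 i].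
  split; first exact: box_compact.
  by move=> y /= h; apply: hU => i; have := h i; rewrite !mxE ler_norml; lra.
by move=> x h i; have := plateau_neq0 r0' h i; rewrite !mxE; lra.
Qed.

Lemma ae_countable (I : countType) (P : I -> 'rV[R]_n.+1 -> Prop) :
  (forall j : I, {ae mu, forall x, P j x}) -> {ae mu, forall x, forall j : I, P j x}.
Proof.
move=> h.
have : {ae mu, forall x, forall k, if unpickle k is Some j then P j x else True}.
  apply: ae_foralln => k; case: unpickle => [j|]; first exact: h.
  exact: aeW.
by apply: filterS => x hx j; have := hx (pickle j); rewrite pickleK.
Qed.

(** Multiplying f by a plateau supported in U reduces the claim to the whole space. Countably many
    plateaus suffice for all points of U, so the exceptional sets add up to a null set. *)
Lemma fundamental_lemma (U : set 'rV[R]_n.+1) f : open U -> L2 mu f ->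
  (forall phi, tf_in U phi -> \int[mu]_x (f x * phi x) = 0) ->
  {ae mu, forall x, U x -> f x = 0}.
Proof.
move=> oU Lf hf.
pose chi (p : 'rV[rat]_n.+1 * rat) : 'rV[R]_n.+1 -> R :=
  plateau (\row_i (ratr (p.1 ord0 i) - ratr p.2)) (\row_i (ratr (p.1 ord0 i) + ratr p.2)) (ratr p.2).
have : {ae mu, forall x, forall p, tf_in U (chi p) -> f x * chi p x = 0}.
  apply: ae_countable => p.
  have [tp|ntp] := pselect (tf_in U (chi p)); last exact: aeW.
  have := @tf_box_eq0 (fun x => f x * chi p x).
  have tp' := tf_in_tf tp.
  move=> /(_ (tf_mul_itg Lf tp')) h.
  have : (fun x => f x * chi p x) = (fun=> 0) %[ae mu].
    apply: h => phi tphi; rewrite -(hf (fun x => phi x * chi p x)).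
      by apply: eq_Rintegral => x _; rewrite mulrAC mulrA.
    by apply: tf_inM => //; case: tphi.
  by apply: filterS => x /(_ I) h' _.
apply: filterS => x hx Ux.
have [q [r [r0 h1 h2]]] := open_rat_box oU Ux.
have := hx (q, r) (rat_plateau_tf_in r0 h2).
rewrite /chi plateau_eq1 ?mulr1//; first by rewrite ltr0q.
by move=> i; have := h1 i; rewrite !mxE/= ler_norml; lra.
Qed.

Lemma fundamental_lemmaT f : L2 mu f ->
  (forall phi, is_tf phi -> \int[mu]_x (f x * phi x) = 0) -> f = (fun=> 0) %[ae mu].
Proof.
move=> Lf hf; have := fundamental_lemma openT Lf; move=> h.
have : {ae mu, forall x, setT x -> f x = 0}.
  by apply: h => phi /tf_in_tf; exact: hf.
by apply: filterS => x hx _; exact: hx.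
Qed.

(** By duality: f minus its projection onto the closure of the test functions is orthogonal to every
    test function, hence 0 almost everywhere by [fundamental_lemmaT]. *)
Lemma tf_dense f (e : R) : L2 mu f -> 0 < e ->
  exists2 phi, is_tf phi & nrm2 mu (fun x => f x - phi x) < e.
Proof.
move=> Lf e0.
have sL := L2_is_subspace mu; have iL := ip2_inner mu.
have sD : is_subspace (is_tf : ('rV[R]_n.+1 -> R^o) -> Prop).
  by split; [exact: tf0|move=> a u v tu tv; apply: tfD => //; exact: tfZ].
have [d [Dd cd hd]] := inner_proj sL iL sD (fun phi tp => tf_L2 tp) Lf.
have Ld k : L2 mu (d k) by exact: tf_L2.
have [g Lg dg] := L2_complete Ld cd.
have Lfg : L2 mu (f - g) by exact: L2B.
have fg0 : (fun x => f x - g x) = (fun=> 0) %[ae mu].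
  apply: fundamental_lemmaT => // phi tp.
  apply/eqP; rewrite -normr_le0; apply/ler_addgt0Pr => e1 e10; rewrite add0r.
  have Lp := tf_L2 tp.
  have np := nrm2_ge0 mu phi.
  have e2 : 0 < e1 / 2 / (nrm2 mu phi + 1) by rewrite !divr_gt0// ltr_wpDl.
  have [N1 h1] := dg _ e2.
  have e12 : 0 < e1 / 2 by rewrite divr_gt0.
  have [N2 h2] := hd (phi : 'rV[R]_n.+1 -> R^o) tp _ e12.
  pose k := maxn N1 N2.
  have := h1 k (leq_maxl _ _); have {h2} := h2 k (leq_maxr _ _).
  have -> : \int[mu]_x ((f x - g x) * phi x) = ip2 mu (f - d k) phi + ip2 mu (d k - g) phi.
    rewrite -(innerDl iL)//; [|exact: L2B|exact: L2B].
    by apply: eq_Rintegral => x _; rewrite !fctE subrKA.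
  have CS : `|ip2 mu (d k - g) phi| <= nrm2 mu (d k - g) * nrm2 mu phi.
    by apply: ip2_CS => //; exact: L2B.
  have := ler_normD (ip2 mu (f - d k) phi) (ip2 mu (d k - g) phi).
  have n0 := nrm2_ge0 mu (d k - g).
  move=> t1 t2; rewrite ltr_pdivlMr ?ltr_wpDl// => t3.
  have : nrm2 mu (d k - g) * nrm2 mu phi <= nrm2 mu (d k - g) * (nrm2 mu phi + 1).
    by rewrite ler_wpM2l// lerDl.
  by move: t1 t2 CS t3; lra.
have [N hN] := dg _ e0; exists (d N) => //.
have := hN N (leqnn _); rewrite (seminormBC sL (nrm2_seminorm mu))//.
suff -> : nrm2 mu (fun x => f x - d N x) = nrm2 mu (g - d N) by [].
apply: nrm2_ae; [exact: L2_mfun (L2B Lf (Ld N))|exact: L2_mfun (L2B Lg (Ld N))|].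
by apply: filterS fg0 => x /(_ I)/eqP; rewrite subr_eq0 => /eqP fgx _; rewrite !fctE fgx.
Qed.

(** Translations are isometries of L^2, so density reduces the claim to a test function, where
    [tf_translate_bound] gives a Lipschitz estimate. *)
Lemma translate_continuous f (e : R) : L2 mu f -> 0 < e ->
  exists2 d : R, 0 < d & forall v, `|v| <= d -> nrm2 mu (fun x => f (x + v) - f x) < e.
Proof.
move=> Lf e0; have e3 : 0 < e / 3 by rewrite divr_gt0.
have [phi tp hp] := tf_dense Lf e3.
have Lp := tf_L2 tp.
pose S := \sum_i nrm2 mu (partial i phi).
have S0 : 0 <= S by apply: sumr_ge0 => i _; exact: nrm2_ge0.
have S1 : 0 < S + 1 by rewrite ltr_wpDl.
exists (e / 3 / (S + 1)) => [|v hv]; first by rewrite divr_gt0.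
have Lfv := leb_translate_L2 v Lf; have Lpv := leb_translate_L2 v Lp.
have -> : (fun x => f (x + v) - f x) =
  (fun x => (f (x + v) - phi (x + v)) + ((phi (x + v) - phi x) - (f x - phi x))).
  by apply/funext => x; ring.
have Lfp := L2B Lf Lp; have Lpp := L2B Lpv Lp.
have t1 := nrm2D (L2B Lfv Lpv) (L2B Lpp Lfp).
have t2 := nrm2B Lpp Lfp.
have t3 : nrm2 mu (fun x => f (x + v) - phi (x + v)) = nrm2 mu (fun x => f x - phi x).
  exact: (leb_translate_nrm2 v Lfp).
have t4 := tf_translate_bound v tp.
have t5 : \sum_i `|v ord0 i| * nrm2 mu (partial i phi) < e / 3.
  apply: (@le_lt_trans _ _ (`|v| * S)).
    by rewrite mulr_sumr; apply: ler_sum => i _; rewrite ler_wpM2r ?nrm2_ge0// rV_coord_le.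
  apply: (@le_lt_trans _ _ (e / 3 / (S + 1) * S)); first by rewrite ler_wpM2r.
  by rewrite mulrAC ltr_pdivrMr// ltr_pM2l// ltrDl.
lra.
Qed.

End fundamental_lemma.

(** * Mollification *)

Lemma littleo_differentiable (R : realType) (V W : normedModType R) (f : V -> W)
  (df : {linear V -> W}) (x : V) : continuous df ->
  (forall e : R, 0 < e -> \forall v \near (0 : V), `|f (v + x) - (f x + df v)| <= e * `|v|) ->
  differentiable f x /\ 'd f x = df :> (V -> W).
Proof.
move=> cdf h.
have key : f \o shift x = cst (f x) + df +o_ (0 : V) id.
  by apply/eqaddoP => e e0; exact: h.
have dE := diff_unique cdf key.
by split=> //; apply/diff_locallyP; rewrite dE.
Qed.

Section mollification.
Context {R : realType} {n : nat}.
Notation mu := (@leb R n.+1).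
Implicit Types (f g u phi K : 'rV[R]_n.+1 -> R) (i : 'I_n.+1) (x v z : 'rV[R]_n.+1).

Definition coord_form (c : 'I_n.+1 -> R) (v : 'rV[R]_n.+1) : R^o := \sum_i v ord0 i * c i.

Lemma coord_form_is_linear c : linear (coord_form c).
Proof.
move=> a u v; rewrite /coord_form scaler_sumr -big_split; apply: eq_bigr => i _.
by rewrite !mxE mulrDl -mulrA.
Qed.
HB.instance Definition _ c := GRing.isLinear.Build R 'rV[R]_n.+1 R^o *:%R
  (coord_form c) (coord_form_is_linear c).

Lemma coord_form_continuous c : continuous (coord_form c).
Proof.
apply: continuous_big => [|i _ v]; first exact: add_continuous.
have h : (fun v : 'rV[R]_n.+1 => v ord0 i) @ v --> v ord0 i := @coord_continuous R 1 n.+1 ord0 i v.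
exact: (cvgM h (cvg_cst (c i))).
Qed.

Lemma taylor_differentiable f x (c : 'I_n.+1 -> R) (C : R) :
  (forall v, `|f (x + v) - f x - \sum_i v ord0 i * c i| <= C * `|v| ^+ 2) ->
  differentiable f x /\ forall i, partial i f x = c i.
Proof.
move=> h.
have [||df dE] := @littleo_differentiable R 'rV[R]_n.+1 R f (coord_form c) x.
- exact: coord_form_continuous.
- move=> e e0; have eC : 0 < e / (`|C| + 1) by rewrite divr_gt0// ltr_wpDl.
  have near_eC := @nbhs0_le R 'rV[R]_n.+1 _ eC.
  near=> v.
  rewrite opprD addrA [v + x]addrC; apply: le_trans (h v) _.
  have vC : `|v| <= e / (`|C| + 1).
    by near: v.
  rewrite expr2 mulrA ler_wpM2r//.
  apply: (@le_trans _ _ ((`|C| + 1) * `|v|)).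
    by rewrite ler_wpM2r// (le_trans (ler_norm C))// lerDl.
  by rewrite mulrC -ler_pdivlMr// ltr_wpDl.
split => // i; rewrite partial_diff// dE /=.
rewrite /coord_form -[delta_mx ord0 i]scale1r.
by rewrite (sum_delta c) mul1r.
Unshelve. all: by end_near. Qed.

(** The kernel is not reflected: this is the average of u (x + z) with weight K z, so a kernel
    concentrated near c samples u near x + c. Differentiation in x therefore puts a minus sign on
    the derivative of K. *)
Definition moll K u x : R := \int[mu]_y (u y * K (y - x)).

Lemma bounded_mul_itg u f (C : R) : itg mu u -> measurable_fun setT f ->
  (forall x, `|f x| <= C) -> itg mu (fun x => u x * f x).
Proof.
move=> iu mf fC; apply: (itg_le _ (itgZ C (itg_norm iu))) => [|x].
  by apply: measurable_funM => //; exact: itg_mfun iu.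
by rewrite normrM mulrC ler_wpM2r.
Qed.

Lemma tf_mulr_itg u phi : itg mu u -> is_tf phi -> itg mu (fun x => u x * phi x).
Proof.
move=> iu tp; have [C C0 hC] := tf_bounded tp.
by apply: bounded_mul_itg hC => //; exact: tf_measurable.
Qed.

Lemma moll_itg u K x : itg mu u -> is_tf K -> itg mu (fun y => u y * K (y - x)).
Proof. by move=> iu tK; apply: tf_mulr_itg => //; exact: tf_translate. Qed.

(** Differentiation under the integral: the quadratic Taylor bound for K is uniform, so it survives
    integration against u. *)
Lemma moll_diff u K : itg mu u -> is_tf K ->
  (forall x, differentiable (moll K u) x) /\
  forall i, partial i (moll K u) = moll (fun z => -1 * partial i K z) u.
Proof.
move=> iu tK; have [C C0 hC] := tf_taylor tK.
have tdK i : is_tf (fun z => -1 * partial i K z) by apply: tfZ; exact: tf_partial.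
suff key x : differentiable (moll K u) x /\ forall i, partial i (moll K u) x =
    moll (fun z => -1 * partial i K z) u x.
  by split=> [x|i]; [case: (key x)|apply/funext => x; case: (key x)].
apply: (@taylor_differentiable _ _ _ (C * \int[mu]_y `|u y|)) => v.
have iK w := moll_itg w iu tK; have idK i w := moll_itg w iu (tdK i).
have -> : moll K u (x + v) - moll K u x -
      \sum_i v ord0 i * moll (fun z => -1 * partial i K z) u x =
    \int[mu]_y (u y * (K ((y - x) - v) - K (y - x) - \sum_i (- v) ord0 i * partial i K (y - x))).
  transitivity (\int[mu]_y (u y * K (y - (x + v)) - u y * K (y - x) -
      \sum_i v ord0 i * (u y * (-1 * partial i K (y - x))))).
    rewrite RintegralB//; last 2 first.
      by apply: itgB; exact: iK.
      by apply: itg_sum => i _; apply: itgZ; exact: idK.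
    have -> : \int[mu]_y (\sum_i v ord0 i * (u y * (-1 * partial i K (y - x)))) =
        \sum_i \int[mu]_y (v ord0 i * (u y * (-1 * partial i K (y - x)))).
      by apply: Rintegral_sum => i _; apply: itgZ; exact: idK.
    rewrite RintegralB//; [|exact: iK|exact: iK].
    congr (_ - _); apply: eq_bigr => i _.
    by rewrite RintegralZl//; exact: idK.
  apply: eq_Rintegral => y _; rewrite opprD addrA !mulrBr; congr (_ - _).
  rewrite mulr_sumr; apply: eq_bigr => i _; rewrite !mxE; ring.
have bnd y : `|u y * (K ((y - x) - v) - K (y - x) - \sum_i (- v) ord0 i * partial i K (y - x))| <=
    C * `|v| ^+ 2 * `|u y|.
  by rewrite normrM mulrC ler_wpM2r// -(normrN v); exact: hC.
have ibnd : itg mu (fun y => C * `|v| ^+ 2 * `|u y|) by apply: itgZ; exact: itg_norm.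
have mE : measurable_fun setT (fun y => u y * (K ((y - x) - v) - K (y - x) -
    \sum_i (- v) ord0 i * partial i K (y - x))).
  apply: measurable_funM; first exact: itg_mfun iu.
  apply: measurable_funB; last first.
    apply: measurable_sum => i; apply: measurable_funM => //.
    by apply: tf_measurable; apply: tf_translate; exact: tf_partial.
  apply: measurable_funB; last by apply: tf_measurable; exact: tf_translate.
  by apply: tf_measurable; apply: (tf_translate (phi := fun y => K (y - v))); exact: tf_translate.
have iE := itg_le mE ibnd bnd.
apply: le_trans (le_normr_Rintegral _ _) _ => //.
apply: (@le_trans _ _ (\int[mu]_y (C * `|v| ^+ 2 * `|u y|))).
  by apply: le_Rintegral => //; exact: itg_norm.
rewrite RintegralZl; [|by []|exact: itg_norm].
by move: (\int[_]_y _) => I; rewrite (_ : C * `|v| ^+ 2 * I = C * I * `|v| ^+ 2)//; ring.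
Qed.

Lemma moll_smooth u K : itg mu u -> is_tf K -> smooth (moll K u).
Proof.
move=> iu tK; apply: (@smooth_coind _ _ (fun f => exists2 K, is_tf K & f = moll K u)); last by exists K.
move=> _ [{tK}K tK ->]; have [df pf] := moll_diff iu tK; split=> // i.
by exists (fun z => -1 * partial i K z); [apply: tfZ; exact: tf_partial|rewrite pf].
Qed.

Lemma moll_translate u K x : itg mu u -> is_tf K ->
  moll K u x = \int[mu]_z (u (x + z) * K z).
Proof.
move=> iu tK; rewrite /moll -(leb_translate_Rintegral x (moll_itg x iu tK)).
by apply: eq_Rintegral => z _; rewrite addrK addrC.
Qed.

Lemma moll_supp u K x : moll K u x != 0 -> exists z, K z != 0 /\ u (x + z) != 0.
Proof.
apply: contraNP => /forallNP h; apply/eqP; rewrite /moll -[RHS](@Rintegral0 _ _ _ mu).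
apply: eq_Rintegral => y _; have [->|uy] := eqVneq (u y) 0; first by rewrite mul0r.
have [->|Ky] := eqVneq (K (y - x)) 0; first by rewrite mulr0.
by exfalso; apply: (h (y - x)); split => //; rewrite addrCA subrr addr0.
Qed.

(* Jensen's inequality for the probability density K. *)
Lemma density_jensen K f : is_tf K -> (forall z, 0 <= K z) -> \int[mu]_z K z = 1 -> L2 mu f ->
  (\int[mu]_z (f z * K z)) ^+ 2 <= \int[mu]_z (f z ^+ 2 * K z).
Proof.
move=> tK K0 K1 Lf; set m := \int[mu]_z (f z * K z).
have i1 : itg mu (fun z => f z * K z) by exact: tf_mul_itg.
have i2 : itg mu (fun z => f z ^+ 2 * K z) by apply: tf_mulr_itg => //; case: Lf.
have i0 := tf_itg tK.
have : 0 <= \int[mu]_z ((f z - m) ^+ 2 * K z).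
  by apply: Rintegral_ge0 => z _; rewrite mulr_ge0// sqr_ge0.
have -> : \int[mu]_z ((f z - m) ^+ 2 * K z) =
    \int[mu]_z (f z ^+ 2 * K z - 2 * m * (f z * K z) + m ^+ 2 * K z).
  by apply: eq_Rintegral => z _; ring.
have i3 := itgZ (2 * m) i1; have i4 := itgZ (m ^+ 2) i0.
rewrite RintegralD//; last exact: itgB.
rewrite RintegralB// !RintegralZl// K1 -/m; nra.
Qed.

(** Jensen in z at each x, followed by Tonelli, bounds the squared error by the average, with weight
    K z, of the squared translation errors of u. *)
Lemma moll_nrm2 u K (e : R) : L2 mu u -> itg mu u -> is_tf K -> (forall z, 0 <= K z) ->
  \int[mu]_z K z = 1 -> 0 <= e ->
  (forall z, K z != 0 -> nrm2 mu (fun x => u (x + z) - u x) <= e) ->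
  L2 mu (moll K u) /\ nrm2 mu (fun x => moll K u x - u x) <= e.
Proof.
move=> Lu iu tK K0 K1 e0 he.
have mu_ : measurable_fun setT u by exact: L2_mfun Lu.
have mK := tf_measurable tK.
pose F (p : 'rV[R]_n.+1 * 'rV[R]_n.+1) : \bar R := ((u (p.1 + p.2) - u p.1) ^+ 2 * K p.2)%:E.
have mF : measurable_fun setT F.
  apply/measurable_EFinP/measurable_funM; last exact: (measurableT_comp mK measurable_snd).
  apply: measurable_funX; apply: measurable_funB.
    exact: (measurableT_comp mu_ (measurable_rVD (n := n.+1))).
  exact: (measurableT_comp mu_ measurable_fst).
have F0 p : (0 <= F p)%E by rewrite lee_fin mulr_ge0// sqr_ge0.
pose E x := moll K u x - u x.
have Ld z : L2 mu (fun x => u (x + z) - u x) by apply: L2B => //; exact: leb_translate_L2.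
have Lx x : L2 mu (fun z => u (x + z)).
  by under eq_fun do rewrite addrC; exact: leb_translate_L2.
have bd x : itg mu (fun z => (u (x + z) - u x) ^+ 2 * K z).
  have -> : (fun z => (u (x + z) - u x) ^+ 2 * K z) =
      (fun z => u (x + z) ^+ 2 * K z - 2 * u x * (u (x + z) * K z) + u x ^+ 2 * K z).
    by apply/funext => z; ring.
  apply: itgD; last by apply: itgZ; exact: tf_itg.
  apply: itgB; last by apply: itgZ; exact: tf_mul_itg.
  by apply: tf_mulr_itg => //; case: (Lx x).
have E2 x : E x ^+ 2 <= \int[mu]_z ((u (x + z) - u x) ^+ 2 * K z).
  have := density_jensen tK K0 K1 (Lx x); rewrite -moll_translate// => J.
  have -> : \int[mu]_z ((u (x + z) - u x) ^+ 2 * K z) =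
      \int[mu]_z (u (x + z) ^+ 2 * K z - 2 * u x * (u (x + z) * K z) + u x ^+ 2 * K z).
    by apply: eq_Rintegral => z _; ring.
  have i1 : itg mu (fun z => u (x + z) * K z) by exact: tf_mul_itg.
  have i2 : itg mu (fun z => u (x + z) ^+ 2 * K z) by apply: tf_mulr_itg => //; case: (Lx x).
  have i3 := itgZ (2 * u x) i1; have i4 := itgZ (u x ^+ 2) (tf_itg tK).
  rewrite RintegralD//; last exact: itgB.
  rewrite RintegralB// !RintegralZl//; last exact: tf_itg.
  by rewrite K1 -moll_translate// /E; move: J; move: (\int[_]_z _) => J; nra.
have sK := smooth_continuous (moll_smooth iu tK).
have mM : measurable_fun setT (moll K u) by exact: rV_continuous_measurable.
have mE : measurable_fun setT E by apply: measurable_funB.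
have key : (\int[mu]_x (E x ^+ 2)%:E <= (e ^+ 2)%:E)%E.
  apply: (@le_trans _ _ (\int[mu]_x \int[mu]_z F (x, z))%E).
    apply: ge0_le_integral => //.
    - by move=> x _; rewrite lee_fin sqr_ge0.
    - by apply/measurable_EFinP; exact: measurable_funX.
    - exact: (@measurable_fun_fubini_tonelli_F _ _ _ _ R mu F).
    - by move=> x _; rewrite /F/= -EFin_Rintegral// lee_fin.
  rewrite (fubini_tonelli F mF F0).
  apply: (@le_trans _ _ (\int[mu]_z (e ^+ 2 * K z)%:E)%E).
    apply: ge0_le_integral => //.
    - by move=> z _; apply: integral_ge0.
    - exact: (@measurable_fun_fubini_tonelli_G _ _ _ _ R mu F).
    - by apply/measurable_EFinP; apply: measurable_funM.
    move=> z _; have [Kz|Kz] := eqVneq (K z) 0.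
      rewrite Kz mulr0 (_ : (\int[mu]_x F (x, z))%E = 0%E)//.
      by rewrite -[RHS](integral0 mu setT); apply: eq_integral => x _; rewrite /F/= Kz mulr0.
    have -> : (\int[mu]_x F (x, z) = (\int[mu]_x (K z * (u (x + z) - u x) ^+ 2))%:E)%E.
      rewrite EFin_Rintegral; last by apply: itgZ; case: (Ld z).
      by apply: eq_integral => x _; rewrite /F/= mulrC.
    rewrite lee_fin RintegralZl//; last by case: (Ld z).
    by rewrite -nrm2_sqr mulrC ler_wpM2r// lerXn2r ?nnegrE ?nrm2_ge0// he.
  rewrite -EFin_Rintegral; last by apply: itgZ; exact: tf_itg.
  by rewrite RintegralZl ?K1 ?mulr1//; exact: tf_itg.
have LE : L2 mu E.
  split => //; apply/integrableP; split; first exact/measurable_EFinP/measurable_funX.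
  apply: le_lt_trans (ltry (e ^+ 2)); apply: le_trans key.
  by rewrite le_eqVlt; apply/orP; left; apply/eqP/eq_integral => x _ /=; rewrite ger0_norm ?sqr_ge0.
split.
  have -> : moll K u = (fun x => E x + u x) by apply/funext => x; rewrite /E subrK.
  exact: L2D.
rewrite -(ler_pXn2r (ltn0Sn 1)) ?nnegrE ?nrm2_ge0// nrm2_sqr.
by rewrite -lee_fin EFin_Rintegral//; case: LE.
Qed.

Lemma moll_kernel (c : 'rV[R]_n.+1) (rho : R) : 0 < rho -> exists K,
  [/\ is_tf K, forall z, 0 <= K z, \int[mu]_z K z = 1 & forall z, K z != 0 -> `|z - c| < rho].
Proof.
move=> r0; have r2 : 0 < rho / 2 by rewrite divr_gt0.
pose a : 'rV[R]_n.+1 := \row_i (c ord0 i - rho / 2).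
pose b : 'rV[R]_n.+1 := \row_i (c ord0 i + rho / 2).
pose P := plateau a b (rho / 2).
have tP : is_tf P by exact: plateau_tf.
pose B := [set x : 'rV[R]_n.+1 | forall i, x ord0 i \in `[a ord0 i, b ord0 i]].
have mB : measurable B.
  exact: (measurable_forall_coord (B := fun i => `[a ord0 i, b ord0 i]%classic)).
have lB : mu B = (rho ^+ n.+1)%:E.
  rewrite leb_box; last by move=> i; rewrite !mxE; lra.
  congr (_%:E); transitivity (\prod_(i < n.+1) rho); last by rewrite prodr_const card_ord.
  by apply: eq_bigr => i _; rewrite !mxE; lra.
(* P dominates the indicator of the cube B of side rho, whose volume is known. *)
have I0 : 0 < \int[mu]_z P z.
  apply: (@lt_le_trans _ _ (\int[mu]_z (\1_B z))).
    have -> : \int[mu]_z (\1_B z) = rho ^+ n.+1.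
      by rewrite /Rintegral integral_indic// setIT; exact: (congr1 fine lB).
    exact: exprn_gt0.
  apply: le_Rintegral => //.
  - by apply: itg_indic => //; apply: le_lt_trans (ltry (rho ^+ n.+1)); rewrite le_eqVlt; apply/orP; left; apply/eqP; exact: lB.
  - exact: tf_itg.
  - move=> z _; have [Bz|Bz] := pselect (B z).
      have -> : P z = 1 by apply: plateau_eq1 => // i; have := Bz i; rewrite in_itv.
      by rewrite indicE; case: (_ \in _).
    by rewrite indicE memNset// plateau_ge0.
exists (fun z => (\int[mu]_z P z)^-1 * P z); split.
- exact: tfZ.
- by move=> z; rewrite mulr_ge0 ?plateau_ge0// invr_ge0 ltW.
- by rewrite RintegralZl ?mulVf ?gt_eqF//; exact: tf_itg.
- move=> z; rewrite mulf_eq0 negb_or => /andP[_] /(plateau_neq0 r2) h.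
  apply: rV_norm_lt => // i; have := h i; rewrite !mxE ltr_norml.
  by move=> /andP[h1 h2]; apply/andP; split; lra.
Qed.

End mollification.

(** * The Poincare inequality *)

Section poincare.
Context {R : realType} {n : nat}.
Notation mu := (@leb R n.+1).
Implicit Types (f g u phi : 'rV[R]_n.+1 -> R) (i j : 'I_n.+1) (x v z : 'rV[R]_n.+1).

(** The symmetry of second derivatives enters as an exact commutation: the difference quotient in
    direction i commutes with the derivative in direction j. After integrations by parts the two
    sides differ by O(h). *)
Lemma tf_mixed f g i j : is_tf f -> is_tf g ->
  \int[mu]_x (partial i f x * partial j g x) = \int[mu]_x (partial j f x * partial i g x).
Proof.
move=> tf_ tg.
have tdf k : is_tf (partial k f) by exact: tf_partial.
have tdg k : is_tf (partial k g) by exact: tf_partial.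
have sf := tf_smooth tf_; have sg := tf_smooth tg.
pose Dq (h : R) (psi : 'rV[R]_n.+1 -> R) x := h^-1 * (psi (x + h *: delta_mx ord0 i) - psi x).
have DqT psi : is_tf psi -> exists2 C : R, 0 <= C & forall h : R, 0 < h -> forall x,
    `|Dq h psi x - partial i psi x| <= C * h.
  move=> tpsi; have [C C0 hC] := tf_taylor tpsi; exists C => // h h0 x.
  have := hC x (h *: delta_mx ord0 i); rewrite sum_delta => le1.
  rewrite -(ler_pM2l h0) -{1}(gtr0_norm h0) -normrM.
  have -> : h * (Dq h psi x - partial i psi x) =
      psi (x + h *: delta_mx ord0 i) - psi x - h * partial i psi x.
    by rewrite /Dq; field; rewrite gt_eqF.
  apply: le_trans le1 _.
  have -> : h * (C * h) = C * h ^+ 2 by ring.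
  apply: ler_wpM2l => //; rewrite lerXn2r ?nnegrE ?(ltW h0)//.
  by have := norm_delta_le i h; rewrite (gtr0_norm h0).
have tDq h psi : is_tf psi -> is_tf (Dq h psi).
  move=> tpsi; apply: tfZ; rewrite (_ : (fun _ => _) = fun x => psi (x + h *: delta_mx ord0 i) + -1 * psi x).
    by apply: tfD; [exact: tf_translate|exact: tfZ].
  by apply/funext => x; rewrite mulN1r.
have pDq h : partial j (Dq h g) = Dq h (partial j g).
  rewrite /Dq partialZ; last first.
    by apply: smoothB => //; exact: smooth_translate.
  apply/funext => x; congr (_ * _); rewrite partialB//; last exact: smooth_translate.
  by rewrite partial_translate.
have small f1 psi : is_tf f1 -> is_tf psi -> exists2 C : R, 0 <= C & forall h : R, 0 < h ->
    `|\int[mu]_x (f1 x * Dq h psi x) - \int[mu]_x (f1 x * partial i psi x)| <= C * h.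
  move=> t1 tpsi; have [C C0 hC] := DqT _ tpsi.
  exists (C * \int[mu]_x `|f1 x|) => [|h h0].
    by rewrite mulr_ge0// Rintegral_ge0.
  have i1 : itg mu (fun x => f1 x * Dq h psi x) by apply: tf_mul_itg; [exact: tf_L2|exact: tDq].
  have i2 : itg mu (fun x => f1 x * partial i psi x) by apply: tf_mul_itg; [exact: tf_L2|exact: tf_partial].
  rewrite -RintegralB//; apply: le_trans (le_normr_Rintegral _ (itgB i1 i2)) _ => //.
  have i3 : itg mu (fun x => C * h * `|f1 x|) by apply: itgZ; apply: itg_norm; exact: tf_itg.
  apply: (@le_trans _ _ (\int[mu]_x (C * h * `|f1 x|))).
    apply: le_Rintegral => //; first exact: itg_norm (itgB i1 i2).
    by move=> x _; rewrite -mulrBr normrM mulrC ler_wpM2r// hC.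
  by rewrite RintegralZl//; [rewrite mulrAC|apply: itg_norm; exact: tf_itg].
have [C1 C10 h1] := small _ _ tf_ (tdg j).
have [C2 C20 h2] := small _ _ (tdf j) tg.
have key h : 0 < h -> `|\int[mu]_x (partial i f x * partial j g x) -
    \int[mu]_x (partial j f x * partial i g x)| <= (C1 + C2) * h.
  move=> h0; have := h1 h h0; have := h2 h h0.
  rewrite -pDq (tf_ibp j sf (tDq h _ tg)) (tf_ibp i sf (tdg j)).
  set A := \int[mu]_x _; set B := \int[mu]_x _; set D := \int[mu]_x _.
  rewrite !ler_norml; lra.
apply/eqP; rewrite -subr_eq0 -normr_le0; apply/ler_addgt0Pr => e e0; rewrite add0r.
have C1' : 0 < C1 + C2 + 1 by rewrite ltr_wpDl// addr_ge0.
have eC : 0 < e / (C1 + C2 + 1) by rewrite divr_gt0.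
apply: le_trans (key _ eC) _.
by rewrite mulrA ler_pdivrMr// mulrC ler_wpM2l ?(ltW e0)// lerDl.
Qed.

(** As phi has mean 0 on a cell Q containing x, |Q| phi(x)^2 is at most the integral of (phi y - phi
    x)^2 over Q, hence over all y within delta of x. Tonelli and [tf_translate_bound] conclude. The
    factor 2^(n+1) is the volume of the ball of radius delta for the maximum norm, divided by that
    of Q. *)
Lemma poincare_cells phi (delta : R) : 0 < delta -> is_tf phi ->
  (forall x, phi x != 0 -> exists Q, [/\ measurable Q, Q x,
     forall y, Q y -> `|y - x| <= delta, mu Q = (delta ^+ n.+1)%:E &
     \int[mu]_(y in Q) phi y = 0]) ->
  nrm2 mu phi ^+ 2 <= 2 ^+ n.+1 * (delta * \sum_i nrm2 mu (partial i phi)) ^+ 2.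
Proof.
move=> d0 tp hQ; have Lp := tf_L2 tp; have mp := tf_measurable tp.
set S := \sum_i _.
have S0 : 0 <= S by apply: sumr_ge0 => i _; exact: nrm2_ge0.
have dn0 : 0 < delta ^+ n.+1 by rewrite exprn_gt0.
pose B := nball delta : set 'rV[R]_n.+1.
have mB : measurable B by exact: nball_measurable.
pose F (p : 'rV[R]_n.+1 * 'rV[R]_n.+1) : \bar R := ((phi (p.1 + p.2) - phi p.1) ^+ 2 * \1_B p.2)%:E.
have mF : measurable_fun setT F.
  apply/measurable_EFinP/measurable_funM; last first.
    by apply: (measurableT_comp (f := \1_B : _ -> R)); [exact: measurable_indic|exact: measurable_snd].
  apply: measurable_funX; apply: measurable_funB.
    exact: (measurableT_comp mp (measurable_rVD (n := n.+1))).
  exact: (measurableT_comp mp measurable_fst).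
have F0 p : (0 <= F p)%E by rewrite lee_fin mulr_ge0// sqr_ge0.
have Ld v : L2 mu (fun x => phi (x + v) - phi x) by apply: L2B => //; exact: leb_translate_L2.
have iB : itg mu (\1_B : _ -> R) by apply: itg_indic => //; exact: nball_lty.
have [C C0 hC] := tf_bounded tp.
have iFx x : itg mu (fun z => (phi (x + z) - phi x) ^+ 2 * \1_B z).
  apply: (itg_le _ (itgZ ((2 * C) ^+ 2) iB)) => [|z].
    apply: measurable_funM; last exact: measurable_indic.
    apply: measurable_funX; apply: measurable_funB => //.
    by under eq_fun do rewrite addrC; exact: (measurableT_comp mp (measurable_translate x)).
  rewrite normrM ger0_norm ?sqr_ge0// [`|\1_B z|]ger0_norm// ler_wpM2r//.
  rewrite -(real_normK (num_real (_ - _))) lerXn2r ?nnegrE ?mulr_ge0//.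
  by have := ler_normB (phi (x + z)) (phi x); have := hC x; have := hC (x + z); lra.
have pt x : delta ^+ n.+1 * phi x ^+ 2 <= \int[mu]_z ((phi (x + z) - phi x) ^+ 2 * \1_B z).
  have [->|px] := eqVneq (phi x) 0.
    by rewrite expr0n mulr0; apply: Rintegral_ge0 => z _; rewrite mulr_ge0// sqr_ge0.
  have [Q [mQ Qx Qd muQ Q0]] := hQ x px.
  have iQ : itg mu (\1_Q : _ -> R).
    by apply: itg_indic => //; apply: le_lt_trans (ltry (delta ^+ n.+1)); rewrite le_eqVlt; apply/orP; left; apply/eqP; exact: muQ.
  have IQ : \int[mu]_y (\1_Q y : R) = delta ^+ n.+1.
    by rewrite /Rintegral integral_indic// setIT; exact: (congr1 fine muQ).
  have phiQ : \int[mu]_y (phi y * \1_Q y) = 0.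
    rewrite -[RHS]Q0 [RHS]Rintegral_mkcond; apply: eq_Rintegral => y _.
    by rewrite patchE indicE; case: ifP => _; rewrite ?mulr1 ?mulr0.
  have bQ f : L2 mu f -> itg mu (fun y => f y * \1_Q y).
    move=> Lf; apply: L2_mulr => //; split; first exact: measurable_indic.
    have -> : (fun x => (\1_Q x : R) ^+ 2) = \1_Q; last exact: iQ.
    by apply/funext => y; rewrite indicE; case: (_ \in _); rewrite ?expr1n ?expr0n.
  have i1 := bQ _ Lp.
  have i2 : itg mu (fun y => phi y ^+ 2 * \1_Q y).
    have := bQ _ (tf_L2 (tfM (tf_smooth tp) tp)).
    by under eq_fun do rewrite -expr2.
  have := @leb_translate_Rintegral _ _ (fun z => (phi (x + z) - phi x) ^+ 2 * \1_B z) (- x) (iFx x).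
  move=> <-.
  apply: (@le_trans _ _ (\int[mu]_y (phi y ^+ 2 * \1_Q y - 2 * phi x * (phi y * \1_Q y) + phi x ^+ 2 * \1_Q y))).
    have i3 := itgZ (2 * phi x) i1; have i4 := itgZ (phi x ^+ 2) iQ.
    rewrite RintegralD//; last exact: itgB.
    rewrite RintegralB// !RintegralZl// phiQ IQ mulr0 subr0 mulrC lerDr.
    by apply: Rintegral_ge0 => y _; rewrite mulr_ge0// sqr_ge0.
  apply: le_Rintegral => //.
  - apply: itgD; last exact: itgZ.
    by apply: itgB => //; exact: itgZ.
  - exact: (leb_translate_itg (- x) (iFx x)).
  - move=> y _; rewrite [x + _]addrC subrK.
    have [Qy|Qy] := pselect (Q y).
      rewrite !indicE (mem_set Qy) mem_set ?mulr1; last exact: Qd.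
      by rewrite le_eqVlt; apply/orP; left; apply/eqP; ring.
    by rewrite [\1_Q y]indicE memNset// !mulr0 subrr addr0 mulr_ge0// sqr_ge0.
have V : \int[mu]_z (\1_B z : R) = (2 * delta) ^+ n.+1.
  rewrite /Rintegral integral_indic// setIT.
  have -> : B = cube delta.
    apply/seteqP; split => y /=.
      by move=> /(rV_norm_le _ (ltW d0)) h; apply/mem_cube.
    by move/mem_cube => h; apply/(rV_norm_le _ (ltW d0)).
  have := @leb_cube R n.+1 delta (ltW d0) => /(congr1 fine) /= ->.
  by rewrite mulr_natl.
have key : ((delta ^+ n.+1 * nrm2 mu phi ^+ 2)%:E <= ((delta * S) ^+ 2 * (2 * delta) ^+ n.+1)%:E)%E.
  apply: (@le_trans _ _ (\int[mu]_x \int[mu]_z F (x, z))%E).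
    rewrite nrm2_sqr -RintegralZl//; last by case: Lp.
    rewrite EFin_Rintegral; last by apply: itgZ; case: Lp.
    apply: ge0_le_integral => //.
    - by move=> x _; rewrite lee_fin mulr_ge0 ?sqr_ge0 ?ltW.
    - by apply/measurable_EFinP/measurable_funM => //; exact: measurable_funX.
    - exact: (@measurable_fun_fubini_tonelli_F _ _ _ _ R mu F).
    - by move=> x _; rewrite /F/= -EFin_Rintegral// lee_fin.
  rewrite (fubini_tonelli F mF F0).
  apply: (@le_trans _ _ (\int[mu]_z ((delta * S) ^+ 2 * \1_B z)%:E)%E).
    apply: ge0_le_integral => //.
    - by move=> z _; apply: integral_ge0.
    - exact: (@measurable_fun_fubini_tonelli_G _ _ _ _ R mu F).
    - by apply/measurable_EFinP; apply: measurable_funM => //; exact: measurable_indic.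
    move=> z _; have [Bz|Bz] := pselect (B z); last first.
      rewrite indicE memNset// mulr0 (_ : (\int[mu]_x F (x, z))%E = 0%E)//.
      rewrite -[RHS](integral0 mu setT); apply: eq_integral => x _.
      by rewrite /F/= indicE memNset// mulr0.
    have -> : (\int[mu]_x F (x, z) = (\int[mu]_x ((phi (x + z) - phi x) ^+ 2))%:E)%E.
      rewrite EFin_Rintegral; last by case: (Ld z).
      by apply: eq_integral => x _; rewrite /F/= indicE mem_set ?mulr1.
    rewrite lee_fin -nrm2_sqr indicE mem_set// mulr1.
    rewrite lerXn2r ?nnegrE ?nrm2_ge0 ?mulr_ge0 ?(ltW d0)//.
    apply: le_trans (tf_translate_bound z tp) _; rewrite mulr_sumr; apply: ler_sum => i _.
    by rewrite ler_wpM2r ?nrm2_ge0// (le_trans (rV_coord_le z i)).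
  by rewrite -EFin_Rintegral ?RintegralZl ?V//; exact: itgZ.
move: key; rewrite lee_fin [(2 * delta) ^+ _]exprMn.
rewrite (_ : (delta * S) ^+ 2 * (2 ^+ n.+1 * delta ^+ n.+1) =
  delta ^+ n.+1 * (2 ^+ n.+1 * (delta * S) ^+ 2)); last by ring.
by rewrite ler_pM2l.
Qed.

(** The sets Q are the cubes of a grid that covers the ball of radius r. Their number grows as e
    decreases, which is harmless because only its finiteness is used. *)
Lemma poincare_finite_rank (r e : R) : 0 <= r -> 0 < e ->
  exists (m : nat) (Q : 'I_m -> set 'rV[R]_n.+1), (forall k, measurable (Q k)) /\
  forall phi, is_tf phi -> supp_in r phi -> (forall k, \int[mu]_(y in Q k) phi y = 0) ->
  nrm2 mu phi <= e * \sum_i nrm2 mu (partial i phi).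
Proof.
move=> r0 e0; pose s : R := Num.sqrt (2 ^+ n.+1).
have s0 : 0 < s by rewrite sqrtr_gt0 exprn_gt0.
(* Chosen so that [2 ^+ n.+1 * delta ^+ 2] equals [e ^+ 2], matching the constant of
   [poincare_cells]. *)
pose delta := e / s; have d0 : 0 < delta by rewrite divr_gt0.
(* The shifted coordinates x_i + r range over [0, 2 r] with both ends, so the cell indices run from
   0 to M inclusive. *)
pose M := Num.truncn (2 * r / delta).
pose I : finType := {ffun 'I_n.+1 -> 'I_M.+1}.
pose a (c : I) : 'rV[R]_n.+1 := \row_i ((c i)%:R * delta - r).
pose b (c : I) : 'rV[R]_n.+1 := \row_i ((c i)%:R * delta - r + delta).
pose Q (c : I) := [set x : 'rV[R]_n.+1 | forall i, x ord0 i \in `[a c ord0 i, b c ord0 i]].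
exists #|I|, (fun k => Q (enum_val k)); split=> [k|phi tp sp hQ].
  exact: (measurable_forall_coord (B := fun i => `[a (enum_val k) ord0 i, b (enum_val k) ord0 i]%classic)).
rewrite -(ler_pXn2r (ltn0Sn 1)) ?nnegrE ?nrm2_ge0//; last first.
  by rewrite mulr_ge0 ?(ltW e0)// sumr_ge0// => i _; exact: nrm2_ge0.
have -> : (e * \sum_i nrm2 mu (partial i phi)) ^+ 2 =
    2 ^+ n.+1 * (delta * \sum_i nrm2 mu (partial i phi)) ^+ 2.
  have s2 : s ^+ 2 = 2 ^+ n.+1 by rewrite sqr_sqrtr// exprn_ge0.
  by rewrite -s2 /delta; field; rewrite gt_eqF.
apply: poincare_cells => // x /sp xr.
have xi i : 0 <= (x ord0 i + r) / delta.
  by rewrite divr_ge0 ?(ltW d0)//; have := le_trans (rV_coord_le x i) xr; rewrite ler_norml; lra.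
pose c : I := [ffun i => inord (Num.truncn ((x ord0 i + r) / delta))].
have cE i : (c i = Num.truncn ((x ord0 i + r) / delta) :> nat)%N.
  rewrite ffunE inordK// ltnS; apply: le_truncn; rewrite ler_pM2r ?invr_gt0//.
  by have := le_trans (rV_coord_le x i) xr; rewrite ler_norml; lra.
have ci i : (c i)%:R * delta <= x ord0 i + r < (c i)%:R * delta + delta.
  rewrite cE; have /andP[h1 h2] := truncn_itv (xi i).
  rewrite -ler_pdivlMr// h1/= -[X in _ < _ + X]mul1r -mulrDl natr1.
  by rewrite -ltr_pdivrMr.
exists (Q c); split.
- exact: (measurable_forall_coord (B := fun i => `[a c ord0 i, b c ord0 i]%classic)).
- by move=> i; rewrite !mxE in_itv/=; have := ci i; lra.
- move=> y Qy; apply/rV_norm_le => [|i]; first exact: ltW.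
  by have := Qy i; have := ci i; rewrite !mxE in_itv/= ler_norml; lra.
- rewrite leb_box; last by move=> i; rewrite !mxE; lra.
  congr (_%:E); transitivity (\prod_(i < n.+1) delta); last by rewrite prodr_const card_ord.
  by apply: eq_bigr => i _; rewrite !mxE; lra.
- by have := hQ (enum_rank c); rewrite enum_rankK.
Qed.

End poincare.

(** * Clifford-valued functions *)

Section clifford_inner.
Context {R : comNzRingType} {n : nat}.
Local Notation Cl := (clifford R n).
Implicit Types (a b c : Cl) (A B : {set 'I_n}).

Lemma symd_eq0 A B : (symd A B == finset.set0) = (A == B).
Proof.
apply/eqP/eqP => [h|->]; last exact: symdd.
apply/setP => i; have /setP/(_ i) := h; rewrite !inE.
by case: (i \in A); case: (i \in B).
Qed.

Lemma clmul_coef a b A : (a * b) A =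
  \sum_B \sum_C (-1) ^+ blade_exp B C * a B * b C * (A == symd B C)%:R.
Proof.
rewrite clmulE /clmul sum_ffunE; apply: eq_bigr => B _.
by rewrite sum_ffunE; apply: eq_bigr => C _; rewrite !ffunE.
Qed.

Lemma clSc_mul a b : clSc (a * b) = \sum_A (-1) ^+ blade_exp A A * a A * b A.
Proof.
rewrite /clSc clmul_coef; apply: eq_bigr => A _.
rewrite (bigD1 A)//= symdd eqxx mulr1 big1 ?addr0// => B BA.
by rewrite eq_sym symd_eq0 eq_sym (negPf BA) mulr0.
Qed.

Lemma clSc_mulC a b : clSc (a * b) = clSc (b * a).
Proof. by rewrite !clSc_mul; apply: eq_bigr => A _; rewrite mulrAC. Qed.

Lemma clSc_conj a : clSc (clconj a) = clSc a.
Proof. by rewrite /clSc ffunE cards0 bin_small// mul1r. Qed.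

Lemma clgenN_mul i : - clgen i * clgen i = 1 :> Cl.
Proof.
have -> : - clgen i * clgen i = blade finset.set0 :> Cl.
  rewrite mulNr clmulE clmul_bladeE symdd /blade_exp !big_set1 leqnn expr1.
  by rewrite scaleN1r opprK.
exact: blade0.
Qed.

(** Conjugation reverses the product, so equal generators meet and cancel in pairs. *)
Lemma clconj_blade_mul A : clconj (blade A) * blade A = 1 :> Cl.
Proof.
rewrite bladeE; elim: (enum A) => [|i s IH]; first by rewrite big_nil clconj1 mulr1.
rewrite big_cons clconjM clconj_gen -mulrA (mulrA (- _)) clgenN_mul mul1r.
exact: IH.
Qed.

(** Read off from the scalar part of conj(e_A) e_A = 1 instead of counting transpositions. *)
Lemma blade_sign A : (-1) ^+ blade_exp A A * (-1) ^+ 'C(#|A|.+1, 2) = 1 :> R.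
Proof.
have /(congr1 (@clSc R n)) := clconj_blade_mul A.
rewrite clSc_mul (bigD1 A)//= big1 => [|B BA]; last by rewrite !ffunE (negPf BA) !mulr0.
by rewrite !ffunE eqxx /clSc -[in RHS]blade0 ffunE eqxx !mulr1 addr0.
Qed.

Lemma clSc_conj_mul a b : clSc (clconj a * b) = \sum_A a A * b A.
Proof.
rewrite clSc_mul; apply: eq_bigr => A _.
by rewrite ffunE !mulrA blade_sign mul1r.
Qed.

Lemma clconjK : involutive (@clconj R n).
Proof.
by move=> a; apply/ffunP => A; rewrite !ffunE mulrA -expr2 sqrr_sign mul1r.
Qed.

Lemma clSc_gen_swap i j a b : i != j ->
  clSc (clconj (clgen i * a) * (clgen j * b)) = - clSc (clconj (clgen j * a) * (clgen i * b)).
Proof.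
move=> ij; rewrite !clconjM !clconj_gen -!mulrA !(mulrA (- clgen _)) !mulNr.
have /eqP := clgen_anticomm (R := R) i j; rewrite (negPf ij) mul0rn oppr0 addr_eq0 => /eqP ->.
by rewrite mulNr !mulrN opprK /clSc !ffunE opprK.
Qed.

Lemma clSc_gen_same i a b :
  clSc (clconj (clgen i * a) * (clgen i * b)) = clSc (clconj a * b).
Proof. by rewrite clconjM clconj_gen -mulrA (mulrA (- _)) clgenN_mul mul1r. Qed.

Lemma clgen_expand i c : clgen i * c = \sum_A c A *: (clgen i * blade A).
Proof.
by rewrite [in LHS](clifford_blade c) mulr_sumr; apply: eq_bigr => A _; rewrite -scalerAr.
Qed.

Lemma clSc_blade A b : clSc (clconj (blade A) * b) = b A.
Proof.
rewrite clSc_conj_mul (bigD1 A)//= big1 => [|B BA]; last by rewrite ffunE (negPf BA) mul0r.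
by rewrite ffunE eqxx mul1r addr0.
Qed.

Lemma clSc_adjoint_gen i a c : clSc (clconj a * (clgen i * c)) = - clSc (clconj c * (clgen i * a)).
Proof.
rewrite -[LHS]clSc_conj !clconjM clconjK clconj_gen mulrN mulNr -mulrA.
by rewrite /clSc !ffunE.
Qed.

(** The map taking c to conj(c) b is only real-linear; its transpose for the real scalar product
    takes a to b conj(a). This is how M^alpha C becomes alpha conj(w) in the Vekua equation. *)
Lemma clSc_adjoint_alpha a b c : clSc (clconj a * (clconj c * b)) = clSc (clconj c * (b * clconj a)).
Proof. by rewrite clSc_mulC mulrA. Qed.

Lemma clSc_adjoint_beta a b c : clSc (clconj a * (clconj b * c)) = clSc (clconj c * (b * a)).
Proof. by rewrite -[LHS]clSc_conj !clconjM !clconjK mulrA. Qed.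

End clifford_inner.

Lemma clmul_bound {R : realType} {n : nat} (a b : clifford R n) (A : {set 'I_n}) :
  `|(a * b) A| <= \sum_B \sum_C `|a B| * `|b C|.
Proof.
rewrite clmul_coef; apply: le_trans (ler_norm_sum _ _ _) _; apply: ler_sum => B _.
apply: le_trans (ler_norm_sum _ _ _) _; apply: ler_sum => C _.
rewrite !normrM normrX normrN1 expr1n mul1r.
by case: (_ == _); rewrite ?normr1 ?mulr1// normr0 mulr0 mulr_ge0.
Qed.

Lemma clconj_norm {R : realType} {n : nat} (a : clifford R n) (A : {set 'I_n}) :
  `|clconj a A| = `|a A|.
Proof. by rewrite ffunE normrM normrX normrN1 expr1n mul1r. Qed.

Section clifford_L2.
Context {R : realType} {n : nat}.
Notation mu := (@leb R n.+1).
Local Notation Cl := (clifford R n.+1).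
Implicit Types (u v w : 'rV[R]_n.+1 -> Cl) (A : {set 'I_n.+1}).

Definition L2c w := forall A, L2 mu (coef A w).

Definition ipc u v : R := \sum_A ip2 mu (coef A u) (coef A v).

Lemma L2c_subspace : is_subspace L2c.
Proof.
split=> [A|a u v Lu Lv A].
  by rewrite (_ : coef A 0 = fun=> 0); [exact: L20|apply/funext => x; rewrite /coef ffunE].
have := subspace_lin (L2_is_subspace mu) a (Lu A) (Lv A).
by rewrite (_ : a *: coef A u + coef A v = coef A (a *: u + v))//; apply/funext => x; rewrite /coef !fctE !ffunE.
Qed.

Lemma ipc_inner : semi_inner L2c ipc.
Proof.
split.
- by move=> u v Lu Lv; apply: eq_bigr => A _; exact: (inner_sym (ip2_inner mu)).
- move=> a u v w Lu Lv Lw; rewrite /ipc mulr_sumr -big_split; apply: eq_bigr => A _ /=.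
  rewrite -(inner_lin (ip2_inner mu) a (Lu A) (Lv A) (Lw A)); congr ip2.
  by apply/funext => x; rewrite /coef !fctE !ffunE.
- by move=> u Lu; apply: sumr_ge0 => A _; exact: (inner_ge0 (ip2_inner mu)).
Qed.

Definition nrmc w : R := nrm ipc w.

Lemma nrmc_seminorm : seminorm_on L2c nrmc.
Proof. exact: nrm_seminorm L2c_subspace ipc_inner. Qed.

Lemma nrmc_sqr w : nrmc w ^+ 2 = \sum_A nrm2 mu (coef A w) ^+ 2.
Proof.
rewrite /nrmc /nrm sqr_sqrtr; last first.
  by apply: sumr_ge0 => A _; apply: Rintegral_ge0 => x _; rewrite -expr2 sqr_ge0.
apply: eq_bigr => A _; rewrite nrm2_sqr; apply: eq_Rintegral => x _; exact: esym (expr2 _).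
Qed.

Lemma nrmc_sqrE w : L2c w -> nrmc w ^+ 2 = ipc w w.
Proof. by move=> Lw; rewrite (nrm_sqr ipc_inner). Qed.

Lemma nrmc_ge0 w : 0 <= nrmc w. Proof. exact: nrm_ge0. Qed.

Lemma nrm2_le_nrmc w A : nrm2 mu (coef A w) <= nrmc w.
Proof.
rewrite -(ler_pXn2r (ltn0Sn 1)) ?nnegrE ?nrm2_ge0 ?nrmc_ge0// nrmc_sqr.
by rewrite (bigD1 A)//= lerDl sumr_ge0// => B _; rewrite sqr_ge0.
Qed.

Lemma sqr_sum_le (I : finType) (F : I -> R) : (forall i, 0 <= F i) ->
  \sum_i F i ^+ 2 <= (\sum_i F i) ^+ 2.
Proof.
move=> F0; rewrite [leRHS]expr2 mulr_suml; apply: ler_sum => i _.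
rewrite expr2 ler_wpM2l// (bigD1 i)//= lerDl; exact: sumr_ge0.
Qed.

Lemma nrmc_le_sum w : nrmc w <= \sum_A nrm2 mu (coef A w).
Proof.
rewrite -(ler_pXn2r (ltn0Sn 1)) ?nnegrE ?nrmc_ge0 ?sumr_ge0// => [|A _]; last exact: nrm2_ge0.
by rewrite nrmc_sqr; apply: sqr_sum_le => A; exact: nrm2_ge0.
Qed.

(** The Dirac operator with classical derivatives, as opposed to [Dirac], which uses [wpartial]. *)
Definition Dc (phi : 'rV[R]_n.+1 -> Cl) : 'rV[R]_n.+1 -> Cl := fun x =>
  \sum_(i < n.+1) clgen i * [ffun A => partial i (coef A phi) x].

Lemma ipcE u v : L2c u -> L2c v -> ipc u v = \int[mu]_x clSc (clconj (u x) * v x).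
Proof.
move=> Lu Lv; rewrite /ipc /ip2 -Rintegral_sum; last by move=> A _; exact: L2_mulr.
by apply: eq_Rintegral => x _; rewrite clSc_conj_mul.
Qed.

Lemma L2c_mull a w : L2c w -> L2c (fun x => a * w x).
Proof.
move=> Lw A; rewrite (_ : coef A _ = fun x => \sum_B \sum_C
    ((-1) ^+ blade_exp B C * a B * (A == symd B C)%:R) * coef C w x).
  by apply: L2_sum => B _; apply: L2_sum => C _; exact: L2Z.
by apply/funext => x; rewrite /coef clmul_coef; do 2 (apply: eq_bigr => ? _); rewrite mulrAC.
Qed.

Lemma L2c_sum (I : Type) (s : seq I) (F : I -> 'rV[R]_n.+1 -> Cl) :
  (forall i, L2c (F i)) -> L2c (fun x => \sum_(i <- s) F i x).
Proof.
move=> LF A; rewrite (_ : coef A _ = fun x => \sum_(i <- s) coef A (F i) x).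
  by apply: L2_sum => i _; exact: LF.
by apply/funext => x; rewrite /coef sum_ffunE.
Qed.

Variable phi : 'rV[R]_n.+1 -> Cl.
Hypothesis tphi : forall A, is_tf (coef A phi).

Let dphi (i : 'I_n.+1) x : Cl := [ffun A => partial i (coef A phi) x].

Let dphiE i A : coef A (dphi i) = partial i (coef A phi).
Proof. by apply/funext => x; rewrite /coef ffunE. Qed.

Let Ldphi i : L2c (dphi i).
Proof. by move=> A; rewrite dphiE; apply: tf_L2; exact: tf_partial. Qed.

Lemma Dc_L2c : L2c (Dc phi).
Proof. by apply: L2c_sum => i; apply: L2c_mull; exact: Ldphi. Qed.

(* The mixed terms are antisymmetric in (i, j): the Clifford signs are, while
   the integrals of d_i f d_j g are symmetric. *)
Lemma nrmc_Dc : nrmc (Dc phi) ^+ 2 = \sum_i \sum_A nrm2 mu (partial i (coef A phi)) ^+ 2.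
Proof.
pose M i j A B : R := clSc (clconj (clgen i * blade A) * (clgen j * blade B)).
pose T i j := ipc (fun x => clgen i * dphi i x) (fun x => clgen j * dphi j x).
have Lg i : L2c (fun x => clgen i * dphi i x) by apply: L2c_mull; exact: Ldphi.
have TE i j : T i j = \sum_A \sum_B M i j A B * \int[mu]_x (partial i (coef A phi) x * partial j (coef B phi) x).
  have tp k A : is_tf (partial k (coef A phi)) by exact: tf_partial.
  have iAB A B : itg mu (fun x => partial i (coef A phi) x * partial j (coef B phi) x).
    by apply: tf_mul_itg; [exact: tf_L2|].
  rewrite /T ipcE//.
  transitivity (\int[mu]_x \sum_A \sum_B M i j A B * (partial i (coef A phi) x * partial j (coef B phi) x)).
    apply: eq_Rintegral => x _.
    rewrite (clgen_expand i) (clgen_expand j) linear_sum mulr_suml /clSc sum_ffunE.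
    apply: eq_bigr => A _; rewrite mulr_sumr sum_ffunE; apply: eq_bigr => B _.
    rewrite linearZ/= -scalerAl -scalerAr !ffunE /M /clSc /GRing.scale/=; ring.
  rewrite Rintegral_sum; last first.
    by move=> A _; apply: itg_sum => B _; exact: itgZ.
  apply: eq_bigr => A _; rewrite Rintegral_sum; last by move=> B _; exact: itgZ.
  by apply: eq_bigr => B _; rewrite RintegralZl//; exact: iAB.
have Tanti i j : i != j -> T i j = - T j i.
  move=> ij; rewrite !TE -sumrN; apply: eq_bigr => A _.
  rewrite -sumrN; apply: eq_bigr => B _.
  by rewrite (tf_mixed i j (tphi A) (tphi B)) /M clSc_gen_swap// mulNr.
have Tii i : T i i = \sum_A nrm2 mu (partial i (coef A phi)) ^+ 2.
  transitivity (nrmc (dphi i) ^+ 2).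
    rewrite nrmc_sqrE//; apply: etrans (ipcE (Lg i) (Lg i)) (etrans _ (esym (ipcE (Ldphi i) (Ldphi i)))).
    by apply: eq_Rintegral => x _; exact: clSc_gen_same.
  by rewrite nrmc_sqr; apply: eq_bigr => A _; rewrite dphiE.
have -> : nrmc (Dc phi) ^+ 2 = \sum_i \sum_j T i j.
  rewrite nrmc_sqrE; last exact: Dc_L2c.
  rewrite ipcE; [|exact: Dc_L2c|exact: Dc_L2c].
  transitivity (\int[mu]_x \sum_i \sum_j clSc (clconj (clgen i * dphi i x) * (clgen j * dphi j x))).
    apply: eq_Rintegral => x _; rewrite /Dc linear_sum mulr_suml /clSc sum_ffunE.
    by apply: eq_bigr => i _; rewrite mulr_sumr sum_ffunE.
  have ig i j : itg mu (fun x => clSc (clconj (clgen i * dphi i x) * (clgen j * dphi j x))).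
    rewrite (_ : (fun _ => _) = fun x => \sum_A coef A (fun x => clgen i * dphi i x) x * coef A (fun x => clgen j * dphi j x) x).
      by apply: itg_sum => A _; apply: L2_mulr; exact: Lg.
    by apply/funext => x; rewrite clSc_conj_mul.
  rewrite Rintegral_sum; last by move=> i _; exact: itg_sum.
  apply: eq_bigr => i _; rewrite Rintegral_sum//; apply: eq_bigr => j _.
  by rewrite /T ipcE.
under eq_bigr => i _ do rewrite (bigD1 i)//=.
rewrite big_split/= [X in _ + X](_ : _ = 0) ?addr0; first by apply: eq_bigr => i _; exact: Tii.
set S := \sum_i _.
(* The off-diagonal sum changes sign when i and j are exchanged. *)
suff : S = - S by lra.
rewrite {1}/S (exchange_big_dep xpredT)//= -sumrN; apply: eq_bigr => j _.
by rewrite -sumrN; apply: eq_big => [i|i ij]; [rewrite eq_sym|rewrite Tanti// eq_sym].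
Qed.

End clifford_L2.

(** * Lipschitz charts *)

Section scaled_integral.
Context d (T : measurableType d) {R : realType} (mu : {measure set T -> \bar R}).

Lemma scaled_ge0_integral (phi : T -> T) (c : R) (f : T -> \bar R) :
  measurable_fun setT phi -> 0 <= c ->
  (forall A, measurable A -> mu (phi @^-1` A) = (c%:E * mu A)%E) ->
  measurable_fun setT f -> (forall x, 0 <= f x)%E ->
  (\int[mu]_x f (phi x) = c%:E * \int[mu]_x f x)%E.
Proof.
move=> mphi c0 phimu mf f0.
have := @ge0_integral_pushforward _ _ _ _ R phi mphi mu setT f measurableT mf (fun x _ => f0 x).
rewrite preimage_setT => <-.
have := @ge0_integral_mscale _ T R mu setT measurableT (NngNum c0) f mf (fun x _ => f0 x).
move=> <-; apply: eq_measure_integral => A mA _; exact: phimu.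
Qed.

End scaled_integral.

Lemma itg_ind d (T : measurableType d) (R : realType) (mu : {measure set T -> \bar R})
  (A : set T) (f : T -> R) : measurable A -> itg mu f -> itg mu (fun x => \1_A x * f x).
Proof.
move=> mA fi; apply: itg_le (itg_norm fi) _ => [|x].
  by apply: measurable_funM; [exact: measurable_indic|exact: itg_mfun fi].
by rewrite normrM ler_piMl// indicE; case: (_ \in _); rewrite ?normr1 ?normr0.
Qed.

Lemma le_addgt0_scale (R : realType) (a b c e : R) : 0 <= c -> 0 < e ->
  (forall h, 0 < h -> h <= e -> a <= b + c * h) -> a <= b.
Proof.
move=> c0 e0 H; apply/ler_addgt0Pr => d d0.
have c1 : 0 < c + 1 by rewrite ltr_wpDl.
have h0 : 0 < minr e (d / (c + 1)) by rewrite lt_min e0 divr_gt0.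
apply: le_trans (H _ h0 _) _; first by rewrite ge_min lexx.
rewrite lerD2l; have : minr e (d / (c + 1)) <= d / (c + 1) by rewrite ge_min lexx orbT.
by rewrite ler_pdivlMr//; nra.
Qed.

Section chart_geometry.
Context {R : realType} {n : nat}.
Notation mu := (@leb R n.+1).
Variables (Om : set 'rV[R]_n.+1) (k : @chart R n).
Hypothesis (kL : lipschitz_chart Om k).

Let M := chart_rot k.
Let g := chart_gr k.

Lemma chart_rot_mulV : M *m M^T = 1%:M. Proof. exact: chart_orthogonal kL. Qed.
Lemma chart_rot_Vmul : M^T *m M = 1%:M. Proof. exact: mulmx1C chart_rot_mulV. Qed.

Definition chart_coord (x : 'rV[R]_n.+1) : 'rV[R]_n.+1 := (x - chart_org k) *m (chart_rot k)^T.
Definition chart_t x : R := chart_coord x ord0 ord0.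
Definition chart_y x : 'rV[R]_n := vbehead (chart_coord x).

Lemma vcons_behead (x : 'rV[R]_n.+1) : vcons (x ord0 ord0) (vbehead x) = x.
Proof.
by apply/rowP => i; case: (unliftP ord0 i) => [j|] ->; rewrite ?vcons0 ?vconsS// mxE.
Qed.

Lemma chart_coordK x : chart_pt k (chart_t x) (chart_y x) = x.
Proof.
by rewrite /chart_pt vcons_behead /chart_coord -mulmxA chart_rot_Vmul mulmx1 addrC subrK.
Qed.

Lemma chart_coord_pt t y : chart_coord (chart_pt k t y) = vcons t y.
Proof. by rewrite /chart_coord /chart_pt addrAC subrr add0r -mulmxA chart_rot_mulV mulmx1. Qed.

Lemma chart_t_pt t y : chart_t (chart_pt k t y) = t.
Proof. by rewrite /chart_t chart_coord_pt vcons0. Qed.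

Lemma chart_y_pt t y : chart_y (chart_pt k t y) = y.
Proof. by rewrite /chart_y chart_coord_pt vconsK. Qed.

(** The norm on row vectors is the maximum norm, for which an orthogonal matrix is no isometry; this
    is a common operator bound for M and its transpose, made at least 1. *)
Definition rot_bound : R := (\sum_i \sum_j (`|M i j| + `|M^T i j|)) + 1.

Lemma rot_bound_ge1 : 1 <= rot_bound.
Proof. by rewrite lerDr; do 2 (apply: sumr_ge0 => ? _); rewrite addr_ge0. Qed.

Lemma mulmx_norm_le (N : 'M[R]_n.+1) (v : 'rV[R]_n.+1) :
  `|v *m N| <= (\sum_i \sum_j `|N i j|) * `|v|.
Proof.
apply/rV_norm_le => [|j].
  by rewrite mulr_ge0// sumr_ge0// => i _; rewrite sumr_ge0.
rewrite mxE; apply: le_trans (ler_norm_sum _ _ _) _; rewrite mulr_suml; apply: ler_sum => i _.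
rewrite normrM mulrC ler_pM//; last exact: rV_coord_le.
by rewrite (bigD1 j)//= lerDl sumr_ge0.
Qed.

Lemma mulmx_rot_le (v : 'rV[R]_n.+1) : `|v *m M| <= rot_bound * `|v|.
Proof.
apply: le_trans (mulmx_norm_le _ _) _; rewrite ler_wpM2r// /rot_bound.
apply: le_trans (_ : _ <= \sum_i \sum_j (`|M i j| + `|M^T i j|)) _; last by rewrite lerDl.
by apply: ler_sum => i _; apply: ler_sum => j _; rewrite lerDl.
Qed.

Lemma mulmx_rotV_le (v : 'rV[R]_n.+1) : `|v *m M^T| <= rot_bound * `|v|.
Proof.
apply: le_trans (mulmx_norm_le _ _) _; rewrite ler_wpM2r// /rot_bound.
apply: le_trans (_ : _ <= \sum_i \sum_j (`|M i j| + `|M^T i j|)) _; last by rewrite lerDl.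
by apply: ler_sum => i _; apply: ler_sum => j _; rewrite lerDr.
Qed.

Lemma vbehead_le (v : 'rV[R]_n.+1) : `|vbehead v| <= `|v|.
Proof. by apply/rV_norm_le => // i; rewrite mxE; exact: rV_coord_le. Qed.

Lemma vbeheadB (u v : 'rV[R]_n.+1) : vbehead (u - v) = vbehead u - vbehead v.
Proof. by apply/rowP => i; rewrite !mxE. Qed.

Lemma rVDE m (u v : 'rV[R]_m) i : (u + v) ord0 i = u ord0 i + v ord0 i.
Proof. by rewrite mxE. Qed.

Lemma rVZE m (a : R) (v : 'rV[R]_m) i : (a *: v) ord0 i = a * v ord0 i.
Proof. by rewrite mxE. Qed.

Lemma chart_coordB x x' : chart_coord x - chart_coord x' = (x - x') *m M^T.
Proof. by rewrite /chart_coord -mulmxBl opprB addrA subrK. Qed.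

Lemma chart_t_lip x x' : `|chart_t x - chart_t x'| <= rot_bound * `|x - x'|.
Proof.
apply: le_trans (mulmx_rotV_le _); rewrite -chart_coordB.
rewrite /chart_t; move: (chart_coord x) (chart_coord x') => a b.
by have := rV_coord_le (a - b) ord0; rewrite !mxE.
Qed.

Lemma chart_y_lip x x' : `|chart_y x - chart_y x'| <= rot_bound * `|x - x'|.
Proof.
apply: le_trans (mulmx_rotV_le _); rewrite -chart_coordB -vbeheadB.
exact: vbehead_le.
Qed.

Lemma chart_gr_lip : exists2 L : R, 0 <= L & forall y y', `|g y - g y'| <= L * `|y - y'|.
Proof.
have [L hL] := chart_gr_lipschitz kL; exists `|L| => // y y'.
have /= h := hL (y, y') (conj I I); apply: le_trans h _.
by rewrite ler_wpM2r// ler_norm.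
Qed.

Lemma chart_gr_continuous : continuous g.
Proof.
have [L L0 hL] := chart_gr_lip; move=> y; apply/(cvgrPdist_lt (FF := nbhs_filter y)) => e e0.
have e1 : 0 < e / (L + 1) by rewrite divr_gt0// ltr_wpDl.
apply/nbhs_ballP; exists (e / (L + 1)) => // y' yy'.
apply: le_lt_trans (hL _ _) _; apply: (@le_lt_trans _ _ ((L + 1) * `|y - y'|)).
  by rewrite ler_wpM2r// lerDl.
rewrite mulrC -ltr_pdivlMr ?ltr_wpDl//.
by move: yy'; rewrite mx_norm_ball.
Qed.

Definition in_cyl x := `|chart_t x| < chart_ht k /\ chart_base k (chart_y x).

Lemma chart_mem x : in_cyl x -> Om x <-> g (chart_y x) < chart_t x.
Proof. by move=> [ht hy]; have := chart_epigraph kL ht hy; rewrite chart_coordK. Qed.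

Lemma cyl_ball x : in_cyl x -> exists2 r : R, 0 < r & forall x', `|x' - x| <= r -> in_cyl x'.
Proof.
move=> [ht hy]; have a1 := rot_bound_ge1.
have a0 : 0 < rot_bound by apply: lt_le_trans a1.
pose m := minr (chart_ht k - `|chart_t x|) (chart_rad k - `|chart_y x|).
have m0 : 0 < m by rewrite lt_min !subr_gt0 ht.
exists (m / (rot_bound * 2)) => [|x' xx']; first by rewrite divr_gt0// mulr_gt0.
have am : rot_bound * `|x' - x| < m.
  apply: (@le_lt_trans _ _ (m / 2)).
    rewrite mulrC -ler_pdivlMr//; apply: le_trans xx' _.
    by rewrite invfM mulrA mulrAC.
  by rewrite ltr_pdivrMr// ltr_pMr// ltr1n.
move: am; rewrite lt_min => /andP[m1 m2].
split.
  have := chart_t_lip x' x; have := ler_normD (chart_t x' - chart_t x) (chart_t x).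
  by rewrite subrK; lra.
rewrite /chart_base/=.
have := chart_y_lip x' x; have := ler_normD (chart_y x' - chart_y x) (chart_y x).
by rewrite subrK; lra.
Qed.

Lemma chart_closure x : closure Om x -> in_cyl x -> g (chart_y x) <= chart_t x.
Proof.
move=> clx cx; rewrite leNgt; apply/negP => gt.
have [r r0 hr] := cyl_ball cx; have [L L0 hL] := chart_gr_lip.
have a1 := rot_bound_ge1; have a0 : 0 < rot_bound by apply: lt_le_trans a1.
have aL : 0 < rot_bound * (L + 1) by rewrite mulr_gt0// ltr_wpDl.
pose e := minr r ((g (chart_y x) - chart_t x) / (rot_bound * (L + 1))).
have e0 : 0 < e by rewrite lt_min r0 divr_gt0// subr_gt0.
have [x' [Omx']] := clx _ (nbhsx_ballx x _ e0); rewrite mx_norm_ball /ball_/= distrC.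
rewrite lt_min => /andP[h1 h2].
have /(chart_mem) : in_cyl x' by apply: hr; exact: ltW.
move=> [+ _] => /(_ Omx') lt'.
move: h2; rewrite ltr_pdivlMr// => h2.
have t1 := chart_t_lip x' x; have t2 := hL (chart_y x') (chart_y x).
have t3 : L * `|chart_y x' - chart_y x| <= L * (rot_bound * `|x' - x|).
  by rewrite ler_wpM2l// chart_y_lip.
move: t1 t2; rewrite !ler_norml => /andP[t11 t12] /andP[t21 t22].
have : `|x' - x| * (rot_bound * (L + 1)) = L * (rot_bound * `|x' - x|) + rot_bound * `|x' - x| by ring.
lra.
Qed.

(** A uniform interior cone condition. Along d, the image of the vertical axis, a step e raises t by
    e and keeps y. Replacing d by a z within rho changes t by at most [e * rot_bound * rho] and the
    graph by at most L times that; rho makes the sum e / 2. *)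
Lemma chart_cone p : in_cyl p -> exists r d rho e0, [/\ 0 < r :> R, 0 < rho :> R, 0 < e0 :> R &
  forall x, closure Om x -> `|x - p| <= r -> forall e, 0 < e < e0 ->
  forall z, `|z - d| <= rho -> Om (x + e *: z)].
Proof.
move=> cp; have [r r0 hr] := cyl_ball cp; have [L L0 hL] := chart_gr_lip.
have a1 := rot_bound_ge1; have a0 : 0 < rot_bound by apply: lt_le_trans a1.
have aL : 0 < rot_bound * (L + 1) by rewrite mulr_gt0// ltr_wpDl.
pose d : 'rV[R]_n.+1 := vcons 1 0 *m M.
pose rho := (2 * (rot_bound * (L + 1)))^-1.
have rho0 : 0 < rho by rewrite invr_gt0 mulr_gt0.
have dr : 0 < `|d| + rho by rewrite ltr_wpDl.
exists (r / 2), d, rho, (r / 2 / (`|d| + rho)); split; rewrite ?divr_gt0//.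
move=> x clx xp e /andP[e0 ee] z zd.
have nz : `|z| <= `|d| + rho.
  by have := ler_normD (z - d) d; rewrite subrK; lra.
have cx : in_cyl x by apply: hr; lra.
have cxe : in_cyl (x + e *: z).
  apply: hr; rewrite addrAC; apply: le_trans (ler_normD _ _) _.
  have : `|e *: z| <= r / 2.
    rewrite normrZ (gtr0_norm e0); move: ee; rewrite ltr_pdivlMr// => ee.
    apply: le_trans (ltW ee); rewrite ler_wpM2l//; exact: ltW.
  lra.
apply/(chart_mem cxe).
pose w := (z - d) *m M^T.
have nw : `|w| <= rot_bound * rho.
  by apply: le_trans (mulmx_rotV_le _) _; rewrite ler_wpM2l// ltW.
have cE : chart_coord (x + e *: z) = chart_coord x + e *: (vcons 1 0 + w).
  rewrite /w mulmxBl /d -(mulmxA _ M) chart_rot_mulV mulmx1 addrCA subrr addr0.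
  by rewrite scalemxAl /chart_coord -mulmxDl addrAC.
have tE : chart_t (x + e *: z) = chart_t x + e * (1 + w ord0 ord0).
  rewrite /chart_t cE; move: (chart_coord x) w {nw cE} => a b.
  by rewrite !rVDE rVZE rVDE vcons0.
have yE : chart_y (x + e *: z) - chart_y x = e *: vbehead w.
  rewrite /chart_y cE; move: (chart_coord x) w {nw cE tE} => a b; apply/rowP => i.
  rewrite -vbeheadB addrAC subrr add0r [LHS]mxE [RHS]rVZE [in RHS]/vbehead [in RHS]mxE rVZE rVDE vconsS.
  by rewrite [X in X + _]mxE add0r.
have lt1 := hL (chart_y (x + e *: z)) (chart_y x).
have le2 : L * `|chart_y (x + e *: z) - chart_y x| <= L * (e * (rot_bound * rho)).
  rewrite ler_wpM2l// yE normrZ (gtr0_norm e0) ler_wpM2l ?(ltW e0)//.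
  exact: le_trans (vbehead_le _) nw.
have w0 := le_trans (rV_coord_le w ord0) nw.
have cg := chart_closure clx cx.
have rE : e * (rot_bound * rho) * (L + 1) = e / 2.
  have -> : e * (rot_bound * rho) * (L + 1) = e * (rho * (rot_bound * (L + 1))) by ring.
  by rewrite /rho invfM mulfVK ?gt_eqF.
rewrite tE; move: lt1 w0; rewrite !ler_norml => /andP[_ lt1] /andP[w0 _].
have : e * - (rot_bound * rho) <= e * w ord0 ord0 by rewrite ler_wpM2l// ltW.
nra.
Qed.

Lemma chart_rot_unit : M^T \in unitmx.
Proof. by have [] := mulmx1_unit chart_rot_mulV. Qed.

Lemma measurable_chart_pt :
  measurable_fun setT (fun p : measurableTypeR R * 'rV[R]_n => chart_pt k p.1 p.2).
Proof.
have -> : (fun p : measurableTypeR R * 'rV[R]_n => chart_pt k p.1 p.2) =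
  (fun w => w + chart_org k) \o ((fun w => w *m M) \o (fun p => vcons p.1 p.2)).
  by apply/funext => p /=; rewrite addrC.
apply: measurableT_comp; first exact: measurable_translate.
by apply: measurableT_comp; [exact: measurable_mulmx|exact: measurable_vcons].
Qed.

(** Fubini in the coordinates (t, y), with the factor c of [leb_mulmx] for the rotation. *)
Lemma chart_integral : exists2 c : R, 0 <= c & forall f : 'rV[R]_n.+1 -> \bar R,
  measurable_fun setT f -> (forall x, 0 <= f x)%E ->
  (\int[mu]_x f x = c%:E * \int[leb n]_y \int[lebesgue_measure]_t f (chart_pt k t y))%E.
Proof.
have [c c0 muM] := leb_mulmx chart_rot_unit; exists c => // f mf f0.
pose f1 w := f (w + chart_org k).
have mf1 : measurable_fun setT f1 by apply: measurableT_comp => //; exact: measurable_translate.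
pose f2 w := f1 (w *m M).
have mf2 : measurable_fun setT f2 by apply: measurableT_comp => //; exact: measurable_mulmx.
rewrite -(mp_ge0_integral (measurable_translate (chart_org k)) (leb_translate (chart_org k)) mf f0).
have -> : (\int[mu]_x f (x + chart_org k)%R = \int[mu]_x f2 (x *m M^T))%E.
  by apply: eq_integral => x _; rewrite /f2 /f1 -mulmxA chart_rot_Vmul mulmx1.
rewrite (scaled_ge0_integral (measurable_mulmx _) c0 muM mf2) ?/f2 ?/f1//; congr (_ * _)%E.
rewrite /= /leb_cons ge0_integral_pushforward//; last exact: measurable_vcons.
rewrite preimage_setT.
pose F (p : measurableTypeR R * 'rV[R]_n) := f (vcons p.1 p.2 *m M + chart_org k).
have mF : measurable_fun setT F.
  by apply: (measurableT_comp mf2); exact: measurable_vcons.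
transitivity (\int[lebesgue_measure \x leb n]_p F p)%E; first by [].
rewrite (fubini_tonelli2 F mF) => [|p]; last exact: f0.
by rewrite /fubini_G; apply: eq_integral => y _; apply: eq_integral => t _; rewrite /F /chart_pt addrC.
Qed.

Lemma measurable_chart_coord : measurable_fun setT chart_coord.
Proof.
apply: (measurableT_comp (f := fun x => x *m M^T)); first exact: measurable_mulmx.
exact: measurable_translate.
Qed.

Lemma measurable_chart_t : measurable_fun setT chart_t.
Proof.
exact: (measurableT_comp (f := fun x : 'rV[R]_n.+1 => x ord0 ord0)
  (measurable_coord _) measurable_chart_coord).
Qed.

Lemma measurable_chart_y : measurable_fun setT chart_y.
Proof. exact: (measurableT_comp (@measurable_vbehead _ _) measurable_chart_coord). Qed.

Lemma measurable_chart_gr : measurable_fun setT g.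
Proof. exact: rV_continuous_measurable chart_gr_continuous. Qed.

Definition strip (s : R) : set 'rV[R]_n.+1 := [set x | `|chart_t x - g (chart_y x)| <= s].

Lemma strip_measurable s : measurable (strip s).
Proof.
have m : measurable_fun setT (fun x => `|chart_t x - g (chart_y x)|).
  apply: measurableT_comp => //; apply: measurable_funB; first exact: measurable_chart_t.
  exact: (measurableT_comp measurable_chart_gr measurable_chart_y).
have := m measurableT `]-oo, s]%classic (measurable_itv _).
by rewrite setTI; congr measurable; apply/seteqP; split => x /=; rewrite in_itv.
Qed.

Lemma strip_integral : exists2 c : R, 0 <= c & forall (u : 'rV[R]_n -> R) (s : R),
  measurable_fun setT u -> (forall y, 0 <= u y) -> 0 <= s ->
  (\int[mu]_x (u (chart_y x) * \1_(strip s) x)%:E = (c * s)%:E * \int[leb n]_y (u y)%:E)%E.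
Proof.
(* Each vertical slice of the strip is an interval of length 2 s. *)
have [c c0 hc] := chart_integral; exists (c * 2); first by rewrite mulr_ge0.
move=> u s mu0 u0 s0; rewrite hc; last 2 first.
- apply/measurable_EFinP; apply: measurable_funM.
    exact: (measurableT_comp mu0 measurable_chart_y).
  by apply: measurable_indic; exact: strip_measurable.
- by move=> x; rewrite lee_fin mulr_ge0.
rewrite -mulrA EFinM -muleA; congr (_ * _)%E.
rewrite -ge0_integralZl//; last 3 first.
- exact/measurable_EFinP.
- by move=> y _; rewrite lee_fin.
- by rewrite lee_fin mulr_ge0.
apply: eq_integral => y _.
transitivity (\int[lebesgue_measure]_t ((u y)%:E * (\1_(`[g y - s, g y + s]%classic) t)%:E))%E.
  apply: eq_integral => t _; rewrite chart_y_pt -EFinM; congr (_ * _)%:E.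
  rewrite !indicE; congr (_%:R); congr nat_of_bool; apply/idP/idP; rewrite !inE /strip/=.
    by rewrite chart_y_pt chart_t_pt in_itv/= ler_norml => /andP[h1 h2]; apply/andP; split; lra.
  by rewrite chart_y_pt chart_t_pt in_itv/= ler_norml => /andP[h1 h2]; apply/andP; split; lra.
rewrite ge0_integralZl//; last by rewrite lee_fin.
- rewrite integral_indic// setIT.
  have /= -> := lebesgue_measure_itv `[g y - s, g y + s]%R.
  rewrite lte_fin; have [h|h] := ltP (g y - s) (g y + s).
    by rewrite -EFinD -EFinM; congr (_%:E); ring.
  have -> : s = 0 by lra.
  by rewrite mule0 mulr0 mul0e.
exact/measurable_EFinP/measurable_indic.
Qed.

Lemma chart_base_measurable : measurable (chart_base k).
Proof.
rewrite (_ : chart_base k = [set y | forall i, `|y ord0 i| < chart_rad k]).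
  apply: (measurable_forall_coord (B := fun=> [set t | `|t| < chart_rad k])) => i.
  have m : measurable_fun setT (fun t : R => `|t|) by exact: measurableT_comp.
  have := m measurableT `]-oo, chart_rad k[%classic (measurable_itv _).
  by rewrite setTI; congr measurable; apply/seteqP; split => x /=; rewrite in_itv.
apply/seteqP; split => y /=.
  by move=> h i; apply: le_lt_trans h; exact: rV_coord_le.
exact: rV_norm_lt (chart_rad_gt0 kL).
Qed.

Lemma chart_base_lty : (leb n (chart_base k) < +oo)%E.
Proof.
apply: (@leb_bounded_lty _ _ _ (chart_rad k)); first exact: chart_base_measurable.
by move=> y yb i; apply: le_trans (rV_coord_le _ _) (ltW yb).
Qed.

(** If exactly one of x and x' lies in Om, then t - g(y) changes sign between them. Its Lipschitz
    constant is at most [rot_bound * (L + 1)], which bounds the vertical distance from x to the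
    graph. *)
Lemma chart_indic : exists2 c : R, 0 <= c & forall x x', in_cyl x -> in_cyl x' ->
  \1_Om x != \1_Om x' :> R -> strip (c * `|x - x'|) x.
Proof.
have [L L0 hL] := chart_gr_lip; exists (rot_bound * (L + 1)).
  by apply: mulr_ge0; [exact: le_trans ler01 rot_bound_ge1|rewrite addr_ge0].
move=> x x' cx cx'; rewrite /strip/= => ne.
have t1 := chart_t_lip x x'; have t2 := hL (chart_y x) (chart_y x').
have t3 : L * `|chart_y x - chart_y x'| <= L * (rot_bound * `|x - x'|).
  by rewrite ler_wpM2l// chart_y_lip.
have t4 : rot_bound * (L + 1) * `|x - x'| = L * (rot_bound * `|x - x'|) + rot_bound * `|x - x'| by ring.
rewrite t4; move: t1 t2; rewrite !ler_norml => /andP[t11 t12] /andP[t21 t22].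
have [ox|ox] := pselect (Om x); have [ox'|ox'] := pselect (Om x').
- by move: ne; rewrite !indicE !mem_set ?eqxx.
- have /(chart_mem cx) lx := ox.
  have lx' : chart_t x' <= g (chart_y x') by rewrite leNgt; apply/negP => /(chart_mem cx').
  by apply/andP; split; lra.
- have /(chart_mem cx') lx' := ox'.
  have lx : chart_t x <= g (chart_y x) by rewrite leNgt; apply/negP => /(chart_mem cx).
  by apply/andP; split; lra.
- by move: ne; rewrite !indicE !memNset ?eqxx.
Qed.

Lemma chart_pt_lip t t' y : `|chart_pt k t y - chart_pt k t' y| <= rot_bound * `|t - t'|.
Proof.
have -> : chart_pt k t y - chart_pt k t' y = (vcons t y - vcons t' y) *m M.
  by rewrite /chart_pt opprD addrACA subrr add0r mulmxBl.
apply: le_trans (mulmx_rot_le _) _; rewrite ler_wpM2l//.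
  exact: le_trans ler01 rot_bound_ge1.
apply/rV_norm_le => // i; rewrite rVDE [X in _ + X]mxE.
case: (unliftP ord0 i) => [j|] ->; last by rewrite !vcons0.
by rewrite !vconsS subrr normr0.
Qed.

Lemma measurable_on_graph (G : 'rV[R]_n.+1 -> R) : measurable_fun setT G ->
  measurable_fun setT (on_graph k G).
Proof.
move=> mG; have mp : measurable_fun setT (fun y : 'rV[R]_n => (g y, y)).
  by apply: measurable_fun_pair => //; exact: measurable_chart_gr.
exact: (measurableT_comp mG (measurableT_comp measurable_chart_pt mp)).
Qed.

(* The difference quotient of the integral of G over Om only sees a strip of
   width O(h) around the graph. *)
Lemma chart_div_bound p : measurable Om -> in_cyl p ->
  exists r C, [/\ 0 < r :> R, 0 <= C :> R & forall G i, is_tf G ->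
    (forall x, G x != 0 -> `|x - p| <= r) ->
    `|\int[mu]_x (\1_Om x * partial i G x)| <=
      C * \int[leb n]_y (`|on_graph k G y| * \1_(chart_base k) y)].
Proof.
move=> mOm cp; have [r0 r00 hr0] := cyl_ball cp.
have [c c0 hc] := strip_integral; have [kp kp0 hkp] := chart_indic.
exists (r0 / 2), (c * kp); split; rewrite ?divr_gt0 ?mulr_ge0// => G i tG sG.
have mG := tf_measurable tG; have iG := tf_itg tG; have mOm1 := measurable_indic (R := R) mOm.
have [CR CR0 hCR] := tf_remainder tG; have [CL CL0 hCL] := tf_lipschitz tG.
set I := \int[mu]_x _; set J := \int[leb n]_y _.
pose V := fine (leb n (chart_base k)).
have rb0 : 0 <= rot_bound := le_trans ler01 rot_bound_ge1.
(* The error of order h collects the Taylor remainder and the variation of G across the strip. CR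
   and CL depend on G but come with the factor h, so the final constant does not. *)
suff H h : 0 < h -> h <= minr (r0 / 2) 1 ->
    `|I| <= c * kp * J + (c * kp * (CL * (rot_bound * kp)) * V + CR) * h.
  apply: le_addgt0_scale H => //; last by rewrite lt_min ltr01 divr_gt0.
  by rewrite addr_ge0// mulr_ge0 ?fine_ge0// mulr_ge0 ?mulr_ge0.
rewrite le_min => h0 /andP[hr h1].
pose v : 'rV[R]_n.+1 := h *: delta_mx ord0 i.
have nv : `|v| <= h by have := norm_delta_le i h; rewrite (gtr0_norm h0).
pose rem x := G (x + v) - G x - h * partial i G x.
have [irem irem2] : itg mu rem /\ \int[mu]_x `|rem x| <= CR * h ^+ 2.
  have [] := hCR v (le_trans nv h1).
  have -> : (fun x => G (x + v) - G x - \sum_j v ord0 j * partial j G x) = rem.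
    by apply/funext => x; rewrite sum_delta.
  move=> /= i1 _ i2 _; split => //.
  have v2 : CR * `|v| ^+ 2 <= CR * h ^+ 2 by rewrite ler_wpM2l// lerXn2r ?nnegrE ?(ltW h0).
  apply: le_trans v2; rewrite (_ : \int[mu]_x _ =
    \int[mu]_x `|G (x + v) - G x - \sum_j v ord0 j * partial j G x|)//.
  by apply: eq_Rintegral => x _; rewrite sum_delta.
(* A change of variables moves the shift from G to the indicator of Om; D then vanishes wherever the
   shift does not cross the boundary. *)
pose D x : R := (\1_Om (x - v) - \1_Om x) * G x.
have hI : h * I = \int[mu]_x D x - \int[mu]_x (\1_Om x * rem x).
  rewrite /I -RintegralZl//; last exact: itg_ind (tf_itg (tf_partial i tG)).
  have iGv : itg mu (fun x => G (x + v)) by exact: leb_translate_itg.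
  have -> : \int[mu]_x (h * (\1_Om x * partial i G x)) =
      \int[mu]_x ((\1_Om x * G (x + v) - \1_Om x * G x) - \1_Om x * rem x).
    by apply: eq_Rintegral => x _; rewrite /rem; ring.
  rewrite RintegralB//; [|by apply: itgB; exact: itg_ind|exact: itg_ind].
  congr (_ - _); rewrite RintegralB//; [|exact: itg_ind|exact: itg_ind].
  rewrite -(leb_translate_Rintegral (- v)); last exact: itg_ind.
  rewrite -RintegralB//; last exact: itg_ind; last first.
    apply: (leb_translate_itg (f := fun x => \1_Om x * G (x + v))); exact: itg_ind.
  by apply: eq_Rintegral => x _; rewrite subrK /D mulrBl.
have DG : `|\int[mu]_x D x| <= (c * (kp * h)) * (J + CL * (rot_bound * (kp * h)) * V).
  pose K := CL * (rot_bound * (kp * h)).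
  have K0 : 0 <= K by rewrite !mulr_ge0 ?(ltW h0).
  pose u y : R := `|on_graph k G y| * \1_(chart_base k) y + K * \1_(chart_base k) y.
  have ib : itg (leb n) (\1_(chart_base k) : _ -> R).
    by apply: itg_indic; [exact: chart_base_measurable|exact: chart_base_lty].
  have ig : itg (leb n) (fun y => `|on_graph k G y| * \1_(chart_base k) y).
    have [CG CG0 hCG] := tf_bounded tG.
    apply: itg_le (itgZ CG ib) _ => [|y].
      apply: measurable_funM; last exact: itg_mfun ib.
      by apply: measurableT_comp => //; exact: measurable_on_graph.
    rewrite normrM normr_id (ger0_norm (_ : 0 <= \1_(chart_base k) y))//.
    by rewrite ler_wpM2r//; exact: hCG.
  have iu : itg (leb n) u by apply: itgD => //; exact: itgZ.
  have u0 y : 0 <= u y by rewrite addr_ge0// mulr_ge0.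
  have Du x : `|D x| <= u (chart_y x) * \1_(strip (kp * h)) x.
    have [->|] := eqVneq (D x) 0; first by rewrite normr0 mulr_ge0.
    rewrite mulf_eq0 negb_or => /andP[n1 n2].
    have xp := sG _ n2.
    have cx : in_cyl x by apply: hr0; lra.
    have cxv : in_cyl (x - v).
      by apply: hr0; rewrite addrAC; apply: le_trans (ler_normB _ _) _; lra.
    have sx : strip (kp * h) x.
      have /(hkp _ _ cx cxv) : \1_Om x != \1_Om (x - v) :> R.
        by rewrite eq_sym -subr_eq0.
      rewrite opprB addrC subrK /strip/= => /le_trans; apply.
      by rewrite ler_wpM2l.
    have s1 : \1_(strip (kp * h)) x = 1 :> R by rewrite indicE mem_set.
    have b1 : \1_(chart_base k) (chart_y x) = 1 :> R by rewrite indicE mem_set//; case: cx.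
    rewrite s1 mulr1 /u b1 !mulr1.
    have D1 : `|D x| <= `|G x|.
      rewrite normrM ler_piMl// !indicE; case: (_ \in _); case: (_ \in _).
      - by rewrite subrr normr0.
      - by rewrite subr0 normr1.
      - by rewrite sub0r normrN normr1.
      - by rewrite subrr normr0.
    apply: le_trans D1 _.
    (* The point of the graph on the vertical line through x, where G is compared with its value at
       x. *)
    pose x' := chart_pt k (g (chart_y x)) (chart_y x).
    have := hCL x' (x - x'); rewrite (addrC x') subrK -/(on_graph k G (chart_y x)).
    have : `|x - x'| <= rot_bound * (kp * h).
      rewrite -{1}(chart_coordK x); apply: le_trans (chart_pt_lip _ _ _) _.
      by rewrite ler_wpM2l.
    move=> /(ler_wpM2l CL0); rewrite -/K => h2 h3.
    by have := ler_normD (G x - on_graph k G (chart_y x)) (on_graph k G (chart_y x)); rewrite subrK; lra.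
  have iD : itg mu D.
    have -> : D = (fun x => \1_Om (x - v) * G x - \1_Om x * G x).
      by apply/funext => x; rewrite /D mulrBl.
    apply: itgB; last exact: itg_ind.
    apply: itg_le (itg_norm iG) _ => [|x].
      apply: measurable_funM; last exact: itg_mfun iG.
      by apply: (measurableT_comp (f := \1_Om : _ -> R)) => //; exact: measurable_translate.
    by rewrite normrM ler_piMl// indicE; case: (_ \in _); rewrite ?normr1 ?normr0.
  have := le_normr_Rintegral measurableT iD => /le_trans; apply.
  rewrite -lee_fin EFin_Rintegral; last exact: itg_norm.
  have -> : c * (kp * h) * (J + K * V) = c * (kp * h) * \int[leb n]_y u y.
    rewrite /u RintegralD//; last exact: itgZ.
    rewrite RintegralZl//; congr (_ * (_ + _ * _)); apply/esym.
    rewrite /Rintegral integral_indic//; last exact: chart_base_measurable.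
    by rewrite setIT.
  rewrite EFinM EFin_Rintegral// -hc//; last 2 first.
  - exact: itg_mfun iu.
  - by rewrite mulr_ge0// ltW.
  apply: ge0_le_integral => //.
  - by apply/measurable_EFinP; exact: itg_mfun (itg_norm iD).
  - apply/measurable_EFinP; apply: measurable_funM.
      exact: (measurableT_comp (itg_mfun iu) measurable_chart_y).
    by apply: measurable_indic; exact: strip_measurable.
  - by move=> x _; rewrite lee_fin; exact: Du.
have remb : `|\int[mu]_x (\1_Om x * rem x)| <= CR * h ^+ 2.
  apply: le_trans irem2; apply: le_trans (le_normr_Rintegral _ _) _ => //; first exact: itg_ind.
  apply: le_Rintegral => //; [exact: itg_norm (itg_ind mOm irem)|exact: itg_norm|move=> x _].
  by rewrite normrM ler_piMl// indicE; case: (_ \in _); rewrite ?normr1 ?normr0.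
rewrite -(ler_pM2l h0) -{1}(gtr0_norm h0) -normrM hI.
apply: le_trans (ler_normB _ _) _.
apply: le_trans (lerD DG remb) _.
rewrite le_eqVlt; apply/orP; left; apply/eqP; ring.
Qed.

End chart_geometry.

(** * Weak derivatives and traces *)

Section weak_derivatives.
Context {R : realType} {n : nat}.
Notation mu := (@leb R n.+1).
Implicit Types (f g u v phi : 'rV[R]_n.+1 -> R).
Variables (Om : set 'rV[R]_n.+1).
Hypothesis (oOm : open Om).

Lemma partial_supp (K : set 'rV[R]_n.+1) phi i : closed K ->
  (forall x, phi x != 0 -> K x) -> forall x, partial i phi x != 0 -> K x.
Proof.
move=> cK hK x; apply: contraNP => nKx.
apply/eqP; rewrite /partial -(derive_cst (0:R) x (delta_mx ord0 i)).
apply: near_eq_derive.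
have : \forall y \near x, (~` K) y by apply: open_nbhs_nbhs; split => //; exact: closed_openC.
by apply: filterS => y nKy; apply: contra_notP nKy => /eqP/hK.
Qed.

Lemma restrictE f (x : 'rV[R]_n.+1) : (f \_ Om) x = \1_Om x * f x.
Proof. by rewrite patchE indicE; case: (_ \in _); rewrite ?mul1r ?mul0r. Qed.

Lemma LpF2E f : LpF Om 2%:E f <-> L2 mu (f \_ Om). Proof. exact: L2_Lfun. Qed.

Lemma L2normE f : L2 mu (f \_ Om) -> L2norm Om f = (nrm2 mu (f \_ Om))%:E.
Proof. exact: Lnorm2E. Qed.

Lemma Rintegral_restrict_mul f g :
  \int[mu]_(x in Om) (f x * g x) = \int[mu]_x ((f \_ Om) x * g x).
Proof.
rewrite Rintegral_mkcond; apply: eq_Rintegral => x _.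
by rewrite !restrictE mulrA.
Qed.

Lemma is_weak_partialE i f g : is_weak_partial Om i f g <-> forall phi, tf_in Om phi ->
  \int[mu]_x ((f \_ Om) x * partial i phi x) = - \int[mu]_x ((g \_ Om) x * phi x).
Proof.
by split=> h phi hp; [rewrite -!Rintegral_restrict_mul|rewrite !Rintegral_restrict_mul];
  apply: h; exact/tf_in_test.
Qed.

Lemma wpartialP i f : W12 Om f ->
  LpF Om 2%:E (wpartial Om i f) /\ is_weak_partial Om i f (wpartial Om i f).
Proof.
move=> [_ /(_ i)[g Lg wg]].
exact: (@xgetPex _ (cst 0) [set g | LpF Om 2%:E g /\ is_weak_partial Om i f g] (ex_intro _ g (conj Lg wg))).
Qed.

Lemma is_weak_partial_ae i f g g' : LpF Om 2%:E g -> LpF Om 2%:E g' ->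
  is_weak_partial Om i f g -> is_weak_partial Om i f g' -> g \_ Om = g' \_ Om %[ae mu].
Proof.
move=> /LpF2E Lg /LpF2E Lg' /is_weak_partialE wg /is_weak_partialE wg'.
have : {ae mu, forall x, Om x -> (g \_ Om) x - (g' \_ Om) x = 0}.
  apply: fundamental_lemma => //; first exact: L2B.
  move=> phi hp; have tp := tf_in_tf hp.
  have -> : \int[mu]_x (((g \_ Om) x - (g' \_ Om) x) * phi x) =
    \int[mu]_x ((g \_ Om) x * phi x) - \int[mu]_x ((g' \_ Om) x * phi x).
    rewrite -RintegralB//; [|exact: tf_mul_itg|exact: tf_mul_itg].
    by apply: eq_Rintegral => x _; rewrite mulrBl.
  by have := wg _ hp; rewrite wg'// => /oppr_inj ->; rewrite subrr.
apply: filterS => x h _; have [ox|ox] := pselect (Om x).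
  exact: subr0_eq (h ox).
by rewrite !restrictE indicE memNset// !mul0r.
Qed.

Lemma smooth_restrict_L2 v : bounded_set Om -> smooth v -> L2 mu (v \_ Om).
Proof.
move=> bOm sv; have [r r0 hr] : exists2 r : R, 0 <= r & forall x, Om x -> `|x| <= r.
  have [M [Mr hM]] := bOm; exists (`|M| + 1) => [|x ox]; first by rewrite addr_ge0.
  by apply: hM ox; rewrite (le_lt_trans (ler_norm M))// ltrDl.
have [C C0 hC] := continuous_bounded_ball r (smooth_continuous sv).
apply: (@bounded_supp_L2 _ _ _ r C).
- rewrite (_ : v \_ Om = fun x => \1_Om x * v x); last by apply/funext => x; rewrite restrictE.
  apply: measurable_funM; first by apply: measurable_indic; exact: rV_open_measurable.
  exact: rV_continuous_measurable (smooth_continuous sv).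
- move=> x; rewrite restrictE indicE; case: (boolP (x \in Om)) => [/set_mem/hr/hC|_].
    by rewrite mul1r.
  by rewrite mul0r normr0.
- by move=> x; rewrite restrictE indicE; case: (boolP (x \in Om)) => [/set_mem/hr xr _//|_]; rewrite mul0r eqxx.
Qed.

Lemma smooth_is_weak_partial i v : smooth v -> is_weak_partial Om i v (partial i v).
Proof.
move=> sv; apply/is_weak_partialE => phi hp.
have tp := tf_in_tf hp; have [_ [K [cK KO] hK]] := hp.
have E (w psi : 'rV[R]_n.+1 -> R) : (forall x, psi x != 0 -> Om x) ->
    \int[mu]_x ((w \_ Om) x * psi x) = \int[mu]_x (w x * psi x).
  move=> h; apply: eq_Rintegral => x _; rewrite restrictE indicE.
  have [->|/h ox] := eqVneq (psi x) 0; first by rewrite !mulr0.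
  by rewrite mem_set// mul1r.
rewrite !E; first exact: tf_ibp.
- by move=> x /hK /KO.
- move=> x; have clK : closed K by apply: compact_closed => //; exact: norm_hausdorff.
  by move=> /(partial_supp clK hK)/KO.
Qed.

(** [wpartial] is a choice, but weak derivatives agree almost everywhere in Om, so any of them
    computes the norm. *)
Lemma W12normE f (g : 'I_n.+1 -> 'rV[R]_n.+1 -> R) : LpF Om 2%:E f ->
  (forall i, LpF Om 2%:E (g i)) -> (forall i, is_weak_partial Om i f (g i)) ->
  W12norm Om f = (nrm2 mu (f \_ Om) + \sum_i nrm2 mu (g i \_ Om))%:E.
Proof.
move=> Lf Lg wg; have W : W12 Om f by split => // i; exists (g i).
rewrite /W12norm L2normE; last exact/LpF2E.
rewrite EFinD -sumEFin; congr (_ + _)%E; apply: eq_bigr => i _.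
have [Lw ww] := wpartialP i W.
rewrite L2normE; last exact/LpF2E.
congr (_%:E); apply: nrm2_ae; [by case/LpF2E: Lw|by case/LpF2E: (Lg i)|].
exact: is_weak_partial_ae ww (wg i).
Qed.

End weak_derivatives.

Lemma cvg_EFin0 (R : realType) (a : nat -> R) : ((a j)%:E @[j --> \oo] --> 0%E)%E ->
  forall e, 0 < e -> exists N, forall j, (N <= j)%N -> `|a j| < e.
Proof.
move=> /fine_cvg/cvgrPdist_lt + e e0 => /(_ e e0)[N _ hN].
by exists N => j Nj; have := hN j Nj; rewrite /= sub0r normrN.
Qed.

Lemma finite_ball_cover (R : realType) (n : nat) (K : set 'rV[R]_n.+1) (r : 'rV[R]_n.+1 -> R) :
  compact K -> (forall p, K p -> 0 < r p) -> exists2 s : seq 'rV[R]_n.+1,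
  (forall p, p \in s -> K p) & forall x, K x -> exists2 p, p \in s & `|x - p| < r p.
Proof.
rewrite compact_cover => cK r0.
have [|x Kx|D DK cD] := cK _ K (fun p => ball p (r p)).
- by move=> p Kp; exact: ball_open.
- by exists x => //; apply: ballxx; exact: r0.
exists (finmap.enum_fset D) => [p /DK|x /cD[p pD]]; first by rewrite inE.
by rewrite mx_norm_ball /ball_/= distrC; exists p.
Qed.

Lemma closed_norm_le (R : realType) (n : nat) (p : 'rV[R]_n.+1) (r : R) :
  closed [set x | `|x - p| <= r].
Proof.
rewrite (_ : [set x | _] = closed_ball_ normr p r); first exact: closed_closed_ball_.
by apply/seteqP; split => x; rewrite /closed_ball_/= distrC.
Qed.

(** * Vanishing traces and weak derivatives of the extension by zero *)

Section boundary.
Context {R : realType} {n : nat}.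
Notation mu := (@leb R n.+1).
Variables (Om : set 'rV[R]_n.+1).
Hypothesis (dOm : bounded_lipschitz_domain Om).

Let oOm : open Om := domain_open dOm.
Let mOm : measurable Om := rV_open_measurable oOm.

Definition vanishing_trace (v : nat -> 'rV[R]_n.+1 -> R) := (forall j, smooth (v j)) /\
  forall k, lipschitz_chart Om k ->
    (L2norm (chart_base k) (on_graph k (v j)) @[j --> \oo] --> 0)%E.

(* By the divergence theorem the integrals below are boundary integrals. *)
Definition no_flux p (r : R) := forall v, vanishing_trace v -> forall F i, is_tf F ->
  (forall x, F x != 0 -> `|x - p| <= r) -> forall e : R, 0 < e ->
  exists N, forall j, (N <= j)%N -> `|\int[mu]_x (\1_Om x * partial i (fun x => v j x * F x) x)| <= e.

(** A whole ball of directions around d is demanded, so that a shift by e d and an averaging over a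
    ball of radius e rho can be carried out together inside Om. *)
Definition inward p (r : R) := exists d (rho e0 : R), [/\ 0 < rho, 0 < e0 &
  forall x, closure Om x -> `|x - p| <= r -> forall e, 0 < e < e0 ->
  forall z, `|z - d| <= rho -> Om (x + e *: z)].

Lemma closure_compact : compact (closure Om).
Proof.
apply: bounded_closed_compact; last exact: closed_closure.
have [M [Mr hM]] := domain_bounded dOm; exists M; split => // x Mx y cy.
have /closure_id cl := @closed_norm_le R n 0 x.
suff : closure [set y : 'rV[R]_n.+1 | `|y - 0| <= x] y by rewrite -cl /= subr0.
by apply: closureS cy => z /=; rewrite subr0; exact: hM.
Qed.

Lemma interior_ball p : Om p -> exists2 r : R, 0 < r & forall x, `|x - p| <= r -> Om x.
Proof.
move=> op; have /nbhs_ballP[r /= r0 hr] : nbhs p Om by exact: open_nbhs_nbhs.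
exists (r / 2) => [|x xp]; first by rewrite divr_gt0.
by apply: hr; rewrite mx_norm_ball /ball_/= distrC; lra.
Qed.

Lemma no_flux_interior p r : (forall x, `|x - p| <= r -> Om x) -> no_flux p r.
Proof.
move=> hr v [sv _] F i tF sF e e0; exists 0%N => j _.
have tG := tfM (sv j) tF.
rewrite (_ : \int[mu]_x _ = 0) ?normr0 ?(ltW e0)//.
rewrite -(tf_int_partial i tG); apply: eq_Rintegral => x _.
have [->|d0] := eqVneq (partial i (fun x => v j x * F x) x) 0; first by rewrite mulr0.
have ox : Om x.
  apply: hr; move: d0; apply: (partial_supp (K := [set x | `|x - p| <= r])).
    exact: closed_norm_le.
  by move=> y; rewrite mulf_eq0 negb_or => /andP[_] /sF.
by rewrite indicE mem_set// mul1r.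
Qed.

Section graph.
Variable (k : @chart R n).
Hypothesis (kL : lipschitz_chart Om k).

Lemma graph_bounded v : smooth v ->
  exists2 C : R, 0 <= C & forall y, chart_base k y -> `|on_graph k v y| <= C.
Proof.
move=> sv; pose r := `|chart_org k| + rot_bound k * (chart_ht k + chart_rad k).
have [C C0 hC] := continuous_bounded_ball r (smooth_continuous sv).
exists C => // y yb; apply: hC; apply: le_trans (ler_normD _ _) _; rewrite lerD2l.
apply: le_trans (mulmx_rot_le _ _) _; rewrite ler_wpM2l//.
  exact: le_trans ler01 (rot_bound_ge1 _).
have g1 := ltW (chart_gr_lt kL yb); have y1 := ltW yb.
have h0 := ltW (chart_ht_gt0 kL); have r0 := ltW (chart_rad_gt0 kL).
apply/rV_norm_le => [|i]; first exact: addr_ge0.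
case: (unliftP ord0 i) => [j|] ->; rewrite ?vcons0 ?vconsS.
  by have := rV_coord_le y j; lra.
by lra.
Qed.

Lemma graph_L2 v : smooth v -> L2 (leb n) (on_graph k v \_ (chart_base k)).
Proof.
move=> sv; have [C C0 hC] := graph_bounded sv.
have mb := chart_base_measurable kL.
have Lb : L2 (leb n) (\1_(chart_base k) : _ -> R).
  split; first exact: measurable_indic.
  rewrite (_ : (fun x => _) = \1_(chart_base k)); first by apply: itg_indic => //; exact: chart_base_lty kL.
  by apply/funext => y; rewrite indicE; case: (_ \in _); rewrite ?expr1n ?expr0n.
apply: (L2_le (c := C) _ Lb) => [|y].
  have -> : on_graph k v \_ (chart_base k) = fun y => \1_(chart_base k) y * on_graph k v y.
    by apply/funext => y; rewrite patchE indicE; case: (_ \in _); rewrite ?mul1r ?mul0r.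
  apply: measurable_funM; first exact: measurable_indic.
  by apply: (measurable_on_graph kL); exact: rV_continuous_measurable (smooth_continuous sv).
rewrite patchE indicE; case: (boolP (y \in _)) => [/set_mem/hC|_].
  by rewrite normr1 mulr1.
by rewrite normr0 mulr0.
Qed.

(** [chart_div_bound] for v_j F, then Cauchy-Schwarz on the graph: the norms of the v_j there tend
    to 0 while F is fixed. *)
Lemma no_flux_chart p : in_cyl k p -> exists2 r : R, 0 < r & no_flux p r.
Proof.
move=> cp; have [r [C [r0 C0 hC]]] := chart_div_bound kL mOm cp.
exists r => // v [sv vt] F i tF sF e e0.
have LF := graph_L2 (tf_smooth tF).
pose b := nrm2 (leb n) (on_graph k F \_ (chart_base k)).
have b0 : 0 <= b by exact: nrm2_ge0.
have Cb : 0 < C * b + 1 by rewrite ltr_wpDl// mulr_ge0.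
have : (fun j => (nrm2 (leb n) (on_graph k (v j) \_ (chart_base k)))%:E) @ \oo --> 0%E.
  have -> : (fun j => (nrm2 (leb n) (on_graph k (v j) \_ (chart_base k)))%:E) =
    fun j => L2norm (chart_base k) (on_graph k (v j)).
    by apply/funext => j; apply/esym/Lnorm2E; exact: graph_L2.
  exact: vt k kL.
move=> /cvg_EFin0/(_ (e / (C * b + 1)))[|N hN]; first by rewrite divr_gt0.
exists N => j /hN; rewrite (ger0_norm (nrm2_ge0 _ _)) ltr_pdivlMr// => hj.
have tG := tfM (sv j) tF.
have sG x : v j x * F x != 0 -> `|x - p| <= r by rewrite mulf_eq0 negb_or => /andP[_] /sF.
apply: le_trans (hC _ i tG sG) _.
have -> : \int[leb n]_y (`|on_graph k (fun x => v j x * F x) y| * \1_(chart_base k) y) =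
    ip2 (leb n) (fun y => `|(on_graph k (v j) \_ (chart_base k)) y|)
                (fun y => `|(on_graph k F \_ (chart_base k)) y|).
  apply: eq_Rintegral => y _; rewrite !patchE indicE /on_graph.
  by case: (y \in _); rewrite ?normr0 ?mulr0// mulr1 normrM.
have nE (u : 'rV[R]_n -> R) : L2 (leb n) u -> L2 (leb n) (fun y => `|u y|) /\ nrm2 (leb n) (fun y => `|u y|) = nrm2 (leb n) u.
  move=> Lu; have Lu' : L2 (leb n) (fun y => `|u y|).
    apply: (L2_le (c := 1) _ Lu) => [|y]; first by apply: measurableT_comp => //; exact: L2_mfun Lu.
    by rewrite normr_id mul1r.
  by split => //; apply/eqP; rewrite eq_le; apply/andP; split; apply: nrm2_le => // y; rewrite normr_id.
have [L1 n1] := nE _ (graph_L2 (sv j)); have [L2' n2] := nE _ LF.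
have := ip2_CS L1 L2'; rewrite n1 n2 -/b => /(le_trans (ler_norm _)) cs.
move: hj cs; set x := nrm2 _ _; set I := ip2 _ _ _ => hj cs.
have x0 : 0 <= x by exact: nrm2_ge0.
have := ler_wpM2l C0 cs; have : C * (x * b) = x * (C * b + 1) - x by ring.
lra.
Qed.

End graph.

Lemma good_ball p : closure Om p -> exists r : R, [/\ 0 < r, no_flux p r & inward p r].
Proof.
move=> cp; have [op|nop] := pselect (Om p).
  have [r r0 hr] := interior_ball op.
  exists (r / 2); split; first by rewrite divr_gt0.
    by apply: no_flux_interior => x xp; apply: hr; lra.
  (* At an interior point the distinguished direction may be 0: short steps in every direction of
     norm at most 1 stay in Om. *)
  exists 0, 1, (r / 2); split; rewrite ?divr_gt0// => x _ xp e /andP[e0 e1] z.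
  rewrite subr0 => z1; apply: hr; rewrite addrAC; apply: le_trans (ler_normD _ _) _.
  by rewrite normrZ (gtr0_norm e0); nra.
have [k [t [y [kL ht hy pE]]]] := domain_lipschitz dOm (conj cp nop).
have cyl : in_cyl k p by rewrite pE /in_cyl (chart_t_pt kL) (chart_y_pt kL).
have [r1 r10 h1] := no_flux_chart kL cyl.
have [r2 [d [rho [e0 [r20 rho0 e00 h2]]]]] := chart_cone kL cyl.
exists (minr r1 r2); split; first by rewrite lt_min r10.
  move=> v vt F i tF sF; apply: h1 => // x /sF; rewrite le_min => /andP[]//.
exists d, rho, e0; split => // x cx; rewrite le_min => /andP[_ xr]; exact: h2.
Qed.

Lemma restrictB (f g : 'rV[R]_n.+1 -> R) : (f \- g) \_ Om = fun x => (f \_ Om) x - (g \_ Om) x.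
Proof. by apply/funext => x; rewrite !restrictE /= mulrBr. Qed.

Lemma is_weak_partialB i f g f' g' : LpF Om 2%:E f -> LpF Om 2%:E g ->
  LpF Om 2%:E f' -> LpF Om 2%:E g' -> is_weak_partial Om i f f' ->
  is_weak_partial Om i g g' -> is_weak_partial Om i (f \- g) (f' \- g').
Proof.
move=> /LpF2E Lf /LpF2E Lg /LpF2E Lf' /LpF2E Lg' /is_weak_partialE wf /is_weak_partialE wg.
apply/is_weak_partialE => phi hp; have tp := tf_in_tf hp.
have E u v psi : L2 mu (u \_ Om) -> L2 mu (v \_ Om) -> is_tf psi ->
    \int[mu]_x (((u \- v) \_ Om) x * psi x) =
    \int[mu]_x ((u \_ Om) x * psi x) - \int[mu]_x ((v \_ Om) x * psi x).
  move=> Lu Lv ts; rewrite -RintegralB//; [|exact: tf_mul_itg|exact: tf_mul_itg].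
  by apply: eq_Rintegral => x _; rewrite restrictB mulrBl.
rewrite !E//; last exact: tf_partial.
by rewrite wf// wg// opprD.
Qed.

(** Unfolds the convergence in [W12norm] into real L^2 norms, with the classical derivatives of the
    smooth v_j in place of the chosen weak ones. *)
Lemma trace_approx f : W012 Om f -> exists2 v, vanishing_trace v & forall e : R, 0 < e ->
  exists N, forall j, (N <= j)%N -> nrm2 mu ((v j \- f) \_ Om) <= e /\
    forall i, nrm2 mu ((partial i (v j) \- wpartial Om i f) \_ Om) <= e.
Proof.
move=> [Wf [_ [v [sv cv tv]]]].
exists v.
  split => // k kL; have := tv k kL.
  by rewrite (_ : (fun j => _) = fun j => L2norm (chart_base k) (on_graph k (v j)))//; apply/funext => j;
    congr (L2norm _ (on_graph _ _)); apply/funext => x /=; rewrite subr0.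
have Lf : L2 mu (f \_ Om) by apply/LpF2E; case: Wf.
have Lv j : L2 mu (v j \_ Om) by apply: smooth_restrict_L2 => //; exact: domain_bounded dOm.
have Ldv j i : L2 mu (partial i (v j) \_ Om).
  by apply: smooth_restrict_L2 => //; [exact: domain_bounded dOm|exact: smooth_partial].
have wf i := wpartialP i Wf.
have Lg i : L2 mu (wpartial Om i f \_ Om) by apply/LpF2E; case: (wf i).
have Lvf j : L2 mu ((v j \- f) \_ Om) by rewrite restrictB; exact: L2B.
have Ldg j i : L2 mu ((partial i (v j) \- wpartial Om i f) \_ Om) by rewrite restrictB; exact: L2B.
have wvf j i : is_weak_partial Om i (v j \- f) (partial i (v j) \- wpartial Om i f).
  apply: is_weak_partialB; try exact/LpF2E.
    by apply: smooth_is_weak_partial.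
  by case: (wf i).
have NE j : W12norm Om (v j \- f) = (nrm2 mu ((v j \- f) \_ Om) +
    \sum_i nrm2 mu ((partial i (v j) \- wpartial Om i f) \_ Om))%:E.
  by apply: W12normE => //; [exact/LpF2E|move=> i; exact/LpF2E].
move=> e e0; move: cv; rewrite (_ : (fun j => _) = fun j => (nrm2 mu ((v j \- f) \_ Om) +
    \sum_i nrm2 mu ((partial i (v j) \- wpartial Om i f) \_ Om))%:E); last first.
  by apply/funext => j; exact: NE.
move=> /cvg_EFin0/(_ e e0)[N hN]; exists N => j /hN.
have s0 : 0 <= \sum_i nrm2 mu ((partial i (v j) \- wpartial Om i f) \_ Om).
  by apply: sumr_ge0 => i _; exact: nrm2_ge0.
have a0 : 0 <= nrm2 mu ((v j \- f) \_ Om) by exact: nrm2_ge0.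
rewrite ger0_norm ?addr_ge0// => lt; split; first by lra.
move=> i; move: lt; rewrite (bigD1 i)//=.
have : 0 <= \sum_(l | l != i) nrm2 mu ((partial l (v j) \- wpartial Om l f) \_ Om).
  by apply: sumr_ge0 => l _; exact: nrm2_ge0.
lra.
Qed.

(** The defect of integration by parts over Om; formally the boundary integral of f F times the i-th
    component of the normal. *)
Definition flux (f : 'rV[R]_n.+1 -> R) i (F : 'rV[R]_n.+1 -> R) : R :=
  \int[mu]_x ((f \_ Om) x * partial i F x + (wpartial Om i f \_ Om) x * F x).

(** For a smooth v_j the flux is the integral of the i-th derivative of v_j F over Om, which
    [no_flux] sends to 0; convergence in W^{1,2} carries this over to f. *)
Lemma flux_ball f p r i F : W012 Om f -> no_flux p r -> is_tf F ->
  (forall x, F x != 0 -> `|x - p| <= r) -> flux f i F = 0.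
Proof.
move=> Wf nf tF sF; have [v vt hv] := trace_approx Wf; have [sv _] := vt.
have Lf : L2 mu (f \_ Om) by apply/LpF2E; case: Wf => -[].
have Lg : L2 mu (wpartial Om i f \_ Om) by apply/LpF2E; case: (wpartialP i (proj1 Wf)).
have Lv j : L2 mu (v j \_ Om) by apply: smooth_restrict_L2 => //; exact: domain_bounded dOm.
have Ldv j : L2 mu (partial i (v j) \_ Om).
  by apply: smooth_restrict_L2 => //; [exact: domain_bounded dOm|exact: smooth_partial].
have tdF := tf_partial i tF.
have NF := nrm2_ge0 mu F; have NdF := nrm2_ge0 mu (partial i F).
apply/eqP; rewrite -normr_le0; apply/ler_addgt0Pr => e e0; rewrite add0r.
have c0 : 0 < 1 + nrm2 mu F + nrm2 mu (partial i F) by lra.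
have e1 : 0 < e / (1 + nrm2 mu F + nrm2 mu (partial i F)) by rewrite divr_gt0.
set e' := e / _ in e1.
have [N1 h1] := hv _ e1; have [N2 h2] := nf v vt F i tF sF _ e1.
pose j := maxn N1 N2.
have [a1 /(_ i) a2] := h1 j (leq_maxl _ _); have a3 := h2 j (leq_maxr _ _).
have Lvf : L2 mu ((v j \- f) \_ Om) by rewrite restrictB; exact: L2B.
have Ldg : L2 mu ((partial i (v j) \- wpartial Om i f) \_ Om) by rewrite restrictB; exact: L2B.
have fE : flux f i F = \int[mu]_x (\1_Om x * partial i (fun x => v j x * F x) x) -
    ip2 mu ((v j \- f) \_ Om) (partial i F) -
    ip2 mu ((partial i (v j) \- wpartial Om i f) \_ Om) F.
  have iG : itg mu (fun x => \1_Om x * partial i (fun x => v j x * F x) x).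
    by apply: itg_ind => //; apply: tf_itg; apply: tf_partial; exact: tfM.
  have i1 : itg mu (fun x => ((v j \- f) \_ Om) x * partial i F x) by exact: tf_mul_itg.
  have i2 : itg mu (fun x => ((partial i (v j) \- wpartial Om i f) \_ Om) x * F x) by exact: tf_mul_itg.
  rewrite /ip2 -RintegralB// -RintegralB//; last exact: itgB.
  apply: eq_Rintegral => x _; rewrite partialM; [|by move=> y; exact: smooth_differentiable|
    by move=> y; apply: smooth_differentiable; exact: tf_smooth tF].
  by rewrite !restrictE /=; ring.
have b1 := ip2_CS Lvf (tf_L2 tdF); have b2 := ip2_CS Ldg (tf_L2 tF).
have c1 := ler_wpM2r NdF a1; have c2 := ler_wpM2r NF a2.
rewrite fE; apply: le_trans (ler_normB _ _) _.
apply: le_trans (lerD (le_trans (ler_normB _ _) (lerD a3 (le_trans b1 c1))) (le_trans b2 c2)) _.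
rewrite le_eqVlt; apply/orP; left; apply/eqP.
rewrite -[RHS](@divfK _ (1 + nrm2 mu F + nrm2 mu (partial i F))) ?gt_eqF// -/e'.
by rewrite 2!mulrDr mulr1 addrAC.
Qed.

Lemma cutoff (p : 'rV[R]_n.+1) (r : R) : 0 < r -> exists chi : 'rV[R]_n.+1 -> R,
  [/\ is_tf chi, forall x : 'rV[R]_n.+1, `|x - p| <= r / 2 -> chi x = 1 &
      forall x : 'rV[R]_n.+1, chi x != 0 -> `|x - p| <= r].
Proof.
move=> r0; have r2 : 0 < r / 2 by rewrite divr_gt0.
exists (plateau (p - const_mx (r / 2)) (p + const_mx (r / 2)) (r / 2)); split.
- exact: plateau_tf.
- move=> x xp; apply: plateau_eq1 => // i; have := le_trans (rV_coord_le (x - p) i) xp.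
  by rewrite !mxE ler_norml => /andP[h1 h2]; apply/andP; split; lra.
- move=> x /(plateau_neq0 r2) h; apply/rV_norm_le => [|i]; first exact: ltW.
  have := h i; rewrite !mxE ler_norml => /andP[h1 h2]; apply/andP; split; lra.
Qed.

(** The partition of unity is obtained by peeling off one ball at a time: F chi lives in the first
    ball and has no flux, while F - F chi vanishes on the half ball, so the remaining half balls
    cover the points of Om where it is nonzero. *)
Lemma W012_extension f i F : W012 Om f -> is_tf F ->
  \int[mu]_x ((f \_ Om) x * partial i F x) = - \int[mu]_x ((wpartial Om i f \_ Om) x * F x).
Proof.
move=> Wf tF.
have Lf : L2 mu (f \_ Om) by apply/LpF2E; case: Wf => -[].
have Lg : L2 mu (wpartial Om i f \_ Om) by apply/LpF2E; case: (wpartialP i (proj1 Wf)).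
suff : flux f i F = 0.
  rewrite /flux RintegralD//; [|by apply: tf_mul_itg => //; exact: tf_partial|exact: tf_mul_itg].
  by move/eqP; rewrite addr_eq0 => /eqP.
have /choice[r hr] : forall p, exists r : R, closure Om p -> 0 < r /\ no_flux p r.
  move=> p; have [cp|] := pselect (closure Om p); last by exists 0.
  by have [r [r0 nf _]] := good_ball cp; exists r.
have [|s sO hs] := finite_ball_cover (r := fun p => r p / 2) closure_compact.
  by move=> p /hr[r0 _]; rewrite divr_gt0.
have : forall x, Om x -> F x != 0 -> exists2 p, p \in s & `|x - p| < r p / 2.
  by move=> x /subset_closure/hs.
elim: s sO {hs} F tF => [_ F tF hF|p s IH sO F tF hF].
  have F0 x : F x != 0 -> (~` Om) x by move=> Fx ox; have [] := hF x ox Fx.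
  rewrite /flux -[RHS](@Rintegral0 _ _ _ mu); apply: eq_Rintegral => x _; rewrite !restrictE indicE.
  have [ox|ox] := pselect (Om x); last by rewrite memNset// !mul0r addr0.
  have -> : F x = 0 by apply/eqP/negPn/negP => /F0.
  have -> : partial i F x = 0.
    by apply/eqP/negPn/negP => /(partial_supp (open_closedC oOm) F0).
  by rewrite !mulr0 addr0.
have [r0 nf] := hr p (sO _ (mem_head _ _)).
have [chi [tchi chi1 chi0]] := cutoff p r0.
have t1 : is_tf (fun x => F x * chi x) by apply: tfM tchi; exact: tf_smooth.
have t2 : is_tf (fun x => F x + -1 * (F x * chi x)) by apply: tfD => //; exact: tfZ.
have -> : flux f i F = flux f i (fun x => F x * chi x) + flux f i (fun x => F x + -1 * (F x * chi x)).
  have i1 phi : is_tf phi -> itg mu (fun x => (f \_ Om) x * partial i phi x + (wpartial Om i f \_ Om) x * phi x).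
    by move=> tp; apply: itgD; apply: tf_mul_itg => //; exact: tf_partial.
  rewrite /flux -RintegralD//; [|exact: i1|exact: i1].
  have dif (phi : 'rV[R]_n.+1 -> R) : is_tf phi -> forall x, differentiable phi x.
    by move=> tp x; apply: smooth_differentiable; exact: tf_smooth tp.
  apply: eq_Rintegral => x _.
  rewrite (partialD i (dif _ tF) (dif _ (tfZ (-1) t1))) (partialZ _ _ (tf_smooth t1)).
  ring.
rewrite (flux_ball i Wf nf t1); last by move=> x; rewrite mulf_eq0 negb_or => /andP[_] /chi0.
rewrite add0r; apply: IH => //; first by move=> q qs; apply: sO; rewrite inE qs orbT.
move=> x ox; rewrite mulN1r -[X in X - _]mulr1 -mulrBr mulf_eq0 negb_or => /andP[Fx].
rewrite subr_eq0 => c1; have [q] := hF x ox Fx; rewrite inE => /predU1P[->|qs] qx; last by exists q.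
by move: c1; rewrite chi1 ?eqxx// ltW.
Qed.

End boundary.

(** * Density of test functions *)

Section density.
Context {R : realType} {n : nat}.
Notation mu := (@leb R n.+1).
Implicit Types (f u phi F : 'rV[R]_n.+1 -> R) (g : 'I_n.+1 -> 'rV[R]_n.+1 -> R).

(** On the whole space, against test functions that may be nonzero on the boundary of Om: the form
    in which [W012_extension] delivers the extension by zero. *)
Definition weak_gradient u g := [/\ L2 mu u, forall i, L2 mu (g i) &
  forall i F, is_tf F -> \int[mu]_x (u x * partial i F x) = - \int[mu]_x (g i x * F x)].

Definition tf_approximable (U : set 'rV[R]_n.+1) u g := forall e : R, 0 < e ->
  exists2 phi, tf_in U phi & nrm2 mu (fun x => phi x - u x) <= e /\
    forall i, nrm2 mu (fun x => partial i phi x - g i x) <= e.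

Lemma compact_sub (A B : set 'rV[R]_n.+1) : compact A -> compact B ->
  compact [set x | exists y z, [/\ A y, B z & x = y - z]].
Proof.
move=> cA cB.
have := @continuous_compact _ _ (fun p : 'rV[R]_n.+1 * 'rV[R]_n.+1 => p.1 - p.2) _ _ (compact_setX cA cB).
rewrite (_ : _ @` _ = [set x | exists y z, [/\ A y, B z & x = y - z]]); last first.
  apply/seteqP; split => x /=.
    by move=> [[y z] [/= Ay Bz] <-]; exists y, z.
  by move=> [y [z [Ay Bz ->]]]; exists (y, z).
apply; apply: continuous_subspaceT => p.
by apply: cvgB; [exact: cvg_fst|exact: cvg_snd].
Qed.

Lemma L2_bounded_supp_itg u r : L2 mu u -> (forall x, u x != 0 -> `|x| <= r) -> itg mu u.
Proof.
move=> [mu_ u2] hr; have ib := nball_itg (n := n) r 1.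
apply: itg_le (itgD u2 ib) _ => // x; have [->|u0] := eqVneq (u x) 0.
  by rewrite normr0 expr0n add0r mul1r.
rewrite indicE mem_set ?mulr1; last exact: hr.
rewrite ler_norml; nra.
Qed.

Variables (Om : set 'rV[R]_n.+1).
Hypothesis (bOm : compact (closure Om)).

Lemma moll_weak u g K i : weak_gradient u g -> itg mu u -> is_tf K ->
  partial i (moll K u) = moll K (g i).
Proof.
move=> [Lu Lg wg] iu tK; have [_ ->] := moll_diff iu tK; apply/funext => x.
have := wg i _ (tf_translate (- x) tK); rewrite partial_translate => E.
rewrite /moll -[RHS]opprK -E -RintegralN.
  by apply: eq_Rintegral => y _; ring.
by apply: tf_mul_itg => //; apply: tf_translate; exact: tf_partial.
Qed.

(* Shifting a function supported near a boundary point into the domain before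
   mollifying makes the mollification compactly supported there. *)
Lemma density_ball p r u g : inward Om p r -> weak_gradient u g ->
  (forall x, u x != 0 -> closure Om x /\ `|x - p| <= r) ->
  (forall i x, g i x != 0 -> closure Om x /\ `|x - p| <= r) ->
  tf_approximable Om u g.
Proof.
move=> [d [rho [e0 [rho0 e00 hcone]]]] wg su sg eps eps0.
have [Lu Lg wu] := wg.
have [M hM] : exists M : R, forall x, closure Om x -> `|x| <= M.
  by have [M [Mr h]] := compact_bounded bOm; exists (`|M| + 1) => x;
    apply: h; rewrite (le_lt_trans (ler_norm M))// ltrDl.
have iu : itg mu u by apply: (L2_bounded_supp_itg (r := M) Lu) => x /su[/hM].
have ig i : itg mu (g i) by apply: (L2_bounded_supp_itg (r := M) (Lg i)) => x /sg[/hM].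
have [du du0 hu] := translate_continuous Lu eps0.
have /choice[dg hg] : forall i, exists d : R, 0 < d /\
    forall v, `|v| <= d -> nrm2 mu (fun x => g i (x + v) - g i x) < eps.
  by move=> i; have [d' d'0 h] := translate_continuous (Lg i) eps0; exists d'.
pose del := \big[minr/du]_i dg i.
have del0 : 0 < del by apply: lt_bigmin => // i _; case: (hg i).
have delu : del <= du by exact: bigmin_le_id.
have delg i : del <= dg i by exact: bigmin_le_cond.
have dr : 0 < `|d| + rho by rewrite ltr_wpDl.
(* The first bound keeps the step within the range of the cone condition; the second keeps every
   translation used by the kernel shorter than del. *)
pose ep := minr (e0 / 2) (del / (`|d| + rho)).
have ep0 : 0 < ep by rewrite lt_min !divr_gt0.
have epe : ep < e0.
  have : ep <= e0 / 2 by rewrite ge_min lexx.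
  lra.
have epd : ep * (`|d| + rho) <= del by rewrite -ler_pdivlMr// ge_min lexx orbT.
(* [moll] samples u at x + z, so centring the kernel at - ep d moves the support by + ep d, into Om;
   the radius ep rho stays within the admissible ball of directions. *)
have [K [tK K0 K1 sK]] := moll_kernel (- (ep *: d)) (mulr_gt0 ep0 rho0).
have zd z : `|z + ep *: d| <= ep * rho -> `|z| <= del /\ `|- (ep^-1 *: z) - d| <= rho.
  move=> h; split.
    apply: le_trans epd; have := ler_normB (z + ep *: d) (ep *: d).
    by rewrite addrK (normrZ ep d) (gtr0_norm ep0) mulrDr; lra.
  have -> : - (ep^-1 *: z) - d = - (ep^-1 *: (z + ep *: d)).
    by rewrite scalerDr scalerA mulVf ?gt_eqF// scale1r opprD.
  by rewrite normrN normrZ gtr0_norm ?invr_gt0// ler_pdivrMl.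
have zK z : K z != 0 -> `|z + ep *: d| <= ep * rho by move=> /sK; rewrite opprK => /ltW.
have close f : L2 mu f -> itg mu f ->
    (forall v, `|v| <= del -> nrm2 mu (fun x => f (x + v) - f x) < eps) ->
    nrm2 mu (fun x => moll K f x - f x) <= eps.
  move=> Lf jf hf; have [|z /zK/zd[zdel _]|//] := moll_nrm2 Lf jf tK K0 K1 (e := eps); first exact: ltW.
  by apply: ltW; exact: hf.
exists (moll K u); last first.
  split; first by apply: close => // v vd; apply: hu; exact: le_trans delu.
  move=> i; rewrite (moll_weak i wg)//; apply: close => // v vd.
  by have [_] := hg i; apply; exact: le_trans (delg i).
split; first exact: moll_smooth.
pose S := closure Om `&` [set x | `|x - p| <= r].
pose B := [set z : 'rV[R]_n.+1 | `|z - (- (ep *: d))| <= ep * rho].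
have cS : compact S by apply: compact_closedI => //; exact: closed_norm_le.
have cB : compact B.
  apply: bounded_closed_compact; last exact: closed_norm_le.
  exists del; split; first exact: num_real.
  move=> x dx z; rewrite /B/= opprK => /zd[zdel _]; exact: le_trans (ltW dx).
exists [set x | exists y z, [/\ S y, B z & x = y - z]].
  split; first exact: compact_sub.
  move=> x [y [z [[cy yp]]]]; rewrite /B/= opprK => /zd[_ zd'] ->.
  have -> : y - z = y + ep *: (- (ep^-1 *: z)) by rewrite scalerN scalerA mulfV ?gt_eqF// scale1r.
  by apply: hcone => //; rewrite ep0.
move=> x /moll_supp[z [Kz uz]]; exists (x + z), z; split.
- by have [] := su _ uz.
- by rewrite /B/= opprK; exact: zK.
- by rewrite addrK.
Qed.

Lemma tf_inD U phi psi : tf_in U phi -> tf_in U psi -> tf_in U (fun x => phi x + psi x).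
Proof.
move=> [sp [K [cK KU] hK]] [sq [L [cL LU] hL]]; split; first exact: smoothD.
exists (K `|` L); first by split; [exact: compactU|move=> x [/KU|/LU]].
move=> x; have [->|/hK] := eqVneq (phi x) 0; last by left.
by rewrite add0r => /hL; right.
Qed.

Lemma tf_in0 (U : set 'rV[R]_n.+1) : tf_in U (fun=> 0 : R).
Proof.
split; first exact: smooth_cst.
by exists set0; [split; [exact: compact0|exact: sub0set]|move=> x; rewrite eqxx].
Qed.

Lemma tf_approximableD U u u' g g' : weak_gradient u g -> weak_gradient u' g' ->
  tf_approximable U u g -> tf_approximable U u' g' ->
  tf_approximable U (fun x => u x + u' x) (fun i x => g i x + g' i x).
Proof.
move=> [Lu Lg _] [Lu' Lg' _] au au' e e0; have e2 : 0 < e / 2 by rewrite divr_gt0.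
have [phi hp [p1 p2]] := au _ e2; have [psi hq [q1 q2]] := au' _ e2.
have tp := tf_in_tf hp; have tq := tf_in_tf hq.
have key (a b f h : 'rV[R]_n.+1 -> R) : L2 mu a -> L2 mu b -> L2 mu f -> L2 mu h ->
    nrm2 mu (fun x => f x - a x) <= e / 2 -> nrm2 mu (fun x => h x - b x) <= e / 2 ->
    nrm2 mu (fun x => f x + h x - (a x + b x)) <= e.
  move=> La Lb Lf Lh h1 h2.
  have -> : (fun x => f x + h x - (a x + b x)) = fun x => (f x - a x) + (h x - b x).
    by apply/funext => x; ring.
  by apply: le_trans (nrm2D (L2B Lf La) (L2B Lh Lb)) _; rewrite (splitr e); exact: lerD.
exists (fun x => phi x + psi x); first exact: tf_inD.
split; first by apply: key => //; exact: tf_L2.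
move=> i; rewrite partialD; [|by move=> x; exact/smooth_differentiable/tf_smooth|by move=> x; exact/smooth_differentiable/tf_smooth].
by apply: key => //; apply: tf_L2; exact: tf_partial.
Qed.

Lemma weak_gradientB u u' g g' : weak_gradient u g -> weak_gradient u' g' ->
  weak_gradient (fun x => u x - u' x) (fun i x => g i x - g' i x).
Proof.
move=> [Lu Lg wg] [Lu' Lg' wg']; split=> [|i|i F tF]; try exact: L2B.
have E (a b f : 'rV[R]_n.+1 -> R) : L2 mu a -> L2 mu b -> is_tf f ->
    \int[mu]_x ((a x - b x) * f x) = \int[mu]_x (a x * f x) - \int[mu]_x (b x * f x).
  move=> La Lb tf; rewrite -RintegralB//; [|exact: tf_mul_itg|exact: tf_mul_itg].
  by apply: eq_Rintegral => x _; rewrite mulrBl.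
rewrite !E//; last exact: tf_partial.
by rewrite wg// wg'// opprD.
Qed.

Lemma weak_gradient_cut u g chi : weak_gradient u g -> is_tf chi ->
  weak_gradient (fun x => u x * chi x) (fun i x => g i x * chi x + u x * partial i chi x).
Proof.
move=> [Lu Lg wg] tc; split=> [|i|i F tF].
- exact: tf_mul_bounded_L2.
- by apply: L2D; apply: tf_mul_bounded_L2 => //; exact: tf_partial.
have tcF := tfM (tf_smooth tc) tF; have tdF := tf_partial i tF; have tdc := tf_partial i tc.
have := wg i _ tcF; rewrite partialM; [|by move=> x; exact/smooth_differentiable/tf_smooth|by move=> x; exact/smooth_differentiable/tf_smooth].
have i1 : itg mu (fun x => u x * chi x * partial i F x).
  by apply: tf_mul_itg => //; exact: tf_mul_bounded_L2.
have i2 : itg mu (fun x => u x * partial i chi x * F x).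
  by apply: tf_mul_itg => //; exact: tf_mul_bounded_L2.
have i3 : itg mu (fun x => g i x * chi x * F x).
  by apply: tf_mul_itg => //; exact: tf_mul_bounded_L2.
have -> : \int[mu]_x (u x * (chi x * partial i F x + F x * partial i chi x)) =
    \int[mu]_x (u x * chi x * partial i F x) + \int[mu]_x (u x * partial i chi x * F x).
  by rewrite -RintegralD//; apply: eq_Rintegral => x _; ring.
have -> : \int[mu]_x ((g i x * chi x + u x * partial i chi x) * F x) =
    \int[mu]_x (g i x * chi x * F x) + \int[mu]_x (u x * partial i chi x * F x).
  by rewrite -RintegralD//; apply: eq_Rintegral => x _; ring.
have -> : \int[mu]_x (g i x * (chi x * F x)) = \int[mu]_x (g i x * chi x * F x).
  by apply: eq_Rintegral => x _; rewrite mulrA.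
by move/eqP; rewrite eq_sym -subr_eq => /eqP <-; rewrite opprD.
Qed.

Lemma partial_locally_cst (c : R) f p r i x : (forall y, `|y - p| < r -> f y = c) ->
  `|x - p| < r -> partial i f x = 0.
Proof.
move=> fc xr; rewrite /partial -(derive_cst c x (delta_mx ord0 i)).
apply: near_eq_derive.
have : \forall y \near x, ball x (r - `|x - p|) y by apply: nbhsx_ballx; rewrite subr_gt0.
apply: filterS => y; rewrite mx_norm_ball /ball_/= distrC => h; apply: fc.
by have := ler_normD (y - x) (x - p); rewrite addrA subrK; lra.
Qed.

Lemma tf_density u g : bounded_lipschitz_domain Om -> weak_gradient u g ->
  (forall x, u x != 0 -> Om x) -> (forall i x, g i x != 0 -> Om x) ->
  tf_approximable Om u g.
Proof.
move=> dOm.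
have /choice[r hr] : forall p, exists r : R, closure Om p -> 0 < r /\ inward Om p r.
  move=> p; have [cp|] := pselect (closure Om p); last by exists 0.
  by have [r [r0 _ ip]] := good_ball dOm cp; exists r.
have [|s sO hs] := finite_ball_cover (r := fun p => r p / 2) bOm.
  by move=> p /hr[r0 _]; rewrite divr_gt0.
move=> wg uO gO.
(* Tracked for u and for its gradient: the gradient of u - u chi also vanishes on the half ball,
   since chi is constantly 1 there. *)
pose covered (s : seq 'rV[R]_n.+1) f := forall x, f x != 0 ->
  closure Om x /\ exists2 p, p \in s & `|x - p| < r p / 2.
have {uO} : covered s u by move=> x /uO/subset_closure ox; split => //; exact: hs.
have {gO} : forall i, covered s (g i) by move=> i x /gO/subset_closure ox; split => //; exact: hs.
elim: s sO {hs} u g wg => [_ u g wg hg hu e e0|p s IH sO u g wg hg hu].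
  have u0 : u = fun=> 0 by apply/funext => x; apply/eqP/negPn/negP => /hu[_ []].
  have g0 i : g i = fun=> 0 by apply/funext => x; apply/eqP/negPn/negP => /hg[_ []].
  have z0 : (fun _ : 'rV[R]_n.+1 => 0 - 0 : R) = fun=> 0 by apply/funext => x; rewrite subrr.
  exists (fun=> 0); first exact: tf_in0.
  split=> [|i]; first by rewrite u0 z0 nrm20 ltW.
  have -> : partial i (fun=> 0) = (fun=> 0) :> ('rV[R]_n.+1 -> R).
    by apply/funext => x; rewrite /partial derive_cst.
  by rewrite g0 z0 nrm20 ltW.
have [r0 ip] := hr p (sO _ (mem_head _ _)).
have [chi [tchi chi1 chi0]] := cutoff p r0.
have dchi0 i x : partial i chi x != 0 -> `|x - p| <= r p.
  exact: (partial_supp (@closed_norm_le _ _ p (r p)) chi0).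
have wc := weak_gradient_cut wg tchi.
have wd := weak_gradientB wg wc.
have uE : (fun x => u x * chi x + (u x - u x * chi x)) = u.
  by apply/funext => x; rewrite addrC subrK.
have gE : (fun i x => g i x * chi x + u x * partial i chi x +
    (g i x - (g i x * chi x + u x * partial i chi x))) = g.
  by apply/funext => i; apply/funext => x; rewrite addrC subrK.
have := tf_approximableD wc wd; rewrite uE gE.
apply.
  apply: (density_ball ip wc) => [x|i x].
    by rewrite mulf_eq0 negb_or => /andP[/hu[ox _] /chi0].
  have [->|/hu[ox _]] := eqVneq (u x) 0.
    by rewrite mul0r addr0 mulf_eq0 negb_or => /andP[/hg[ox _] /chi0].
  move=> h; split => //; have [|/chi0//] := eqVneq (chi x) 0 => c0.
  by move: h; rewrite c0 mulr0 add0r mulf_eq0 negb_or => /andP[_ /dchi0].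
have step (f : 'rV[R]_n.+1 -> R) x : (`|x - p| < r p / 2 -> f x = 0) ->
    closure Om x /\ (exists2 q, q \in p :: s & `|x - q| < r q / 2) -> f x != 0 ->
    closure Om x /\ exists2 q, q \in s & `|x - q| < r q / 2.
  move=> f0 [ox [q]]; rewrite inE => /predU1P[->|qs] qx fx; last by split => //; exists q.
  by rewrite f0 ?eqxx in fx.
apply: IH wd _ _ => [q qs|i x h|x h].
- by apply: sO; rewrite inE qs orbT.
- apply: (step (fun x => g i x - (g i x * chi x + u x * partial i chi x))) => // [xp|].
    rewrite chi1 ?(ltW xp)// (partial_locally_cst (c := 1) (p := p) (r := r p / 2))//.
      by rewrite mulr1 mulr0 addr0 subrr.
    by move=> y /ltW/chi1.
  have [u0|/hu//] := eqVneq (u x) 0; apply: (hg i).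
  by apply: contraNneq h => g0; rewrite u0 g0 !mul0r addr0 subrr.
- apply: (step (fun x => u x - u x * chi x)) => // [xp|].
    by rewrite chi1 ?(ltW xp)// mulr1 subrr.
  by apply: hu; apply: contraNneq h => u0; rewrite u0 mul0r subrr.
Qed.

End density.

(** * The adjoint operator *)

Section dominated.
Context {R : realType} {n : nat}.
Notation mu := (@leb R n.+1).
Local Notation Cl := (clifford R n.+1).
Implicit Types (u v w a : 'rV[R]_n.+1 -> Cl) (A B : {set 'I_n.+1}).

Lemma nrm2_le_ae (f g : 'rV[R]_n.+1 -> R) : L2 mu f -> L2 mu g ->
  {ae mu, forall x, `|f x| <= `|g x|} -> nrm2 mu f <= nrm2 mu g.
Proof.
(* h agrees with |f| almost everywhere and lies below |g| at every point. *)
move=> Lf Lg fg; pose h x := minr `|f x| `|g x|.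
have mf := L2_mfun Lf; have mg := L2_mfun Lg.
have mh : measurable_fun setT h by apply: measurable_minr; exact: measurableT_comp.
have h0 x : 0 <= h x by rewrite le_min !normr_ge0.
have Lh : L2 mu h.
  by apply: (L2_le (c := 1) mh Lg) => x; rewrite mul1r ger0_norm// ge_min lexx orbT.
have Lf' : L2 mu (fun x => `|f x|).
  by apply: (L2_le (c := 1) _ Lf) => [|x]; [exact: measurableT_comp|rewrite normr_id mul1r].
apply: le_trans (_ : nrm2 mu (fun x => `|f x|) <= _).
  by apply: nrm2_le => // x; rewrite normr_id.
rewrite (@nrm2_ae _ _ _ mu _ h); [|exact: L2_mfun Lf'|done|].
  by apply: nrm2_le => // x; rewrite ger0_norm// ge_min lexx orbT.
by apply: filterS fg => x fgx _; apply/esym/min_idPl.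
Qed.

Lemma L2c_dom w v (c : R) : 0 <= c -> L2c w -> (forall A, measurable_fun setT (coef A v)) ->
  {ae mu, forall x, forall A, `|v x A| <= c * \sum_B `|w x B|} ->
  L2c v /\ nrmc v <= #|{set 'I_n.+1}|%:R * (c * \sum_B nrm2 mu (coef B w)).
Proof.
move=> c0 Lw mv vw; pose h x : R := c * \sum_B `|coef B w x|.
have Ln B : L2 mu (fun x => `|coef B w x|).
  by apply: (L2_le (c := 1) _ (Lw B)) => [|x];
    [by apply: measurableT_comp => //; exact: L2_mfun (Lw B)|rewrite normr_id mul1r].
have Ls : L2 mu (fun x => \sum_B `|coef B w x|) by exact: L2_sum.
have Lh : L2 mu h by exact: L2Z.
have h0 x : 0 <= h x by rewrite mulr_ge0// sumr_ge0.
have vh A : {ae mu, forall x, `|coef A v x| <= `|h x|}.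
  by apply: filterS vw => x /(_ A); rewrite (ger0_norm (h0 x)).
have Lv : L2c v.
  move=> A; apply: (L2_le_ae (c := 1) (mv A) Lh).
  by apply: filterS (vh A) => x; rewrite mul1r.
split=> //; apply: le_trans (nrmc_le_sum _) _; rewrite mulr_natl -sumr_const.
apply: ler_sum => A _; apply: le_trans (nrm2_le_ae (Lv A) Lh (vh A)) _.
rewrite /h nrm2Z// ger0_norm// ler_wpM2l//.
have /le_trans := @nrm2_sum _ _ _ mu _ (index_enum _) xpredT (fun B x => `|coef B w x|) (fun B _ => Ln B).
apply; apply: ler_sum => B _.
by apply: nrm2_le => // x; rewrite normr_id.
Qed.

Definition bddc a (m : R) := [/\ 0 <= m, forall A, measurable_fun setT (coef A a) &
  {ae mu, forall x, forall A, `|a x A| <= m}].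

Lemma measurable_clmul u v : (forall A, measurable_fun setT (coef A u)) ->
  (forall A, measurable_fun setT (coef A v)) ->
  forall A, measurable_fun setT (coef A (fun x => u x * v x)).
Proof.
move=> mu_ mv A; rewrite (_ : coef A _ = fun x => \sum_B \sum_C
    (-1) ^+ blade_exp B C * coef B u x * coef C v x * (A == symd B C)%:R); last first.
  by apply/funext => x; rewrite /coef clmul_coef.
apply: measurable_sum => B; apply: measurable_sum => C.
by apply: measurable_funM => //; apply: measurable_funM => //; exact: measurable_funM.
Qed.

Lemma measurable_clconj u : (forall A, measurable_fun setT (coef A u)) ->
  forall A, measurable_fun setT (coef A (fun x => clconj (u x))).
Proof.
move=> mu_ A; rewrite (_ : coef A _ = fun x => (-1) ^+ 'C(#|A|.+1, 2) * coef A u x).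
  exact: measurable_funM.
by apply/funext => x; rewrite /coef ffunE.
Qed.

Lemma L2c_conj u : L2c u -> L2c (fun x => clconj (u x)).
Proof.
move=> Lu A; rewrite (_ : coef A _ = fun x => (-1) ^+ 'C(#|A|.+1, 2) * coef A u x).
  exact: L2Z.
by apply/funext => x; rewrite /coef ffunE.
Qed.

Lemma bddc_conj a m : bddc a m -> bddc (fun x => clconj (a x)) m.
Proof.
move=> [m0 ma am]; split=> //; first exact: measurable_clconj.
by apply: filterS am => x h A; rewrite clconj_norm.
Qed.

Lemma bddc_mulr a m : bddc a m -> exists2 C : R, 0 <= C & forall w, L2c w ->
  L2c (fun x => w x * a x) /\ nrmc (fun x => w x * a x) <= C * \sum_B nrm2 mu (coef B w).
Proof.
move=> [m0 ma am]; set N : R := #|{set 'I_n.+1}|%:R.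
exists (N * (N * m)) => [|w Lw]; first by rewrite !mulr_ge0.
rewrite -(mulrA N); apply: L2c_dom => //; first by rewrite mulr_ge0.
  by apply: measurable_clmul => // A; exact: L2_mfun (Lw A).
apply: filterS am => x h A; apply: le_trans (clmul_bound _ _ _) _.
rewrite mulr_sumr; apply: ler_sum => B _; rewrite -mulr_sumr mulrC ler_wpM2r//.
by rewrite mulr_natl -sumr_const; apply: ler_sum => C _.
Qed.

Lemma bddc_mull a m : bddc a m -> exists2 C : R, 0 <= C & forall w, L2c w ->
  L2c (fun x => a x * w x) /\ nrmc (fun x => a x * w x) <= C * \sum_B nrm2 mu (coef B w).
Proof.
move=> [m0 ma am]; set N : R := #|{set 'I_n.+1}|%:R.
exists (N * (N * m)) => [|w Lw]; first by rewrite !mulr_ge0.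
rewrite -(mulrA N); apply: L2c_dom => //; first by rewrite mulr_ge0.
  by apply: measurable_clmul => // A; exact: L2_mfun (Lw A).
apply: filterS am => x h A; apply: le_trans (clmul_bound _ _ _) _.
rewrite exchange_big mulr_sumr; apply: ler_sum => B _; rewrite -mulr_suml ler_wpM2r//.
by rewrite mulr_natl -sumr_const; apply: ler_sum => C _.
Qed.

Lemma nrm2_conj u A : nrm2 mu (coef A (fun x => clconj (u x))) = nrm2 mu (coef A u).
Proof.
rewrite /nrm2 /nrm /ip2; congr Num.sqrt; apply: eq_Rintegral => x _.
rewrite /coef ffunE mulrACA -expr2 sqrr_sign mul1r//.
Qed.

End dominated.

(** * Extension by zero of Clifford-valued functions *)

Section extension_by_zero.
Context {R : realType} {n : nat}.
Notation mu := (@leb R n.+1).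
Local Notation Cl := (clifford R n.+1).
Variable Om : set 'rV[R]_n.+1.
Hypothesis oOm : open Om.
Implicit Types (u v w a : 'rV[R]_n.+1 -> Cl) (A B : {set 'I_n.+1}).

Definition ext w : 'rV[R]_n.+1 -> Cl := fun x => (\1_Om x : R) *: w x.

Lemma coef_ext A w : coef A (ext w) = coef A w \_ Om.
Proof. by apply/funext => x; rewrite restrictE /coef /ext ffunE. Qed.

Lemma ext_in w x : Om x -> ext w x = w x.
Proof. by move=> ox; rewrite /ext indicE mem_set// scale1r. Qed.

Lemma ext_out w x : ~ Om x -> ext w x = 0.
Proof. by move=> ox; rewrite /ext indicE memNset// scale0r. Qed.

Lemma extM u v x : ext (fun x => u x * v x) x = ext u x * ext v x.
Proof.
have [ox|ox] := pselect (Om x); first by rewrite !ext_in.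
by rewrite !ext_out// mul0r.
Qed.

Lemma ext_conj u x : ext (fun x => clconj (u x)) x = clconj (ext u x).
Proof. by rewrite /ext linearZ. Qed.

Lemma clLp2E w : clLp Om 2%:E w <-> L2c (ext w).
Proof. by split=> h A; [rewrite coef_ext; apply/LpF2E|apply/LpF2E; rewrite -coef_ext]. Qed.

Lemma ipE u v : clLp Om 2%:E u -> clLp Om 2%:E v -> ip Om u v = ipc (ext u) (ext v).
Proof.
move=> /clLp2E Lu /clLp2E Lv; rewrite ipcE// /ip /clSc ffunE Rintegral_mkcond.
apply: eq_Rintegral => x _; rewrite restrictE -ext_conj -extM /coef /ext ffunE.
by rewrite /GRing.scale/=.
Qed.

(** Selects the essential supremum in the norm for p = +oo, whose definition treats the zero measure
    apart. *)
Lemma leb_gt0 : (0 < mu setT)%E.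
Proof.
apply: (@lt_le_trans _ _ (mu (cube 1))).
  by rewrite leb_cube// lte_fin exprn_gt0.
by apply: le_measure; rewrite ?inE//; exact: cube_measurable.
Qed.

Lemma clLp_bddc a : clLp Om +oo%E a -> exists m, bddc (ext a) m.
Proof.
move=> La.
have /choice[m hm] : forall A, exists m : R, {ae mu, forall x, `|coef A (ext a) x| <= m}.
  move=> A; rewrite coef_ext; have := La A; rewrite /LpF inE => /andP[_].
  rewrite inE /= /finite_norm unlock leb_gt0 => h.
  have [|m hm] := @ess_supr_bounded _ _ _ mu (fun x => `|(coef A a \_ Om) x|); first exact: h.
  by exists m.
exists (\sum_A `|m A|); split.
- by apply: sumr_ge0.
- by move=> A; rewrite coef_ext; have := La A; rewrite /LpF inE => /andP[]; rewrite inE.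
have : {ae mu, forall x, forall A, `|coef A (ext a) x| <= m A}.
  exact: ae_countable hm.
apply: filterS => x h A; apply: le_trans (h A) _; apply: le_trans (ler_norm _) _.
by rewrite (bigD1 A)//= lerDl sumr_ge0.
Qed.

End extension_by_zero.

(** * The operator T and its a priori estimate *)

Section adjoint_operator.
Context {R : realType} {n : nat}.
Notation mu := (@leb R n.+1).
Local Notation Cl := (clifford R n.+1).
Local Notation fn := ('rV[R]_n.+1 -> R).
Implicit Types (u v w phi : 'rV[R]_n.+1 -> Cl) (A B : {set 'I_n.+1}) (i : 'I_n.+1).
Implicit Types (g : 'I_n.+1 -> {set 'I_n.+1} -> 'rV[R]_n.+1 -> R).

(** D with an arbitrary family g in place of the derivatives, to be filled with classical or weak
    gradients. *)
Definition clgrad g : 'rV[R]_n.+1 -> Cl := fun x =>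
  \sum_i clgen i * [ffun A => g i A x].

Lemma nrmc_sum (I : Type) (s : seq I) (F : I -> 'rV[R]_n.+1 -> Cl) :
  (forall k, L2c (F k)) -> nrmc (fun x => \sum_(k <- s) F k x) <= \sum_(k <- s) nrmc (F k).
Proof.
move=> LF; elim: s => [|k s IH].
  rewrite big_nil (_ : (fun x => _) = 0); last by apply/funext => x; rewrite big_nil.
  by rewrite (seminorm0 L2c_subspace nrmc_seminorm).
rewrite big_cons (_ : (fun x => _) = F k + fun x => \sum_(j <- s) F j x); last first.
  by apply/funext => x; rewrite big_cons.
apply: le_trans (seminormD nrmc_seminorm (LF k) (L2c_sum s LF)) _.
by rewrite lerD2l.
Qed.

Lemma nrmc_gen i w : L2c w -> nrmc (fun x => clgen i * w x) = nrmc w.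
Proof.
move=> Lw; have Lg := L2c_mull (clgen i) Lw.
apply: (congr1 Num.sqrt); apply: etrans (ipcE Lg Lg) (etrans _ (esym (ipcE Lw Lw))).
by apply: eq_Rintegral => x _; exact: clSc_gen_same.
Qed.

Lemma clgrad_bound g : (forall i A, L2 mu (g i A)) ->
  L2c (clgrad g) /\ nrmc (clgrad g) <= \sum_i \sum_A nrm2 mu (g i A).
Proof.
move=> Lg; pose gi i x : Cl := [ffun A => g i A x].
have giE i A : coef A (gi i) = g i A by apply/funext => x; rewrite /coef ffunE.
have Lgi i : L2c (gi i) by move=> A; rewrite giE.
have Lgg i : L2c (fun x => clgen i * gi i x) by exact: L2c_mull.
split; first exact: L2c_sum.
apply: le_trans (nrmc_sum _ Lgg) _; apply: ler_sum => i _.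
rewrite nrmc_gen//; apply: le_trans (nrmc_le_sum _) _; apply: ler_sum => A _.
by rewrite giE.
Qed.

Variables (a b : 'rV[R]_n.+1 -> Cl) (ma mb : R).
Hypotheses (ba : bddc a ma) (bb : bddc b mb).

Definition zop w : 'rV[R]_n.+1 -> Cl := fun x => clconj (w x) * a x + clconj (b x) * w x.

Lemma zop_bound : exists2 C : R, 0 <= C & forall w, L2c w ->
  L2c (zop w) /\ nrmc (zop w) <= C * \sum_B nrm2 mu (coef B w).
Proof.
have [C1 C10 h1] := bddc_mulr ba; have [C2 C20 h2] := bddc_mull (bddc_conj bb).
exists (C1 + C2) => [|w Lw]; first exact: addr_ge0.
have [La na] := h1 _ (L2c_conj Lw); have [Lb nb] := h2 _ Lw.
split; first exact: (subspaceD L2c_subspace La Lb).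
apply: le_trans (seminormD nrmc_seminorm La Lb) _; rewrite mulrDl; apply: lerD => //.
by apply: le_trans na _; rewrite ler_wpM2l//; apply: ler_sum => B _; rewrite nrm2_conj.
Qed.

(** T with the function and its gradient as independent arguments. It is bounded in both for the L^2
    norms, so images converge as soon as functions and gradients do, whatever the origin of the
    gradients. *)
Definition adjop w g : 'rV[R]_n.+1 -> Cl := fun x => clgrad g x - zop w x.

Lemma adjop_bound : exists2 C : R, 0 <= C & forall w g, L2c w -> (forall i A, L2 mu (g i A)) ->
  L2c (adjop w g) /\
  nrmc (adjop w g) <= C * (\sum_B nrm2 mu (coef B w) + \sum_i \sum_A nrm2 mu (g i A)).
Proof.
have [C C0 hC] := zop_bound; exists (C + 1) => [|w g Lw Lg]; first exact: addr_ge0.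
have [Lz nz] := hC _ Lw; have [Lc nc] := clgrad_bound Lg.
split; first exact: (subspaceB L2c_subspace Lc Lz).
apply: le_trans (seminormB L2c_subspace nrmc_seminorm Lc Lz) _.
have s0 : 0 <= \sum_B nrm2 mu (coef B w) by apply: sumr_ge0 => B _; exact: nrm2_ge0.
have t0 : 0 <= \sum_i \sum_A nrm2 mu (g i A).
  by apply: sumr_ge0 => i _; apply: sumr_ge0 => A _; exact: nrm2_ge0.
move: nz nc s0 t0; move: (nrmc _) (nrmc _) (\sum_B _) (\sum_i _) => x y s t; nra.
Qed.

Lemma adjop_lin (c : R) w w' g g' x :
  adjop (fun x => c *: w x + w' x) (fun i A x => c * g i A x + g' i A x) x =
  c *: adjop w g x + adjop w' g' x.
Proof.
rewrite /adjop scalerBr addrACA -opprD; congr (_ - _).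
  rewrite /clgrad scaler_sumr -big_split; apply: eq_bigr => i _ /=.
  rewrite scalerAr -mulrDr; congr (_ * _); apply/ffunP => A; rewrite !ffunE.
  by rewrite /GRing.scale/=.
rewrite /zop linearD linearZ/= mulrDl mulrDr -scalerAl -scalerAr scalerDr.
by rewrite addrACA.
Qed.

Definition tgrad phi i A : 'rV[R]_n.+1 -> R := partial i (coef A phi).

Definition adjtf phi := adjop phi (tgrad phi).

Section domain.
Variables (Om : set 'rV[R]_n.+1).

Definition cltf phi := forall A, tf_in Om (coef A phi).

Lemma cltf_tf phi A : cltf phi -> is_tf (coef A phi).
Proof. by move=> /(_ A)/tf_in_tf. Qed.

Lemma cltf_L2c phi : cltf phi -> L2c phi.
Proof. by move=> h A; apply: tf_L2; exact: cltf_tf. Qed.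

Lemma cltf_L2 phi i A : cltf phi -> L2 mu (tgrad phi i A).
Proof. by move=> h; apply: tf_L2; apply: tf_partial; exact: cltf_tf. Qed.

Lemma adjtf_L2c phi : cltf phi -> L2c (adjtf phi).
Proof.
have [C _ hC] := adjop_bound; move=> h.
by have [] := hC phi (tgrad phi) (cltf_L2c h) (fun i A => cltf_L2 i A h).
Qed.

Lemma coef_lin (c : R) u v A : coef A (c *: u + v) = fun x => c * coef A u x + coef A v x.
Proof. by apply/funext => x; rewrite /coef !ffunE. Qed.

Lemma cltf_subspace : is_subspace cltf.
Proof.
split=> [A|c u v hu hv A].
  rewrite (_ : coef A 0 = fun=> 0); first exact: tf_in0.
  by apply/funext => x; rewrite /coef ffunE.
rewrite coef_lin; apply: tf_inD => //.
by apply: (@tf_inM _ _ _ (fun=> c)) => //; exact: smooth_cst.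
Qed.

Lemma tgrad_lin (c : R) u v : cltf u -> cltf v ->
  tgrad (c *: u + v) = fun i A x => c * tgrad u i A x + tgrad v i A x.
Proof.
move=> hu hv; apply/funext => i; apply/funext => A.
have tu := cltf_tf A hu; have tv := cltf_tf A hv.
have dif (f : fn) : is_tf f -> forall x, differentiable f x.
  by move=> tp x; apply: smooth_differentiable; exact: tf_smooth tp.
rewrite /tgrad coef_lin (partialD i (dif _ (tfZ c tu)) (dif _ tv)) (partialZ _ _ (tf_smooth tu)).
by [].
Qed.

Lemma adjtf_lin (c : R) u v : cltf u -> cltf v -> adjtf (c *: u + v) = c *: adjtf u + adjtf v.
Proof.
move=> hu hv; apply/funext => x; rewrite /adjtf tgrad_lin//.
exact: (adjop_lin c u v (tgrad u) (tgrad v) x).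
Qed.

Definition H1norm phi : R :=
  \sum_A nrm2 mu (coef A phi) + \sum_i \sum_A nrm2 mu (tgrad phi i A).

Lemma H1norm_seminorm : seminorm_on cltf H1norm.
Proof.
split=> [u hu|u v hu hv|c u hu].
- rewrite addr_ge0//; first by apply: sumr_ge0 => A _; exact: nrm2_ge0.
  by apply: sumr_ge0 => i _; apply: sumr_ge0 => A _; exact: nrm2_ge0.
- have E : u + v = 1 *: u + v by rewrite scale1r.
  rewrite /H1norm addrACA -!big_split/=; apply: lerD; apply: ler_sum.
    move=> A _; rewrite E coef_lin (_ : (fun x => _) = fun x => coef A u x + coef A v x).
      by apply: nrm2D; apply: tf_L2; exact: cltf_tf.
    by apply/funext => x; rewrite mul1r.
  move=> i _; rewrite -big_split; apply: ler_sum => A _; rewrite E tgrad_lin//.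
  rewrite (_ : (fun x => _) = fun x => tgrad u i A x + tgrad v i A x).
    by apply: nrm2D; exact: cltf_L2.
  by apply/funext => x; rewrite mul1r.
- have E : c *: u = c *: u + 0 by rewrite addr0.
  have h0 := subspace0 cltf_subspace.
  have c0 A : coef A (0 : 'rV[R]_n.+1 -> Cl) = fun=> 0 by apply/funext => x; rewrite /coef ffunE.
  have g0 i A : tgrad (0 : 'rV[R]_n.+1 -> Cl) i A = fun=> 0.
    by apply/funext => x; rewrite /tgrad c0 /partial derive_cst.
  rewrite /H1norm mulrDr !mulr_sumr; congr (_ + _); apply: eq_bigr.
    move=> A _; rewrite E coef_lin c0 -(nrm2Z _ (tf_L2 (cltf_tf A hu))); congr nrm2.
    by apply/funext => x; rewrite addr0.
  move=> i _; rewrite mulr_sumr; apply: eq_bigr => A _; rewrite E tgrad_lin//.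
  rewrite -(nrm2Z _ (cltf_L2 i A hu)); congr nrm2.
  by apply/funext => x; rewrite g0 addr0.
Qed.

Lemma adjtf_seminorm : seminorm_on cltf (fun phi => nrmc (adjtf phi)).
Proof.
split=> [u hu|u v hu hv|c u hu]; first exact: nrmc_ge0.
- have -> : u + v = 1 *: u + v by rewrite scale1r.
  rewrite adjtf_lin// scale1r.
  by apply: (seminormD nrmc_seminorm); exact: adjtf_L2c.
- have h0 := subspace0 cltf_subspace.
  have -> : c *: u = (c - 1) *: u + u by rewrite scalerBl scale1r subrK.
  rewrite adjtf_lin// scalerBl scale1r subrK.
  by apply: (seminormZ nrmc_seminorm); exact: adjtf_L2c.
Qed.

(** Absorption. With S and G the sums of the norms of phi and of its derivatives, S <= e G by
    Poincare, and G <= N |D phi| <= N (|T phi| + C S), where N counts the pairs (i, A). The choice e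
    = 1 / (2 (N C + 1)) gives N C e <= 1/2, whence G <= 2 N |T phi|. *)
Lemma adjtf_apriori : bounded_set Om -> exists (m : nat) (Q : 'I_m -> set 'rV[R]_n.+1) (c : R),
  (forall k, measurable (Q k)) /\ forall phi, cltf phi ->
  (forall k A, \int[mu]_(y in Q k) coef A phi y = 0) -> H1norm phi <= c * nrmc (adjtf phi).
Proof.
move=> bOm.
have [r r0 hr] : exists2 r : R, 0 <= r & forall x, Om x -> `|x| <= r.
  have [M [Mr hM]] := bOm; exists (`|M| + 1) => [|x ox]; first by rewrite addr_ge0.
  by apply: hM ox; rewrite (le_lt_trans (ler_norm M))// ltrDl.
have [C C0 hC] := zop_bound.
pose N : R := \sum_(i < n.+1) \sum_(A : {set 'I_n.+1}) 1.
have N0 : 0 <= N by apply: sumr_ge0 => i _; apply: sumr_ge0.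
pose e := (2 * (N * C + 1))^-1.
have NC : 0 < N * C + 1 by rewrite ltr_wpDl// mulr_ge0.
have e0 : 0 < e by rewrite invr_gt0 mulr_gt0.
have [m [Q [mQ hQ]]] := poincare_finite_rank (n := n) r0 e0.
exists m, Q, ((1 + e) * (2 * N)); split=> // phi hphi phi0.
set S := \sum_A nrm2 mu (coef A phi).
set G := \sum_i \sum_A nrm2 mu (tgrad phi i A).
have tphi A := cltf_tf A hphi.
have S0 : 0 <= S by apply: sumr_ge0 => A _; exact: nrm2_ge0.
have SG : S <= e * G.
  rewrite /S /G exchange_big mulr_sumr; apply: ler_sum => A _.
  by apply: hQ => // x; have [_ [K [_ KO] hK]] := hphi A; move=> /hK/KO/hr.
have GN : G <= N * nrmc (Dc phi).
  rewrite /G /N mulr_suml; apply: ler_sum => i _; rewrite mulr_suml; apply: ler_sum => A _.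
  rewrite mul1r -(ler_pXn2r (ltn0Sn 1)) ?nnegrE ?nrm2_ge0 ?nrmc_ge0// nrmc_Dc//.
  pose s j := \sum_B nrm2 mu (partial j (coef B phi)) ^+ 2.
  have s0 j : 0 <= s j by apply: sumr_ge0 => B _; exact: sqr_ge0.
  apply: (@le_trans _ _ (s i)).
    rewrite /s (bigD1 A)//=; apply: ler_wpDr => //.
    by apply: sumr_ge0 => B _; exact: sqr_ge0.
  rewrite -/(s _) (_ : \sum_i _ = \sum_j s j)// (bigD1 i)//=; apply: ler_wpDr => //.
  by apply: sumr_ge0 => j _.
have DT : nrmc (Dc phi) <= nrmc (adjtf phi) + C * S.
  have [Lz nz] := hC _ (cltf_L2c hphi).
  have -> : Dc phi = adjtf phi + zop phi by apply/funext => x; rewrite /adjtf /adjop !fctE subrK.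
  apply: le_trans (seminormD nrmc_seminorm (adjtf_L2c hphi) Lz) _.
  by rewrite lerD2l.
have q0 := nrmc_ge0 (adjtf phi).
have eE : e * (2 * (N * C + 1)) = 1 by rewrite mulVf// gt_eqF// mulr_gt0.
rewrite /H1norm -/S -/G.
move: S0 SG GN DT q0 eE; move: S G (nrmc (Dc phi)) (nrmc (adjtf phi)) => S G D q S0 SG GN DT q0 eE.
have G1 : G <= N * q + N * C * S.
  by apply: le_trans GN _; rewrite -mulrA -mulrDr ler_wpM2l.
have NCS : N * C * S <= N * C * (e * G) by rewrite ler_wpM2l// mulr_ge0.
have G0 : 0 <= G by move: SG; rewrite -ler_pdivrMl// => SG; apply: le_trans SG; rewrite mulr_ge0// invr_ge0 ltW.
have eG : 2 * (N * C * (e * G)) <= G.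
  have GE : G = e * (2 * (N * C + 1)) * G by rewrite eE mul1r.
  have -> : 2 * (N * C * (e * G)) = G - 2 * e * G by rewrite [X in X - _]GE; ring.
  by rewrite gerBl !mulr_ge0// ltW.
have G2 : G <= 2 * N * q by lra.
have : (1 + e) * G <= (1 + e) * (2 * N * q) by rewrite ler_wpM2l// addr_ge0// ltW.
rewrite !mulrA; lra.
Qed.

End domain.
End adjoint_operator.

(** * The Vekua space as an orthogonal complement *)

Section vekua.
Context {R : realType} {n : nat}.
Notation mu := (@leb R n.+1).
Local Notation Cl := (clifford R n.+1).
Implicit Types (u v w phi : 'rV[R]_n.+1 -> Cl) (A B : {set 'I_n.+1}) (i : 'I_n.+1).
Implicit Types (c d : Cl) (f psi : 'rV[R]_n.+1 -> R).

Lemma clScB c d : clSc (c - d) = clSc c - clSc d.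
Proof. by rewrite /clSc !ffunE. Qed.

Lemma clScD c d : clSc (c + d) = clSc c + clSc d.
Proof. by rewrite /clSc !ffunE. Qed.

Lemma clScZ (t : R) c : clSc (t *: c) = t * clSc c.
Proof. by rewrite /clSc !ffunE. Qed.

Lemma clSc_sum (I : Type) (s : seq I) (F : I -> Cl) :
  clSc (\sum_(k <- s) F k) = \sum_(k <- s) clSc (F k).
Proof. by rewrite /clSc sum_ffunE. Qed.

Lemma clSc_adjoint_zop c d (p q : Cl) :
  clSc (clconj d * (clconj c * p + clconj q * c)) = clSc (clconj c * (p * clconj d + q * d)).
Proof.
by rewrite !mulrDr !clScD clSc_adjoint_alpha clSc_adjoint_beta.
Qed.

Variables (Om : set 'rV[R]_n.+1) (alpha beta : 'rV[R]_n.+1 -> Cl) (ma mb : R).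
Hypotheses (oOm : open Om) (ba : bddc (ext Om alpha) ma) (bb : bddc (ext Om beta) mb).

Notation a := (ext Om alpha).
Notation b := (ext Om beta).
Notation T := (adjtf a b).

Definition vekua_rhs w : 'rV[R]_n.+1 -> Cl := fun x => a x * clconj (w x) + b x * w x.

Lemma vekua_rhs_L2c w : L2c w -> L2c (vekua_rhs w).
Proof.
move=> Lw; have [C1 _ h1] := bddc_mull ba; have [C2 _ h2] := bddc_mull bb.
have [L1 _] := h1 _ (L2c_conj Lw); have [L2' _] := h2 _ Lw.
exact: (subspaceD L2c_subspace L1 L2').
Qed.

Lemma clgen_coef i c A : (clgen i * c) A = - \sum_B c B * (clgen i * blade A : Cl) B.
Proof. by rewrite -clSc_blade clSc_adjoint_gen clSc_conj_mul. Qed.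

Definition clblade psi A : 'rV[R]_n.+1 -> Cl := fun x => psi x *: blade A.

Lemma coef_clblade psi A B : coef B (clblade psi A) = fun x => (B == A)%:R * psi x.
Proof. by apply/funext => x; rewrite /coef /clblade !ffunE mulrC. Qed.

Lemma clblade_cltf psi A : tf_in Om psi -> cltf Om (clblade psi A).
Proof.
move=> hp B; rewrite coef_clblade.
by apply: (@tf_inM _ _ _ (fun=> (B == A)%:R)) => //; exact: smooth_cst.
Qed.

Lemma adjtf_clblade psi A w x : is_tf psi ->
  clSc (clconj (w x) * T (clblade psi A) x) =
  (\sum_i \sum_B coef B w x * partial i psi x * (clgen i * blade A : Cl) B) -
  coef A (vekua_rhs w) x * psi x.
Proof.
move=> tp; rewrite /adjtf /adjop mulrBr clScB; congr (_ - _).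
  rewrite /clgrad mulr_sumr clSc_sum; apply: eq_bigr => i _.
  have -> : [ffun B => tgrad (clblade psi A) i B x] = partial i psi x *: blade A :> Cl.
    apply/ffunP => B; rewrite !ffunE /tgrad coef_clblade partialZ; last exact: tf_smooth.
    by rewrite mulrC.
  rewrite -!scalerAr clScZ clSc_conj_mul mulr_sumr; apply: eq_bigr => B _.
  by rewrite /coef; ring.
by rewrite /zop clSc_adjoint_zop /clblade linearZ/= -scalerAl clScZ clSc_blade mulrC.
Qed.

(** Pairing with T (psi e_A) isolates the component A of the distributional equation tested with
    psi; the transposes of e_i, alpha and beta are those of [clifford_inner]. *)
Lemma vekua_component w psi A : clLp Om 2%:E w -> tf_in Om psi ->
  (- \sum_i clgen i * clint Om (fun x => partial i psi x *: w x)) A -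
  clint Om (fun x => psi x *: (alpha x * clconj (w x) + beta x * w x)) A =
  ipc (ext Om w) (T (clblade psi A)).
Proof.
move=> /clLp2E Lw hp; have tp := tf_in_tf hp.
have LT := adjtf_L2c ba bb (clblade_cltf A hp).
rewrite (ipcE Lw LT); under eq_Rintegral do rewrite adjtf_clblade//.
have iB i B : itg mu (fun x => coef B (ext Om w) x * partial i psi x * (clgen i * blade A : Cl) B).
  rewrite (_ : (fun x => _) = fun x => (clgen i * blade A : Cl) B * (coef B (ext Om w) x * partial i psi x)).
    by apply: itgZ; apply: tf_mul_itg => //; exact: tf_partial.
  by apply/funext => x; rewrite mulrC.
have iV : itg mu (fun x => coef A (vekua_rhs (ext Om w)) x * psi x).
  by apply: tf_mul_itg => //; exact: vekua_rhs_L2c.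
rewrite RintegralB//; last by apply: itg_sum => i _; exact: itg_sum.
congr (_ - _); last first.
  rewrite ffunE Rintegral_mkcond; apply: eq_Rintegral => x _.
  rewrite restrictE /vekua_rhs /coef !ffunE.
  have [ox|ox] := pselect (Om x); first by rewrite !ext_in// indicE mem_set// mul1r mulrC.
  by rewrite !ext_out// !mul0r !ffunE addr0 indicE memNset// !mul0r.
rewrite ffunE sum_ffunE -sumrN Rintegral_sum; last by move=> i _; exact: itg_sum.
apply: eq_bigr => i _; rewrite clgen_coef opprK Rintegral_sum//; apply: eq_bigr => B _.
have -> : clint Om (fun x => partial i psi x *: w x) B =
    \int[mu]_x (coef B (ext Om w) x * partial i psi x).
  rewrite ffunE Rintegral_mkcond; apply: eq_Rintegral => x _.
  by rewrite restrictE /coef /ext !ffunE /GRing.scale/= mulrAC mulrA.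
rewrite mulrC -RintegralZl//; last by apply: tf_mul_itg => //; exact: tf_partial.
by apply: eq_Rintegral => x _; rewrite mulrC.
Qed.

(** The distributional equation is tested with scalar functions, while T acts on Clifford-valued
    ones; the latter are finite sums of the functions [clblade (coef A phi) A], and T is linear. *)
Lemma vekua_spaceP w : vekua_space Om alpha beta w <->
  clLp Om 2%:E w /\ forall phi, cltf Om phi -> ipc (ext Om w) (T phi) = 0.
Proof.
split=> [[Lw dw]|[Lw h]]; split=> //; last first.
  move=> psi /tf_in_test hp; apply/ffunP => A; apply/eqP; rewrite -subr_eq0; apply/eqP.
  by rewrite vekua_component// h//; exact: clblade_cltf.
move=> phi hphi; have LW : L2c (ext Om w) by exact/clLp2E.
have hT u : cltf Om u -> L2c (T u) by move=> hu; exact: (adjtf_L2c ba bb hu).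
have X0 := subspace0 (@cltf_subspace R n Om).
have T0 : T 0 = 0.
  by have := adjtf_lin a b (-1) X0 X0; rewrite scaler0 addr0 scaleN1r addNr.
have hA A : cltf Om (clblade (coef A phi) A) by exact: clblade_cltf.
have bA A : ipc (ext Om w) (T (clblade (coef A phi) A)) = 0.
  have hp := hphi A; have /tf_in_test/dw E := hp.
  by rewrite -vekua_component// E subrr.
have key (s : seq {set 'I_n.+1}) : let u := \sum_(A <- s) clblade (coef A phi) A in
    cltf Om u /\ ipc (ext Om w) (T u) = 0.
  elim: s => [|A s [IH1 IH2]].
    by rewrite big_nil /= T0; split => //; apply: (inner0r L2c_subspace ipc_inner).
  rewrite big_cons /=; split; first exact: (subspaceD (@cltf_subspace R n Om)).
  have -> : clblade (coef A phi) A + \sum_(B <- s) clblade (coef B phi) B =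
      1 *: clblade (coef A phi) A + \sum_(B <- s) clblade (coef B phi) B by rewrite scale1r.
  rewrite (adjtf_lin a b 1 (hA A) IH1) (inner_linr L2c_subspace ipc_inner)//; try exact: hT.
  by rewrite bA mulr0 add0r.
have [_] := key (index_enum _); congr (ipc _ (T _) = 0).
apply/funext => x; rewrite [RHS](clifford_blade (phi x)).
by rewrite fct_sumE.
Qed.

End vekua.

Lemma EFin_cvg0 (R : realType) (u : nat -> R) : (forall j, 0 <= u j) ->
  (forall e, 0 < e -> exists N, forall j, (N <= j)%N -> u j <= e) ->
  ((u j)%:E @[j --> \oo] --> 0)%E.
Proof.
move=> u0 h; apply: cvg_EFin; first exact: nearW.
apply/cvgrPdist_le => e /h[N hN]; exists N => // j /= Nj.
by rewrite sub0r normrN ger0_norm//; exact: hN.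
Qed.

(** * Limits of test functions in W^{1,2} *)

Section limits.
Context {R : realType} {n : nat}.
Notation mu := (@leb R n.+1).
Variables (Om : set 'rV[R]_n.+1).
Hypothesis (dOm : bounded_lipschitz_domain Om).
Let oOm : open Om := domain_open dOm.
Implicit Types (f : 'rV[R]_n.+1 -> R) (g : 'I_n.+1 -> 'rV[R]_n.+1 -> R).

Lemma tf_in_restrict phi : tf_in Om phi -> phi \_ Om = phi.
Proof.
move=> [_ [K [_ KO] hK]]; apply/funext => x; rewrite restrictE indicE.
have [->|/hK/KO ox] := eqVneq (phi x) 0; first by rewrite mulr0.
by rewrite mem_set// mul1r.
Qed.

Lemma tf_in_partial_restrict phi i : tf_in Om phi -> partial i phi \_ Om = partial i phi.
Proof.
move=> [_ [K [cK KO] hK]]; apply/funext => x; rewrite restrictE indicE.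
have clK : closed K by apply: compact_closed => //; exact: norm_hausdorff.
have [->|/(partial_supp clK hK)/KO ox] := eqVneq (partial i phi x) 0; first by rewrite mulr0.
by rewrite mem_set// mul1r.
Qed.

(** The v_j themselves witness the zero trace: they are smooth and vanish on every chart graph,
    whose points lie outside Om. *)
Lemma W012_limit (v : nat -> 'rV[R]_n.+1 -> R) f g : (forall j, tf_in Om (v j)) ->
  L2 mu (f \_ Om) -> (forall i, L2 mu (g i \_ Om)) ->
  (forall e : R, 0 < e -> exists N, forall j, (N <= j)%N ->
    nrm2 mu (fun x => v j x - (f \_ Om) x) <= e /\
    forall i, nrm2 mu (fun x => partial i (v j) x - (g i \_ Om) x) <= e) ->
  W012 Om f /\ forall i, wpartial Om i f \_ Om = g i \_ Om %[ae mu].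
Proof.
move=> hv Lf Lg cv.
have tv j := tf_in_tf (hv j); have Lv j := tf_L2 (tv j).
have Ldv i j := tf_L2 (tf_partial i (tv j)).
have wf i : is_weak_partial Om i f (g i).
  apply/is_weak_partialE => phi hp; have tp := tf_in_tf hp; have tdp := tf_partial i tp.
  have i1 : itg mu (fun x => (f \_ Om) x * partial i phi x) by exact: tf_mul_itg.
  have i2 : itg mu (fun x => (g i \_ Om) x * phi x) by exact: tf_mul_itg.
  apply/eqP; rewrite -addr_eq0 -normr_le0; apply/ler_addgt0Pr => e e0; rewrite add0r.
  have c0 : 0 < 1 + nrm2 mu phi + nrm2 mu (partial i phi).
    by rewrite -addrA ltr_wpDr// addr_ge0// nrm2_ge0.
  have e1 : 0 < e / (1 + nrm2 mu phi + nrm2 mu (partial i phi)) by rewrite divr_gt0.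
  set e' := e / _ in e1; have [j /(_ j (leqnn j))[h1 /(_ i) h2]] := cv _ e1.
  have := tf_ibp i (tf_smooth (tv j)) tp => /eqP; rewrite -addr_eq0 => /eqP E.
  have j1 : itg mu (fun x => v j x * partial i phi x) by exact: tf_mul_itg.
  have j2 : itg mu (fun x => partial i (v j) x * phi x) by exact: tf_mul_itg.
  have -> : \int[mu]_x ((f \_ Om) x * partial i phi x) + \int[mu]_x ((g i \_ Om) x * phi x) =
    - (ip2 mu (fun x => v j x - (f \_ Om) x) (partial i phi) +
       ip2 mu (fun x => partial i (v j) x - (g i \_ Om) x) phi).
    have E1 : ip2 mu (fun x => v j x - (f \_ Om) x) (partial i phi) =
        \int[mu]_x (v j x * partial i phi x) - \int[mu]_x ((f \_ Om) x * partial i phi x).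
      by rewrite -RintegralB//; apply: eq_Rintegral => x _; rewrite mulrBl.
    have E2 : ip2 mu (fun x => partial i (v j) x - (g i \_ Om) x) phi =
        \int[mu]_x (partial i (v j) x * phi x) - \int[mu]_x ((g i \_ Om) x * phi x).
      by rewrite -RintegralB//; apply: eq_Rintegral => x _; rewrite mulrBl.
    by rewrite E1 E2 addrACA E add0r -opprD opprK.
  rewrite normrN.
  have b1 := ip2_CS (L2B (Lv j) Lf) (tf_L2 tdp); have b2 := ip2_CS (L2B (Ldv i j) (Lg i)) (tf_L2 tp).
  have d1 := ler_wpM2r (nrm2_ge0 mu (partial i phi)) h1; have d2 := ler_wpM2r (nrm2_ge0 mu phi) h2.
  apply: le_trans (ler_normD _ _) _.
  apply: le_trans (lerD (le_trans b1 d1) (le_trans b2 d2)) _.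
  apply: (@le_trans _ _ (e' * (1 + nrm2 mu phi + nrm2 mu (partial i phi)))).
    by rewrite -mulrDr ler_wpM2l ?(ltW e1)// addrC -addrA lerDr.
  by rewrite /e' divfK// gt_eqF.
have Wf : W12 Om f by split => [|i]; [exact/LpF2E|exists (g i) => //; exact/LpF2E].
split; last first.
  move=> i; have [Lw ww] := wpartialP i Wf.
  by apply: is_weak_partial_ae ww (wf i) => //; exact/LpF2E.
split=> //.
have z0 k (S : set 'rV[R]_n) : (on_graph k (cst 0 : 'rV[R]_n.+1 -> R)) \_ S = fun=> 0.
  by apply/funext => y; rewrite patchE; case: ifP.
split=> [k kL|]; first by rewrite /LpF z0; apply/L2_Lfun; exact: L20.
exists v; split=> [j||k kL].
- exact: tf_smooth (tv j).
- have NE j : W12norm Om (v j \- f) = (nrm2 mu (fun x => v j x - (f \_ Om) x) +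
      \sum_i nrm2 mu (fun x => partial i (v j) x - (g i \_ Om) x))%:E.
    have vE := tf_in_restrict (hv j); have dvE i := tf_in_partial_restrict i (hv j).
    have -> : (fun x => v j x - (f \_ Om) x) = (v j \- f) \_ Om by rewrite restrictB vE.
    have pE i : (fun x => partial i (v j) x - (g i \_ Om) x) = (partial i (v j) \- g i) \_ Om.
      by rewrite restrictB dvE.
    under eq_bigr do rewrite pE; apply: W12normE => //.
    + by apply/LpF2E; rewrite restrictB vE; exact: L2B.
    + by move=> i; apply/LpF2E; rewrite restrictB dvE; exact: L2B.
    + move=> i; apply: is_weak_partialB => //; try exact/LpF2E.
      * by apply/LpF2E; rewrite vE.
      * by apply/LpF2E; rewrite dvE.
      * by apply: smooth_is_weak_partial; exact: tf_smooth (tv j).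
  rewrite (_ : (fun j => _) = fun j => (nrm2 mu (fun x => v j x - (f \_ Om) x) +
      \sum_i nrm2 mu (fun x => partial i (v j) x - (g i \_ Om) x))%:E); last first.
    by apply/funext => j; exact: NE.
  apply: EFin_cvg0 => [j|e e0].
    by rewrite addr_ge0 ?nrm2_ge0// sumr_ge0// => i _; exact: nrm2_ge0.
  (* One share for the function and one for each of its [n.+1] derivatives. *)
  have e1 : 0 < e / n.+2%:R by rewrite divr_gt0.
  have [N hN] := cv _ e1; exists N => j /hN[h1 h2].
  apply: (@le_trans _ _ (e / n.+2%:R + \sum_(i < n.+1) e / n.+2%:R)).
    by apply: lerD => //; apply: ler_sum => i _; exact: h2.
  rewrite sumr_const card_ord -mulrS -[X in X <= _]mulr_natr divfK//.
- rewrite (_ : (fun j => _) = fun=> 0%E); first exact: cvg_cst.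
  apply/funext => j; rewrite /L2norm (_ : _ \_ _ = fun=> 0); last first.
    apply/funext => y; rewrite patchE; case: ifPn => // /set_mem yb.
    rewrite /on_graph/= subr0; apply/eqP/negPn/negP => nz.
    have [_ [K [_ KO] hK]] := hv j.
    (* A graph point in Om would lie strictly above the graph. *)
    have /(chart_epigraph kL (chart_gr_lt kL yb) yb) := KO _ (hK _ nz).
    by rewrite ltxx.
  by rewrite Lnorm2E ?nrm20//; exact: L20.
Qed.

End limits.

(** * The decomposition *)

Lemma eventually_all (I : finType) (P : I -> nat -> Prop) :
  (forall i, exists N, forall j, (N <= j)%N -> P i j) ->
  exists N, forall j, (N <= j)%N -> forall i, P i j.
Proof.
move=> /choice[N hN]; exists (\max_i N i) => j Nj i; apply: hN.
exact: leq_trans (leq_bigmax i) Nj.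
Qed.

Lemma In_map (T : eqType) (S : Type) (F : T -> S) (s : seq T) x :
  x \in s -> List.In (F x) (map F s).
Proof.
by elim: s => // y s IH; rewrite inE => /predU1P[->|/IH]; [left|right].
Qed.

Lemma inner_telescope (R : realType) (V : lmodType R) (S : V -> Prop) (b : V -> V -> R)
    (f F p q x : V) : semi_inner S b -> S f -> S F -> S p -> S q -> S x ->
  b (f - F) x = b (f - q) x + (b (p - F) x - b (p - q) x).
Proof.
move=> bS Sf SF Sp Sq Sx; rewrite !(innerBl bS)//; ring.
Qed.

Section decomposition.
Context {R : realType} {n : nat}.
Notation mu := (@leb R n.+1).
Local Notation Cl := (clifford R n.+1).
Variables (Om : set 'rV[R]_n.+1) (alpha beta : 'rV[R]_n.+1 -> Cl) (ma mb : R).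
Hypotheses (dOm : bounded_lipschitz_domain Om).
Hypotheses (ba : bddc (ext Om alpha) ma) (bb : bddc (ext Om beta) mb).
Let oOm : open Om := domain_open dOm.
Implicit Types (u v w phi h : 'rV[R]_n.+1 -> Cl) (A B : {set 'I_n.+1}) (i : 'I_n.+1).
Implicit Types (g : 'I_n.+1 -> {set 'I_n.+1} -> 'rV[R]_n.+1 -> R).

Notation a := (ext Om alpha).
Notation b := (ext Om beta).
Notation T := (adjtf a b).

Definition wgrad h i A : 'rV[R]_n.+1 -> R := wpartial Om i (coef A h) \_ Om.

Lemma ext_vekua_adj h : ext Om (vekua_adj Om alpha beta h) = adjop a b (ext Om h) (wgrad h).
Proof.
apply/funext => x; rewrite /adjop /zop opprD addrA.
have [ox|ox] := pselect (Om x).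
  rewrite !ext_in// /vekua_adj /Dirac /clgrad; congr (_ - _ - _); apply: eq_bigr => i _.
  by congr (_ * _); apply/ffunP => A; rewrite !ffunE /wgrad patchE mem_set.
rewrite !ext_out// linear0 !mul0r !subr0 /clgrad big1// => i _.
rewrite (_ : finfun _ = 0) ?mulr0//; apply/ffunP => A.
by rewrite !ffunE /wgrad patchE memNset.
Qed.

Lemma adjop_close : exists2 C : R, 0 <= C & forall w w' g g' (e : R), L2c w -> L2c w' ->
  (forall i A, L2 mu (g i A)) -> (forall i A, L2 mu (g' i A)) ->
  (forall A, nrm2 mu (fun x => coef A w x - coef A w' x) <= e) ->
  (forall i A, nrm2 mu (fun x => g i A x - g' i A x) <= e) ->
  nrmc (adjop a b w g - adjop a b w' g') <= C * e.
Proof.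
have [C C0 hC] := adjop_bound ba bb.
pose N : R := \sum_(A : {set 'I_n.+1}) 1 + \sum_(i < n.+1) \sum_(A : {set 'I_n.+1}) 1.
exists (C * N) => [|w w' g g' e Lw Lw' Lg Lg' hw hg].
  rewrite mulr_ge0// addr_ge0//; apply: sumr_ge0 => // i _; exact: sumr_ge0.
have -> : adjop a b w g - adjop a b w' g' =
    adjop a b (w - w') (fun i A x => g i A x - g' i A x).
  apply/funext => x; have E := adjop_lin a b (-1) w' w g' g x; rewrite scaleN1r addrC in E.
  apply: etrans (esym E) _; congr (adjop a b _ _ x); first by apply/funext => y; rewrite scaleN1r addrC.
  by apply/funext => i; apply/funext => A; apply/funext => y; rewrite mulN1r addrC.
have cE A : coef A (w - w') = fun x => coef A w x - coef A w' x.
  by apply/funext => x; rewrite /coef !ffunE.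
have [_ le1] := hC (w - w') (fun i A x => g i A x - g' i A x)
  (subspaceB L2c_subspace Lw Lw') (fun i A => L2B (Lg i A) (Lg' i A)).
apply: le_trans le1 _; rewrite -mulrA ler_wpM2l// /N mulrDl; apply: lerD.
  by rewrite mulr_suml; apply: ler_sum => A _; rewrite mul1r cE.
rewrite mulr_suml; apply: ler_sum => i _; rewrite mulr_suml; apply: ler_sum => A _.
by rewrite mul1r.
Qed.

Section range.
Variable h : 'rV[R]_n.+1 -> Cl.
Hypothesis Wh : clW012 Om h.

Lemma clW012_L2c : L2c (ext Om h).
Proof. by move=> A; rewrite coef_ext; apply/LpF2E; case: (Wh A) => -[]. Qed.

Lemma wgrad_L2 i A : L2 mu (wgrad h i A).
Proof. by apply/LpF2E; case: (wpartialP i (proj1 (Wh A))). Qed.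

Lemma vekua_adj_L2c : L2c (ext Om (vekua_adj Om alpha beta h)).
Proof.
rewrite ext_vekua_adj; have [C _ hC] := adjop_bound ba bb.
by have [] := hC _ _ clW012_L2c wgrad_L2.
Qed.

(** [W012_extension] and [tf_density] component by component, transported to the images by
    [adjop_close]. *)
Lemma vekua_adj_approx (e : R) : 0 < e -> exists2 phi, cltf Om phi &
  nrmc (T phi - ext Om (vekua_adj Om alpha beta h)) <= e.
Proof.
move=> e0; have [C C0 hC] := adjop_close.
have C1 : 0 < C + 1 by rewrite ltr_wpDl.
have e1 : 0 < e / (C + 1) by rewrite divr_gt0.
have /choice[psi hpsi] : forall A, exists psi, tf_in Om psi /\
    (nrm2 mu (fun x => psi x - (coef A h \_ Om) x) <= e / (C + 1) /\
     forall i, nrm2 mu (fun x => partial i psi x - wgrad h i A x) <= e / (C + 1)).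
  move=> A; have cO := closure_compact dOm.
  have wg : weak_gradient (coef A h \_ Om) (fun i => wgrad h i A).
    split=> [|i|i F tF]; [by rewrite -coef_ext; exact: clW012_L2c|exact: wgrad_L2|].
    exact: W012_extension.
  have [|i x|psi hp hq] := tf_density cO dOm wg _ _ e1.
  - by move=> x; rewrite patchE; case: ifPn => [/set_mem//|]; rewrite eqxx.
  - by rewrite /wgrad patchE; case: ifPn => [/set_mem//|]; rewrite eqxx.
  - by exists psi.
pose phi x : Cl := [ffun A => psi A x].
have phiE A : coef A phi = psi A by apply/funext => x; rewrite /coef ffunE.
have hphi : cltf Om phi by move=> A; rewrite phiE; case: (hpsi A).
exists phi => //; rewrite ext_vekua_adj.
apply: le_trans (hC _ _ _ _ (e / (C + 1)) (cltf_L2c hphi) clW012_L2c (fun i A => cltf_L2 i A hphi) wgrad_L2 _ _) _.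
- by move=> A; rewrite phiE coef_ext; case: (hpsi A) => _ [].
- by move=> i A; rewrite /tgrad phiE; case: (hpsi A) => _ [].
by rewrite mulrCA ler_piMr ?(ltW e0)// ler_pdivrMr// mul1r lerDl.
Qed.

Lemma vekua_adj_orth w : vekua_space Om alpha beta w ->
  ipc (ext Om w) (ext Om (vekua_adj Om alpha beta h)) = 0.
Proof.
move=> /(vekua_spaceP ba bb)[/clLp2E Lw hw]; have LF := vekua_adj_L2c.
apply/eqP; rewrite -normr_le0; apply/ler_addgt0Pr => e e0; rewrite add0r.
have c1 : 0 < nrmc (ext Om w) + 1 by rewrite ltr_wpDl// nrmc_ge0.
have [phi hphi close] := vekua_adj_approx (divr_gt0 e0 c1).
have LT := adjtf_L2c ba bb hphi.
have -> : ipc (ext Om w) (ext Om (vekua_adj Om alpha beta h)) =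
    - ipc (ext Om w) (T phi - ext Om (vekua_adj Om alpha beta h)).
  by rewrite (innerBr L2c_subspace ipc_inner)// hw// sub0r opprK.
rewrite normrN.
have cs := inner_CS L2c_subspace ipc_inner Lw (subspaceB L2c_subspace LT LF).
apply: le_trans cs _; apply: le_trans (ler_wpM2l (nrmc_ge0 (ext Om w)) close) _.
by rewrite mulrCA ler_piMr ?(ltW e0)// ler_pdivrMr// mul1r lerDl.
Qed.

End range.

Lemma H1norm_ge_coef phi A : nrm2 mu (coef A phi) <= H1norm phi.
Proof.
rewrite /H1norm (bigD1 A)//= -addrA lerDl addr_ge0//.
  by apply: sumr_ge0 => B _; exact: nrm2_ge0.
by apply: sumr_ge0 => i _; apply: sumr_ge0 => B _; exact: nrm2_ge0.
Qed.

Lemma H1norm_ge_grad phi i A : nrm2 mu (tgrad phi i A) <= H1norm phi.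
Proof.
have : nrm2 mu (tgrad phi i A) <= \sum_B nrm2 mu (tgrad phi i B).
  by rewrite (bigD1 A)//= lerDl; apply: sumr_ge0 => B _; exact: nrm2_ge0.
move=> /le_trans; apply; rewrite /H1norm (bigD1 i)//= addrCA lerDl addr_ge0//.
  by apply: sumr_ge0 => B _; exact: nrm2_ge0.
by apply: sumr_ge0 => j _; apply: sumr_ge0 => B _; exact: nrm2_ge0.
Qed.

Lemma adjtfB u v : cltf Om u -> cltf Om v -> T (u - v) = T u - T v.
Proof. by move=> hu hv; rewrite addrC -scaleN1r (adjtf_lin a b (-1) hv hu) scaleN1r addrC. Qed.

Lemma tgradB u v i A : cltf Om u -> cltf Om v ->
  tgrad (u - v) i A = fun x => tgrad u i A x - tgrad v i A x.
Proof.
move=> hu hv; rewrite addrC -scaleN1r (tgrad_lin (-1) hv hu).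
by apply/funext => x; rewrite mulN1r addrC.
Qed.

Lemma coefB u v A : coef A (u - v) = fun x => coef A u x - coef A v x.
Proof. by apply/funext => x; rewrite /coef !ffunE. Qed.

Lemma adjtf_range_subspace : is_subspace [set y | exists2 phi, cltf Om phi & y = T phi].
Proof.
have X0 := subspace0 (@cltf_subspace R n Om).
split=> [|c _ _ [u hu ->] [v hv ->]].
  exists 0 => //; have := adjtf_lin a b (-1) X0 X0.
  by rewrite scaler0 addr0 scaleN1r addNr.
exists (c *: u + v); first exact: (subspace_lin (@cltf_subspace R n Om)).
by rewrite (adjtf_lin a b c hu hv).
Qed.

(* Modulo finitely many functionals the operator bounds the H^1 norm, so a
   sequence whose images converge can be replaced by one that converges in H^1. *)
Lemma adjtf_lift (phi : nat -> 'rV[R]_n.+1 -> Cl) : (forall k, cltf Om (phi k)) ->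
  cauchy_for nrmc (fun k => T (phi k)) -> exists psi, [/\ forall k, cltf Om (psi k),
    cauchy_for (@H1norm R n) psi & forall e : R, 0 < e ->
    exists N, forall k, (N <= k)%N -> nrmc (T (psi k) - T (phi k)) < e].
Proof.
move=> hphi cphi.
have [m [Q [c [mQ hQ]]]] := adjtf_apriori ba bb (domain_bounded dOm).
(* One functional for each cell and each Clifford component. *)
pose l (p : 'I_m * {set 'I_n.+1}) (u : 'rV[R]_n.+1 -> Cl) : R := \int[mu]_(y in Q p.1) coef p.2 u y.
have cauchyT : cauchy_for (fun u => nrmc (T u)) phi.
  move=> e /cphi[N hN]; exists N => k j Nk Nj; rewrite adjtfB//; exact: hN.
have [||psi [hpsi cpsi dpsi]] := cauchy_lift (s := map l (enum {: 'I_m * {set 'I_n.+1}})) (c := c)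
  (@cltf_subspace R n Om) (H1norm_seminorm Om) (adjtf_seminorm ba bb Om) _ _ hphi cauchyT.
- move=> l0 ll0 t u v hu hv.
  have [p ->] : exists p, l0 = l p.
    elim: (enum _) ll0 => // p s IH; rewrite map_cons => -[<-|/IH//]; by exists p.
  have iQ w : cltf Om w -> mu.-integrable (Q p.1) (EFin \o coef p.2 w).
    move=> hw; apply: (integrableS measurableT (mQ p.1)) => //.
    exact: (tf_itg (cltf_tf p.2 hw)).
  have iu : mu.-integrable (Q p.1) (EFin \o (fun y => t * coef p.2 u y)).
    exact: (integrableZl (mQ p.1) t (iQ u hu)).
  rewrite /l coef_lin (RintegralD (mQ p.1) iu (iQ v hv)) RintegralZl//; exact: iQ.
- move=> u hu h; apply: hQ => // k A; apply: (h (l (k, A))).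
  have kA : (k, A) \in enum {: 'I_m * {set 'I_n.+1}} by rewrite mem_enum.
  exact: (In_map l kA).
exists psi; split; [exact: hpsi|exact: cpsi|].
move=> e e0; have [N hN] := dpsi e e0; exists N => k Nk.
rewrite -(adjtfB (hpsi k) (hphi k)); exact: hN.
Qed.

(** The images T phi_k that approach the projection of f form a Cauchy sequence, although the phi_k
    need not. [adjtf_lift] trades them for psi_k with asymptotically the same images that are Cauchy
    in H^1. Their limit h has image equal to the projection, so the rest of f is orthogonal to all T
    chi and [vekua_spaceP] applies. *)
Lemma vekua_decomp f : clLp Om 2%:E f -> exists2 h, clW012 Om h &
  vekua_space Om alpha beta (fun x => f x - vekua_adj Om alpha beta h x).
Proof.
move=> /clLp2E Lf.
have [|d [Dd cd hd]] := inner_proj L2c_subspace ipc_inner adjtf_range_subspace _ Lf.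
  by move=> _ [phi hphi ->]; exact: (adjtf_L2c ba bb hphi).
have /choice[phi hphi] : forall k, exists phi, cltf Om phi /\ d k = T phi.
  by move=> k; have [phi h1 h2] := Dd k; exists phi.
have cphi k : cltf Om (phi k) by case: (hphi k).
have dE : d = fun k => T (phi k) by apply/funext => k; case: (hphi k).
rewrite {}dE {Dd hphi} in cd hd.
have [psi [hpsi cpsi dpsi]] := adjtf_lift cphi cd.
have LT u : cltf Om u -> L2c (T u) by move=> hu; exact: (adjtf_L2c ba bb hu).
have /choice[H hH] : forall A, exists H : 'rV[R]_n.+1 -> R^o,
    L2 mu H /\ cvg_for (nrm2 mu) (fun k => coef A (psi k) : _ -> R^o) H.
  move=> A; have [k||H LH cH] := @L2_complete _ _ _ mu (fun k => coef A (psi k) : _ -> R^o); last by exists H.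
    exact: cltf_L2c (hpsi k) A.
  move=> e /cpsi[N hN]; exists N => k j Nk Nj.
  apply: le_lt_trans (hN k j Nk Nj); apply: le_trans (H1norm_ge_coef _ A).
  by rewrite coefB.
have /choice[G hG] : forall iA : 'I_n.+1 * {set 'I_n.+1}, exists G : 'rV[R]_n.+1 -> R^o,
    L2 mu G /\ cvg_for (nrm2 mu) (fun k => tgrad (psi k) iA.1 iA.2 : _ -> R^o) G.
  move=> [i A]; have [k||G LG cG] := @L2_complete _ _ _ mu (fun k => tgrad (psi k) i A : _ -> R^o); last by exists G.
    exact: cltf_L2 i A (hpsi k).
  move=> e /cpsi[N hN]; exists N => k j Nk Nj.
  apply: le_lt_trans (hN k j Nk Nj); apply: le_trans (H1norm_ge_grad _ i A).
  by rewrite tgradB.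
pose h x : Cl := [ffun A => H A x].
have hE A : coef A h = H A by apply/funext => x; rewrite /coef ffunE.
have mOm : measurable Om := rV_open_measurable oOm.
have L2r (F : 'rV[R]_n.+1 -> R) : L2 mu F -> L2 mu (F \_ Om).
  move=> LF; rewrite (_ : F \_ Om = fun x => \1_Om x * F x); last by apply/funext => x; rewrite restrictE.
  apply: (L2_le (c := 1) _ LF) => [|x].
    by apply: measurable_funM; [exact: measurable_indic|exact: L2_mfun LF].
  by rewrite normrM ler_wpM2r// indicE; case: (_ \in _); rewrite ?normr1 ?normr0.
have nr (v F : 'rV[R]_n.+1 -> R) : v \_ Om = v -> L2 mu v -> L2 mu F ->
    nrm2 mu (fun x => v x - (F \_ Om) x) <= nrm2 mu (fun x => v x - F x).
  move=> vE Lv LF; apply: nrm2_le => [||x]; [by apply: L2B => //; exact: L2r|exact: L2B|].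
  rewrite -{1}vE !restrictE -mulrBr normrM ler_piMl// indicE.
  by case: (_ \in _); rewrite ?normr1 ?normr0.
have conv (e : R) : 0 < e -> exists N, forall j, (N <= j)%N -> forall A,
    nrm2 mu (fun x => coef A (psi j) x - (H A \_ Om) x) <= e /\
    forall i, nrm2 mu (fun x => tgrad (psi j) i A x - (G (i, A) \_ Om) x) <= e.
  move=> e0.
  have [N1 hN1] := eventually_all (fun A => (hH A).2 e e0).
  have [N2 hN2] := eventually_all (fun iA => (hG iA).2 e e0).
  exists (maxn N1 N2) => j; rewrite geq_max => /andP[/hN1 h1 /hN2 h2] A; split=> [|i].
    apply: le_trans (nr _ _ _ _ (hH A).1) (ltW (h1 A)); last exact: cltf_L2c (hpsi j) A.
    exact: tf_in_restrict (hpsi j A).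
  apply: le_trans (nr _ _ _ _ (hG (i, A)).1) (ltW (h2 (i, A))); last exact: cltf_L2 i A (hpsi j).
  exact: tf_in_partial_restrict i (hpsi j A).
have lim A : W012 Om (H A) /\ forall i, wpartial Om i (H A) \_ Om = G (i, A) \_ Om %[ae mu].
  apply: (W012_limit dOm (v := fun j => coef A (psi j)) (g := fun i => G (i, A))).
  - by move=> j; exact: hpsi j A.
  - by apply: L2r; case: (hH A).
  - by move=> i; apply: L2r; case: (hG (i, A)).
  - by move=> e /conv[N hN]; exists N => j /hN/(_ A).
have Wh : clW012 Om h by move=> A; rewrite hE; case: (lim A).
have LF := vekua_adj_L2c Wh.
have close (e : R) : 0 < e -> exists N, forall j, (N <= j)%N ->
    nrmc (T (psi j) - ext Om (vekua_adj Om alpha beta h)) <= e.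
  move=> e0; have [C C0 hC] := adjop_close.
  have C1 : 0 < C + 1 by rewrite ltr_wpDl.
  have [N hN] := conv _ (divr_gt0 e0 C1); exists N => j /hN cj.
  rewrite ext_vekua_adj.
  apply: le_trans (hC _ _ _ _ (e / (C + 1)) (cltf_L2c (hpsi j)) (clW012_L2c Wh)
    (fun i A => cltf_L2 i A (hpsi j)) (wgrad_L2 Wh) _ _) _.
  - by move=> A; rewrite coef_ext hE; case: (cj A).
  - move=> i A; have [_ /(_ i)] := cj A; apply: le_trans.
    rewrite le_eqVlt; apply/orP; left; apply/eqP; apply: nrm2_ae.
    + by apply: measurable_funB; [exact: L2_mfun (cltf_L2 i A (hpsi j))|exact: L2_mfun (wgrad_L2 Wh i A)].
    + apply: measurable_funB; first exact: L2_mfun (cltf_L2 i A (hpsi j)).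
      by apply: (L2_mfun (mu := mu)); apply: L2r; case: (hG (i, A)).
    + have [_ /(_ i)] := lim A; apply: filterS => x /(_ I) E _.
      by rewrite /wgrad hE E.
  by rewrite mulrCA ler_piMr ?(ltW e0)// ler_pdivrMr// mul1r lerDl.
exists h => //.
have extB : ext Om (fun x => f x - vekua_adj Om alpha beta h x) =
    ext Om f - ext Om (vekua_adj Om alpha beta h).
  by apply/funext => x; rewrite /ext scalerBr.
apply/(vekua_spaceP ba bb); split.
  by apply/clLp2E; rewrite extB; exact: (subspaceB L2c_subspace Lf LF).
move=> chi hchi; rewrite extB; have Lc := LT _ hchi.
set F := ext Om (vekua_adj _ _ _ _) in close LF *.
apply/eqP; rewrite -normr_le0; apply/ler_addgt0Pr => e e0; rewrite add0r.
have c1 : 0 < 1 + nrmc (T chi) + nrmc (T chi) by rewrite -addrA ltr_wpDr// addr_ge0// nrmc_ge0.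
have e1 := divr_gt0 e0 c1; set e' := e / _ in e1.
have [N1 h1] := close _ e1.
have [N2 h2] := dpsi _ e1.
have [N3 h3] := hd (T chi) (ex_intro2 _ _ chi hchi erefl) _ e1.
pose j := maxn N1 (maxn N2 N3).
have {}h1 := h1 j (leq_maxl _ _).
have {}h2 := h2 j (leq_trans (leq_maxl _ _) (leq_maxr _ _)).
have {}h3 := h3 j (leq_trans (leq_maxr _ _) (leq_maxr _ _)).
have Lp := LT _ (hpsi j); have Lq := LT _ (cphi j).
have S2 := subspaceB L2c_subspace Lp LF; have S3 := subspaceB L2c_subspace Lp Lq.
(* The three terms are the projection error at T phi_j, the distance from T psi_j to the image of h,
   and the error of the lift. *)
rewrite (inner_telescope ipc_inner Lf LF Lp Lq Lc).
have b1 := inner_CS L2c_subspace ipc_inner S2 Lc.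
have b2 := inner_CS L2c_subspace ipc_inner S3 Lc.
have n0 := nrmc_ge0 (T chi).
have d1 := ler_wpM2r n0 h1.
have d2 := ler_wpM2r n0 (ltW h2).
apply: le_trans (ler_normD _ _) _.
apply: le_trans (lerD (ltW h3) (le_trans (ler_normB _ _) (lerD (le_trans b1 d1) (le_trans b2 d2)))) _.
by rewrite -[X in X + _]mulr1 -!mulrDr addrA /e' divfK ?gt_eqF//.
Qed.

Lemma vekua_space_L2_subspace : L2_subspace Om (vekua_space Om alpha beta).
Proof.
split=> [u [Lu _] //||t u v /(vekua_spaceP ba bb)[/clLp2E Lu hu] /(vekua_spaceP ba bb)[/clLp2E Lv hv]].
  have e0 : ext Om (fun=> 0 : Cl) = 0 by apply/funext => x; rewrite /ext scaler0.
  apply/(vekua_spaceP ba bb); split; first by apply/clLp2E; rewrite e0; exact: subspace0 L2c_subspace.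
  move=> phi hphi; rewrite e0; apply: (inner0l L2c_subspace ipc_inner).
  exact: (adjtf_L2c ba bb hphi).
have eE : ext Om (fun x => t *: u x + v x) = t *: ext Om u + ext Om v.
  by apply/funext => x; rewrite /ext scalerDr !scalerA mulrC -scalerA.
apply/(vekua_spaceP ba bb); split.
  by apply/clLp2E; rewrite eE; exact: subspace_lin L2c_subspace t _ _ Lu Lv.
move=> phi hphi; rewrite eE (inner_lin ipc_inner t Lu Lv (adjtf_L2c ba bb hphi)) hu// hv//.
by rewrite mulr0 addr0.
Qed.

Lemma ext_ae u v A : u = v %[ae mu in Om] -> coef A (ext Om u) = coef A (ext Om v) %[ae mu].
Proof.
apply: filterS => x uv _; rewrite /coef; have [ox|ox] := pselect (Om x).
  by rewrite !ext_in// uv.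
by rewrite !ext_out.
Qed.

Lemma vekua_range_orth u f : vekua_space Om alpha beta u -> vekua_adj_range Om alpha beta f ->
  ipc (ext Om u) (ext Om f) = 0.
Proof.
move=> Vu [/clLp2E Lf [h Wh fh]]; rewrite -[RHS](vekua_adj_orth Wh Vu).
have [/clLp2E Lu _] := Vu; have LF := vekua_adj_L2c Wh.
apply: eq_bigr => A _; apply: ae_eq_Rintegral.
- by apply: measurable_funM; [exact: L2_mfun (Lu A)|exact: L2_mfun (Lf A)].
- by apply: measurable_funM; [exact: L2_mfun (Lu A)|exact: L2_mfun (LF A)].
- by apply: filterS (ext_ae A fh) => x /(_ I) E _; rewrite E.
Qed.

Lemma ipc_eq0_ae u : L2c (ext Om u) -> ipc (ext Om u) (ext Om u) = 0 ->
  u = (fun=> 0) %[ae mu in Om].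
Proof.
move=> Lu u0; have : {ae mu, forall x, forall A, coef A (ext Om u) x = 0}.
  apply: ae_countable => A; have : nrm2 mu (coef A (ext Om u)) = 0.
    apply/eqP; rewrite eq_le nrm2_ge0 andbT; apply: le_trans (nrm2_le_nrmc _ A) _.
    by rewrite /nrmc /nrm u0 sqrtr0.
  by move=> /(nrm2_eq0 (Lu A)); apply: filterS => x /(_ I).
apply: filterS => x h ox; apply/ffunP => A; have := h A.
by rewrite /coef ext_in// ffunE.
Qed.

(** If f is orthogonal to the Vekua space, so is the Vekua part of its decomposition, which is then
    orthogonal to itself and vanishes. Linearity of the range is read off from this description,
    since [vekua_adj] depends on the choices made in [wpartial]. *)
Lemma vekua_adj_rangeP f : vekua_adj_range Om alpha beta f <-> clLp Om 2%:E f /\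
  forall u, vekua_space Om alpha beta u -> ipc (ext Om u) (ext Om f) = 0.
Proof.
split=> [rf|[Lf hf]]; first by split=> [|u /vekua_range_orth]; [case: rf|exact].
have [h Wh Vu] := vekua_decomp Lf; split=> //; exists h => //.
have LF := vekua_adj_L2c Wh; move/clLp2E: Lf => Lf; have Lu := subspaceB L2c_subspace Lf LF.
have extB : ext Om (fun x => f x - vekua_adj Om alpha beta h x) =
    ext Om f - ext Om (vekua_adj Om alpha beta h).
  by apply/funext => x; rewrite /ext scalerBr.
have u0 : (fun x => f x - vekua_adj Om alpha beta h x) = (fun=> 0) %[ae mu in Om].
  apply: ipc_eq0_ae; rewrite extB//.
  rewrite (innerBr L2c_subspace ipc_inner Lf LF Lu) -extB.
  by rewrite hf// (vekua_adj_orth Wh Vu) subrr.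
by apply: filterS u0 => x h0 ox; apply: subr0_eq; exact: h0.
Qed.

Lemma vekua_adj_range_L2_subspace : L2_subspace Om (vekua_adj_range Om alpha beta).
Proof.
split=> [u [Lu _] //||t u v /vekua_adj_rangeP[/clLp2E Lu hu] /vekua_adj_rangeP[/clLp2E Lv hv]].
  have e0 : ext Om (fun=> 0 : Cl) = 0 by apply/funext => x; rewrite /ext scaler0.
  apply/vekua_adj_rangeP; split; first by apply/clLp2E; rewrite e0; exact: subspace0 L2c_subspace.
  move=> u [/clLp2E Lu _]; rewrite e0; exact: (inner0r L2c_subspace ipc_inner Lu).
have eE : ext Om (fun x => t *: u x + v x) = t *: ext Om u + ext Om v.
  by apply/funext => x; rewrite /ext scalerDr !scalerA mulrC -scalerA.
apply/vekua_adj_rangeP; split.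
  by apply/clLp2E; rewrite eE; exact: subspace_lin L2c_subspace t _ _ Lu Lv.
move=> w Vw; have [/clLp2E Lw _] := Vw.
by rewrite eE (inner_linr L2c_subspace ipc_inner t Lu Lv Lw) hu// hv// mulr0 addr0.
Qed.

End decomposition.

Theorem theorem11 (R : realType) (n : nat) (Om : set 'rV[R]_n.+1)
    (alpha beta : 'rV[R]_n.+1 -> clifford R n.+1) :
  bounded_lipschitz_domain Om ->
  clLp Om +oo%E alpha -> clLp Om +oo%E beta ->
  L2_orthogonal_decomposition Om
    (vekua_space Om alpha beta) (vekua_adj_range Om alpha beta).
Proof.
move=> dOm /clLp_bddc[ma ba] /clLp_bddc[mb bb].
have orth u f : vekua_space Om alpha beta u -> vekua_adj_range Om alpha beta f -> ip Om u f = 0.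
  by move=> Vu rf; rewrite ipE; [exact: vekua_range_orth dOm ba bb _ _ Vu rf|case: Vu|case: rf].
split.
- exact: (vekua_space_L2_subspace ba bb).
- exact: (vekua_adj_range_L2_subspace dOm ba bb).
- exact: orth.
- move=> f Lf; have [h Wh Vu] := vekua_decomp dOm ba bb Lf.
  exists (fun x => f x - vekua_adj Om alpha beta h x), (vekua_adj Om alpha beta h); split=> //.
    by split; [apply/clLp2E; exact: (vekua_adj_L2c ba bb Wh)|exists h => //; exact: aeW].
  by apply: aeW => x _; rewrite subrK.
- move=> f Vf rf; have [Lf _] := Vf.
  have := orth _ _ Vf rf; rewrite ipE// => f0.
  by apply: ipc_eq0_ae => //; exact/clLp2E.
Qed.
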